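(* Let $\mathbb{X}=\mathbb{R}$ with the Borel $\sigma$-field, $\lambda$ the Lebesgue measure, and $\mu$ the normal distribution $N(m,\sigma^2)$, $\sigma>0$. Suppose $P\in\mathbb{E}$ with $P_n\ll\lambda^n$ for all $n$, $|\mathbb{E}X_i|<\infty$, $\mathrm{Var}\,X_i<\infty$, and $|h_\lambda|<\infty$. Then $$\lim_{n\to\infty}\frac1n\Big[-\log\mathrm{NPD}_\mu(X_{1:n})+\Big(\sum_{i=1}^n\frac{(X_i-m)^2}{2\sigma^2}\Big)\log e\Big]+\log(\sigma\sqrt{2\pi})=h_\lambda\quad P\text{-a.s.}$$
   Context: On $\mathbb{R}^{\mathbb{Z}}$, $X_k$ are coordinate maps, $x_{j:k}=(x_j,\dots,x_k)$, $P_n(A)=P(X_{1:n}\in A)$, $P_\lambda=dP_n/d\lambda^n$. $\mathbb{E}$: shift-stationary ergodic probability measures; $h_\lambda=\lim_n\mathbb{E}[-\log P_\lambda(X_{1:n})]/n$ (differential entropy rate). NPD density w.r.t. $\mu$: fix finite $\sigma$-fields $\mathcal{X}_0\subset\mathcal{X}_1\subset\cdots$ on $\mathbb{R}$ with $\mathcal{X}_0=\{\emptyset,\mathbb{R}\}$ generating the Borel $\sigma$-field; let $\chi_l$ be the finite partition generating $\mathcal{X}_l$; $x^l$ is the cell of $\chi_l$ containing $x$, $x^l_{1:n}=(x^l_1,\dots,x^l_n)$. Treat $\chi_l$ as a finite alphabet and let $R^l$ be a probability measure on $\chi_l^{\mathbb{Z}}$ universal with respect to the alphabet $\chi_l$ (for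 every stationary ergodic process $(Y_i)$ over $\chi_l$ with Shannon entropy rate $H$, $-\frac1n\log R^l(Y_{1:n})\to H$ a.s., in expectation and in probability). $\mathrm{NPD}^l_\mu(x_{1:n})=R^l(x^l_{1:n})/\prod_{i=1}^n\mu(x^l_i)$, $\mathrm{NPD}_\mu(x_{1:n})=\sum_{l\ge0}w_l\mathrm{NPD}^l_\mu(x_{1:n})$, $w_l=\frac1{l+1}-\frac1{l+2}$. *)

(* Defs.v *)
From HB Require Import structures.
From mathcomp Require Import all_boot all_order all_algebra.
From mathcomp Require Import all_classical all_reals all_analysis.
Set Implicit Arguments.
Unset Strict Implicit.
Unset Printing Implicit Defensive.
Import Order.TTheory GRing.Theory Num.Def Num.Theory.
Import numFieldTopology.Exports.
Local Open Scope classical_set_scope.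
Local Open Scope ring_scope.

Definition block {T : Type} (n : nat) (w : int -> T) : n.-tuple T :=
  [tuple w (Posz i.+1) | i < n].

Section path_space.
Context {d : measure_display} (T : measurableType d).

Definition cylinders : set (set (int -> T)) :=
  [set A | exists k : int, exists2 B : set T, measurable B &
     A = (fun w : int -> T => w k) @^-1` B].

Definition pathspace := g_sigma_algebraType cylinders.

Definition shift (w : pathspace) : pathspace := fun k => w (k + 1)%R.


Context {R : realType}.
Definition stationary (P : probability pathspace R) : Prop :=
  forall A : set pathspace, measurable A -> P (shift @^-1` A) = P A.
Definition ergodic (P : probability pathspace R) : Prop :=
  forall A : set pathspace, measurable A -> shift @^-1` A = A ->
    P A = 0%E \/ P A = 1%E.
Definition stationary_ergodic (P : probability pathspace R) : Prop :=
  stationary P /\ ergodic P.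
End path_space.

(* ---------- finite alphabets: symbols 0, ..., K-1 embedded in nat ---------- *)
Section finite_alphabet.
Context {R : realType}.
Local Open Scope ereal_scope.

Definition word_cyl (n : nat) (u : n.-tuple nat) : set (pathspace nat) :=
  [set w | block n w = u].

Definition supported_on (K : nat) (P : probability (pathspace nat) R) : Prop :=
  forall k : int, P [set w : pathspace nat | (w k < K)%N] = 1.

Definition block_entropy (K : nat) (P : probability (pathspace nat) R)
    (n : nat) : R :=
  (- \sum_(u : n.-tuple 'I_K)
      (let p := fine (P (word_cyl (map_tuple (@nat_of_ord K) u))) in
       p * ln p))%R.

Definition universal (K : nat) (Q : probability (pathspace nat) R) : Prop :=
  supported_on K Q /\
  forall (P : probability (pathspace nat) R) (H : R),
    stationary_ergodic P -> supported_on K P ->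
    (fun n : nat => (n.+1%:R^-1 * block_entropy K P n.+1)%R) @ \oo --> H ->
    let Z := fun (n : nat) (w : pathspace nat) =>
      - ((n.+1%:R^-1)%:E * lne (Q (word_cyl (block n.+1 w)))) in
    [/\ {ae P, forall w, (fun n => Z n w) @ \oo --> H%:E},
        (fun n => \int[P]_w Z n w) @ \oo --> H%:E &
        forall e : R, (0 < e)%R ->
          (fun n => P [set w | e%:E <= `|Z n w - H%:E|]) @ \oo --> 0].
End finite_alphabet.

(* chi_l = { q l @^-1` [set i] | i < K l }, the cell of x is indexed by q l x *)
Definition nested_partitions {R : realType} (K : nat -> nat)
    (q : nat -> R -> nat) : Prop :=
  [/\ K 0%N = 1%N,
      forall l x, (q l x < K l)%N,
      forall l i, (i < K l)%N -> exists x, q l x = i,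
      forall l x y, q l.+1 x = q l.+1 y -> q l x = q l y &
      <<s [set q l @^-1` [set i] | l in [set: nat] & i in [set: nat]] >>
        = (measurable : set (set R))].

Fixpoint lebesgue_n {R : realType} (n : nat) : set (n.-tuple R) -> \bar R :=
  match n return set (n.-tuple R) -> \bar R with
  | 0%N => fun A => (\1_A [tuple] : R)%:E
  | n'.+1 => fun A =>
      (\int[@lebesgue_measure R]_x lebesgue_n [set t | A (cons_tuple x t)])%E
  end.

Section NPD.
Context {R : realType} (m s : R) (K : nat -> nat) (q : nat -> R -> nat)
  (Q : nat -> probability (pathspace nat) R).

Definition mu_cell (l : nat) (x : R) : R :=
  fine (normal_prob m s (q l @^-1` [set q l x])).

Definition NPD_l (l n : nat) (t : n.-tuple R) : R :=
  fine (Q l (word_cyl (map_tuple (q l) t))) / \prod_(i < n) mu_cell l (tnth t i).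

Definition npd_weight (l : nat) : R := l.+1%:R^-1 - l.+2%:R^-1.

Definition NPD (n : nat) (t : n.-tuple R) : \bar R :=
  (\sum_(0 <= l <oo) (npd_weight l * NPD_l l t)%:E)%E.
End NPD.

(* Main.v *)
Require Import Defs.
From HB Require Import structures.
From mathcomp Require Import all_boot all_order all_algebra.
From mathcomp Require Import all_classical all_reals all_analysis measurable_realfun.
From mathcomp Require Import ring lra.
Set Implicit Arguments.
Unset Strict Implicit.
Unset Printing Implicit Defensive.
Import Order.TTheory GRing.Theory Num.Def Num.Theory.
Import numFieldTopology.Exports.
Local Open Scope classical_set_scope.
Local Open Scope ring_scope.

(* Let mu = N(m, s^2), p_n = dP_n/dmu^n and V = E (X_1 - m)^2 / (2 s^2). By
   Birkhoff's theorem for (X_i - m)^2 the claim is that (1/n) log NPD(X_{1:n})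
   converges to D := - h_lambda + V + log (s sqrt(2 pi)) = lim (1/n) E log p_n.

   Not above D: NPD is a sub-density G with respect to every mu^n. If
   G(X_{1:n}) >= e^{nc} held infinitely often with positive probability for
   some c > D, then by ergodicity almost every position of a long path would
   start a block on which a shift mixture of G is at least e^{nc'}, c' > D. A
   mixture over all parsings of X_{1:N} into single letters and such blocks is
   again a sub-density, of expected logarithm at least N (c' - o(1)): this
   contradicts Gibbs' inequality E log G <= E log p_N.

   Not below D: NPD >= w_l NPD^l, and by universality and Birkhoff's theorem
   (1/n) log NPD^l tends to - H_l - E log mu(X_1^l), where H_l is at most the
   N-block entropy divided by N for every N. As l grows, a truncation of p_N is
   approximated in L^1 by functions of the level-l cells; inserted in Gibbs'
   inequality for the words of cells they give
   sup_l (- H_l - E log mu(X_1^l)) >= (1/N) E log p_N. *)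

(** The usual way to the upper bound is almost sure convergence of (1/n) log p_n, followed by
    Markov's inequality and the Borel-Cantelli lemma. Here only expectations of log p_n are
    controlled, since the hypothesis on h_lambda speaks of expectations. The parsing argument closes
    this gap: it turns pathwise growth of a sub-density into a sub-density with a large expected
    logarithm, and Gibbs' inequality needs log p_n only in the mean.

    The reference is the probability mu rather than Lebesgue measure. A single letter then has
    density 1, so a position outside the blocks costs no more than its mixture weight, and D >= 0.
    In the lower bound the approximation has to be good for two measures at once: for mu^n, to keep
    the approximant nearly normalized, and for P_n, to keep its expected logarithm.

    Integrands, densities and word probabilities are functions on untyped finite sequences, so that
    cutting a word in two involves no casts between tuple types. *)

Lemma Rintegral_prob_cst d (X : measurableType d) (R : realType)
  (P : probability X R) (c : R) : \int[P]_x c = c.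
Proof. by rewrite Rintegral_cst// [X in fine X](probability_setT P) mulr1. Qed.

Lemma integrable_prob_cst d (X : measurableType d) (R : realType)
  (P : probability X R) (c : R) : P.-integrable setT (EFin \o (fun=> c)).
Proof. exact: finite_measure_integrable_cst. Qed.

(* The next three are [filterS], [filterS2] and [ae_foralln] for a probability:
   on path spaces the [Filter] instance is not always found by unification. *)
Lemma ae_mono d (X : measurableType d) (R : realType) (P : probability X R)
  (A B : X -> Prop) : (forall x, A x -> B x) ->
  {ae P, forall x, A x} -> {ae P, forall x, B x}.
Proof. by move=> AB; apply: filterS => x; exact: AB. Qed.

Lemma ae_mono2 d (X : measurableType d) (R : realType) (P : probability X R)
  (A B C : X -> Prop) : (forall x, A x -> B x -> C x) ->
  {ae P, forall x, A x} -> {ae P, forall x, B x} -> {ae P, forall x, C x}.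
Proof. by move=> ABC; apply: filterS2 => x; exact: ABC. Qed.

Lemma ae_all d (X : measurableType d) (R : realType) (P : probability X R)
  (A : nat -> X -> Prop) : (forall n, {ae P, forall x, A n x}) ->
  {ae P, forall x n, A n x}.
Proof. exact: ae_foralln. Qed.

Lemma prodr_gt0_mem {R : realType} (I : eqType) (r : seq I) (F : I -> R) :
  {in r, forall i, 0 < F i} -> 0 < \prod_(i <- r) F i.
Proof. by move=> F0; rewrite big_seq_cond; apply: prodr_gt0 => i /andP[/F0]. Qed.

Lemma ln_prod {R : realType} (I : eqType) (r : seq I) (F : I -> R) :
  {in r, forall i, 0 < F i} -> ln (\prod_(i <- r) F i) = \sum_(i <- r) ln (F i).
Proof.
elim: r => [|i r IH] F0; first by rewrite !big_nil ln1.
have Fr : {in r, forall j, 0 < F j} by move=> j jr; rewrite F0// in_cons jr orbT.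
by rewrite !big_cons lnM ?posrE ?F0 ?mem_head ?prodr_gt0_mem// IH.
Qed.

(** * Measurability and stationarity on the path space *)

Section path_space_measurability.
Context {d : measure_display} {T : measurableType d}.

Lemma measurable_coord (k : int) :
  measurable_fun [set: pathspace T] (fun w : pathspace T => w k).
Proof.
move=> _ B mB; rewrite setTI; apply: sub_sigma_algebra.
by exists k, B.
Qed.

Lemma measurable_to_pathspace d' (X : measurableType d') (g : X -> pathspace T) :
  (forall k, measurable_fun [set: X] (fun x => g x k)) ->
  measurable_fun [set: X] g.
Proof.
move=> mg; apply: (@measurability _ _ _ _ setT g (@cylinders d T)) => //.
move=> _ [_ [k [B mB ->]] <-].
by rewrite setTI -[X in measurable X]setTI; exact: (mg k _ B mB).
Qed.

Lemma measurable_shift : measurable_fun [set: pathspace T] (@Defs.shift d T).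
Proof. by apply: measurable_to_pathspace => k; exact: measurable_coord. Qed.

HB.instance Definition _ :=
  isMeasurableFun.Build _ _ _ _ (@Defs.shift d T) measurable_shift.

Lemma iter_shiftE n (w : pathspace T) k : iter n (@Defs.shift d T) w k = w (k + n%:Z).
Proof.
elim: n k => [|n IH] k; first by rewrite addr0.
by rewrite iterS /Defs.shift IH -addrA -PoszD add1n.
Qed.

Lemma measurable_iter_shift n :
  measurable_fun [set: pathspace T] (iter n (@Defs.shift d T)).
Proof.
elim: n => [|n IH]; first exact: measurable_id.
rewrite (_ : iter n.+1 _ = @Defs.shift d T \o iter n (@Defs.shift d T))//.
by apply: measurableT_comp => //; exact: measurable_shift.
Qed.

Lemma measurable_block n : measurable_fun [set: pathspace T] (@block T n).
Proof.
apply/measurable_fun_tnthP => i.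
rewrite (_ : _ \o _ = fun w : pathspace T => w (Posz i.+1)).
  exact: measurable_coord.
by apply/funext => w /=; rewrite tnth_mktuple.
Qed.

Definition path_block n (w : pathspace T) : n.-tuple T := block n w.

HB.instance Definition _ n :=
  isMeasurableFun.Build _ _ _ _ (path_block n) (@measurable_block n).

End path_space_measurability.

Lemma measurable_block_comp d d' (T : measurableType d) (T' : measurableType d')
    n (G : n.-tuple T -> T') : measurable_fun [set: n.-tuple T] G ->
  measurable_fun [set: pathspace T] (fun w => G (block n w)).
Proof. by move=> mG; apply: measurableT_comp => //; exact: measurable_block. Qed.

Section stationary_process.
Context {d : measure_display} {T : measurableType d} {R : realType}.
Variable P : probability (pathspace T) R.
Hypothesis statP : stationary P.
Local Notation S := (@Defs.shift d T).

Lemma ge0_integral_shift (F : pathspace T -> \bar R) :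
  measurable_fun setT F -> (forall w, 0 <= F w)%E ->
  (\int[P]_w F (S w) = \int[P]_w F w)%E.
Proof.
move=> mF F0.
rewrite -[LHS](@ge0_integral_distribution _ _ _ _ _ P S F)//.
by apply: eq_measure_integral => A mA _; exact: statP.
Qed.

Lemma integrable_shift (F : pathspace T -> R) :
  P.-integrable setT (EFin \o F) -> P.-integrable setT (EFin \o F \o S).
Proof.
move=> /integrableP[mF iF]; apply/integrableP; split.
  by apply: measurableT_comp => //; exact: measurable_shift.
rewrite (ge0_integral_shift (F := fun w => `|(F w)%:E|%E))//.
exact: measurableT_comp.
Qed.

Lemma Rintegral_shift (F : pathspace T -> R) :
  P.-integrable setT (EFin \o F) ->
  \int[P]_w F (S w) = \int[P]_w F w.
Proof.
move=> iF; rewrite /Rintegral; congr fine.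
have iF' := integrable_shift iF.
rewrite -[LHS](@integral_distribution _ _ _ _ _ P S (EFin \o F))//; last first.
  exact: measurable_int iF.
by apply: eq_measure_integral => A mA _; exact: statP.
Qed.

Lemma integrable_iter_shift (F : pathspace T -> R) n :
  P.-integrable setT (EFin \o F) ->
  P.-integrable setT (EFin \o (fun w => F (iter n S w))).
Proof.
move=> iF; elim: n => [//|n IH].
have := integrable_shift IH; apply: eq_integrable => // w _ /=.
by rewrite -iterSr.
Qed.

Lemma Rintegral_iter_shift (F : pathspace T -> R) n :
  P.-integrable setT (EFin \o F) ->
  \int[P]_w F (iter n S w) = \int[P]_w F w.
Proof.
move=> iF; elim: n => [//|n IH].
rewrite -IH -[RHS]Rintegral_shift; last exact: integrable_iter_shift.
by apply: eq_Rintegral => w _; rewrite -iterSr.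
Qed.

End stationary_process.

(** * Birkhoff's ergodic theorem *)

Section birkhoff.
Context {d : measure_display} {T : measurableType d} {R : realType}.
Variable P : probability (pathspace T) R.
Hypothesis ergP : stationary_ergodic P.
Local Notation S := (@Defs.shift d T).
Let statP := ergP.1.

Section maximal.
Variable G : pathspace T -> R.
Hypothesis iG : P.-integrable setT (EFin \o G).

Let bsum n w := \sum_(i < n) G (iter i S w).

Let bsumS n w : bsum n.+1 w = G w + bsum n (S w).
Proof.
rewrite /bsum big_ord_recl; congr (_ + _).
by apply: eq_bigr => i _; rewrite -iterSr.
Qed.

(** Unrolled, this is max(0, B_1, ..., B_n) for the ergodic sums B_k = [bsum k] of [G]. The
    recursive form exhibits the relation with the shifted path on which the maximal argument
    rests. *)
Fixpoint running_max n w : R :=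
  if n is n'.+1 then Num.max 0 (G w + running_max n' (S w)) else 0.

Lemma running_max_ge0 n w : 0 <= running_max n w.
Proof. by case: n => //= n; rewrite le_max lexx. Qed.

Lemma running_max_nd n w : running_max n w <= running_max n.+1 w.
Proof.
elim: n w => [w|n IH w]; first by rewrite /= le_max lexx.
rewrite /= ge_max !le_max lexx/=; apply/orP; right.
by rewrite lerD2l; exact: IH.
Qed.

Let bsum_le_running_max n w : bsum n w <= running_max n w.
Proof.
elim: n w => [w|n IH w]; first by rewrite /bsum big_ord0.
by rewrite bsumS /= le_max lerD2l IH orbT.
Qed.

Lemma integrable_running_max n : P.-integrable setT (EFin \o running_max n).
Proof.
elim: n => [|n IH]; first exact: integrable0.
have iS : P.-integrable setT (EFin \o (fun w => G w + running_max n (S w))).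
  rewrite (_ : _ \o _ = (EFin \o G) \+ (EFin \o running_max n \o S))%E.
    by apply: integrableD => //; exact: integrable_shift.
  by apply/funext.
apply: (le_integrable _ _ _ iS) => //.
  apply/measurable_EFinP; apply: measurable_maxr => //.
  by apply/measurable_EFinP; exact: measurable_int iS.
move=> w _ /=; rewrite lee_fin.
by case: (leP 0 (G w + running_max n (S w))) => h0 //; rewrite normr0.
Qed.

(** The event that the sums are unbounded above is invariant, so it has probability 0 or 1. If it
    had probability 1, then M_(n+1) - M_n o S, with M = [running_max], would tend to [G] almost
    everywhere. Its integral is nonnegative by stationarity and monotonicity of M_n in n, which
    would make the integral of [G] nonnegative. *)
Lemma ergodic_birkhoff_bounded : \int[P]_w G w < 0 ->
  {ae P, forall w, exists M, forall n, bsum n w <= M}.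
Proof.
move=> G0.
pose A := [set w | forall k : nat, exists n, k%:R < bsum n w].
have mbsum n : measurable_fun setT (bsum n).
  apply: measurable_sum => i; apply/measurable_EFinP.
  by have /measurable_int := integrable_iter_shift statP i iG.
have mA : measurable A.
  rewrite (_ : A = \bigcap_(k in [set: nat]) \bigcup_(n in [set: nat])
      (bsum n @^-1` `]k%:R, +oo[)).
    apply: bigcapT_measurable => k; apply: bigcupT_measurable => n.
    by rewrite -[X in measurable X]setTI; exact: mbsum.
  apply/seteqP; split => w /=.
    by move=> Aw k _; have [n kn] := Aw k; exists n => //=; rewrite in_itv/= kn.
  move=> Aw k; have [n _ /=] := Aw k I; rewrite in_itv/= andbT => kn.
  by exists n.
(* The sums along w and S w differ by the finite number [G w], so they are unbounded together. *)
have invA : S @^-1` A = A.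
  have archi (x : R) : exists k : nat, x <= k%:R.
    by exists (truncn x).+1; exact/ltW/truncnS_gt.
  apply/seteqP; split => w /= Aw k.
  - have [k' hk'] := archi (k%:R - G w).
    have [n kn] := Aw k'; exists n.+1; rewrite bsumS.
    by rewrite -ltrBlDl (le_lt_trans hk').
  - have [k' hk'] := archi (Num.max 0 (k%:R + G w)).
    have [[|n]] := Aw k'.
      by rewrite /bsum big_ord0 ltNge ler0n.
    move=> kn; exists n.
    move: kn; rewrite bsumS => kn; rewrite -(ltrD2l (G w)); apply: le_lt_trans kn.
    by move: hk'; rewrite ge_max addrC => /andP[].
have [A0|A1] := ergP.2 A mA invA.
  exists A; split => // w /= nbd k; apply: contrapT => nex; apply: nbd.
  exists k%:R => n; rewrite leNgt; apply/negP => kn; apply: nex; by exists n.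
exfalso.
have aeA : {ae P, forall w, A w}.
  exists (~` A); split => //; first exact: measurableC.
  by rewrite probability_setC// A1 subee.
(* [g n] is M_(n+1) - M_n o S in a form that shows its limit: once M_n (S w) exceeds - G w it equals
   [G w]. Moreover |g n| <= |G|, which is the domination needed below. *)
pose g n w := Num.max (- running_max n (S w)) (G w).
have gE n w : g n w = running_max n.+1 w - running_max n (S w).
  by rewrite /g /= addr_maxl add0r addrK.
have iRS n : P.-integrable setT (EFin \o (fun w => running_max n (S w))).
  exact: (integrable_shift statP (integrable_running_max n)).
have ig n : P.-integrable setT (EFin \o g n).
  rewrite (_ : EFin \o g n = (EFin \o running_max n.+1) \-
      (EFin \o (fun w => running_max n (S w))))%E; last first.
    by apply/funext => w /=; rewrite gE EFinB.
  by apply: integrableB => //; exact: integrable_running_max.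
have g_ge0 n : 0 <= \int[P]_w g n w.
  rewrite (_ : \int[P]_w g n w =
      \int[P]_w (running_max n.+1 w - running_max n (S w))); last first.
    by apply: eq_Rintegral => w _; rewrite gE.
  rewrite RintegralB//; last exact: integrable_running_max.
  rewrite (Rintegral_shift statP); last exact: integrable_running_max.
  rewrite subr_ge0; apply: le_Rintegral => //.
  - exact: integrable_running_max.
  - exact: integrable_running_max.
  - by move=> w _; exact: running_max_nd.
have [_ _ cvgI] : [/\ P.-integrable setT (EFin \o G),
   [sequence \int[P]_w `|(EFin \o g n) w - (EFin \o G) w|]_n @ \oo --> 0 &
   [sequence \int[P]_w (EFin \o g n) w]_n @ \oo --> \int[P]_w (EFin \o G) w]%E.
  apply: (@dominated_convergence _ _ _ P setT measurableT _ _
    (abse \o (EFin \o G))).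
  - by move=> n; exact: measurable_int (ig n).
  - exact: measurable_int iG.
  - apply: filterS aeA => w Aw _.
    have /(_ _) : A (S w) by rewrite -[A]invA in Aw.
    move=> ASw; apply: cvg_near_cst.
    have [k kG] : exists k : nat, - G w <= k%:R.
      by exists (truncn (- G w)).+1; exact/ltW/truncnS_gt.
    have [n0 kn0] := ASw k.
    exists n0 => // n /= n0n; rewrite /g max_r//.
    rewrite lerNl (le_trans kG)// (le_trans (ltW kn0))//.
    rewrite (le_trans (bsum_le_running_max _ _))//.
    move: n0n; elim: n => [|n IH]; first by rewrite leqn0 => /eqP ->.
    rewrite leq_eqVlt => /predU1P[->//|]; rewrite ltnS => /IH /le_trans -> //.
    exact: running_max_nd.
  - exact: integrable_abse.
  - apply/aeW => w n _; rewrite lee_fin /g.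
    have := running_max_ge0 n (S w).
    rewrite /Num.max; case: ifPn => //.
    rewrite -leNgt => h1 h2.
    by rewrite !ler0_norm ?oppr_le0// ?lerN2// (le_trans h1)// oppr_le0.
have : (0 <= \int[P]_w (G w)%:E)%E.
  rewrite -(cvg_lim _ cvgI)//; apply: lime_ge.
    by apply/cvg_ex; eexists; exact: cvgI.
  apply: nearW => n; rewrite -[leRHS]fineK; first by rewrite lee_fin; exact: g_ge0.
  exact: integrable_fin_num.
rewrite -[leRHS]fineK; last exact: integrable_fin_num.
by rewrite lee_fin leNgt => /negP; apply.
Qed.

End maximal.

Local Notation avg F w := (fun n : nat => n.+1%:R^-1 * \sum_(i < n.+1) F (iter i S w)).

(** Recentering by the mean plus e / 2 makes the integral negative, so the recentered sums stay
    below some M; the remaining M / n is absorbed by the other e / 2. *)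
Lemma ergodic_limsup_le (F : pathspace T -> R) (e : R) : 0 < e ->
  P.-integrable setT (EFin \o F) ->
  {ae P, forall w, \forall n \near \oo,
     n.+1%:R^-1 * \sum_(i < n.+1) F (iter i S w) <= \int[P]_w F w + e}.
Proof.
move=> e0 iF; set E := \int[P]_w F w.
have ic := integrable_prob_cst P.
have iG : P.-integrable setT (EFin \o (fun w => F w - (E + e / 2))).
  rewrite (_ : _ \o _ = (EFin \o F) \- (EFin \o (fun=> (E + e / 2)%R)))%E.
    exact: integrableB.
  by apply/funext.
have G0 : \int[P]_w (F w - (E + e / 2)) < 0.
  rewrite RintegralB// (Rintegral_prob_cst P) -/E.
  by lra.
apply: filterS (ergodic_birkhoff_bounded iG G0) => w [M bM].
pose N := truncn (M / (e / 2)).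
exists N => // n /= Nn.
have := bM n.+1; rewrite big_split/= sumr_const card_ord -mulr_natl => hM.
have n0 : 0 < n.+1%:R :> R by rewrite ltr0n.
rewrite mulrC ler_pdivrMr//.
have : M < n.+1%:R * (e / 2).
  rewrite -ltr_pdivrMr; last by lra.
  by apply: lt_le_trans (truncnS_gt _) _; rewrite ler_nat ltnS.
by nra.
Qed.

(** The one-sided bound is applied to F and to - F, with tolerances 1 / (k + 1) so that countably
    many null sets suffice. *)
Theorem birkhoff (F : pathspace T -> R) :
  P.-integrable setT (EFin \o F) ->
  {ae P, forall w, avg F w @ \oo --> \int[P]_w F w}.
Proof.
move=> iF.
have iNF : P.-integrable setT (EFin \o (fun w => - F w)).
  rewrite (_ : _ \o _ = \- (EFin \o F))%E; first exact: integrableN.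
  by apply/funext.
have up k := ergodic_limsup_le (e := k.+1%:R^-1) ltac:(by rewrite invr_gt0) iF.
have lo k := ergodic_limsup_le (e := k.+1%:R^-1) ltac:(by rewrite invr_gt0) iNF.
apply: filterS2 (ae_foralln up) (ae_foralln lo) => w hup hlo.
apply/cvgrPdist_le => e e0.
have [k ke] : exists k, k.+1%:R^-1 <= e :> R.
  exists (truncn e^-1); rewrite invf_ple ?posrE//.
  exact/ltW/truncnS_gt.
apply: filterS2 (hup k) (hlo k) => n h1 h2.
have EN : \int[P]_w (- F w) = - \int[P]_w F w.
  rewrite -mulN1r -RintegralZl//.
  by apply: eq_Rintegral => v _; rewrite mulN1r.
rewrite EN sumrN mulrN in h2.
move: ke h1 h2; set c := k.+1%:R^-1; set A := n.+1%:R^-1 * _ => ke h1 h2.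
rewrite ler_norml; apply/andP; split; lra.
Qed.

End birkhoff.

(** * Integration against a density *)

Section change_of_density.
Local Open Scope ereal_scope.
Context d (X : measurableType d) (R : realType).
Variables (nu m : {measure set X -> \bar R}) (g : X -> R).
Hypothesis mg : measurable_fun setT g.
Hypothesis g0 : forall x, (0 <= g x)%R.
Hypothesis nuE : forall A, measurable A -> nu A = \int[m]_(x in A) (g x)%:E.

Import HBNNSimple.

Let indic_dens A : measurable A ->
  \int[nu]_x (\1_A x)%:E = \int[m]_x ((\1_A x)%:E * (g x)%:E).
Proof.
move=> mA; rewrite integral_indic// setIT nuE// integral_mkcond.
apply: eq_integral => x _; rewrite patchE indicE.
by case: ifPn => _; rewrite ?mul1e ?mul0e.
Qed.

Let nnsfun_dens (h : {nnsfun X >-> R}) :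
  \int[nu]_x (h x)%:E = \int[m]_x ((h x)%:E * (g x)%:E).
Proof.
under [LHS]eq_integral do rewrite fimfunE -fsumEFin//.
rewrite [LHS]ge0_integral_fsum//; last 2 first.
  - by move=> r; exact/measurable_EFinP/measurableT_comp.
  - by move=> n x _; rewrite EFinM nnfun_muleindic_ge0.
under [RHS]eq_integral.
  move=> x xD; rewrite fimfunE -fsumEFin// ge0_mule_fsuml; last first.
    by move=> r; rewrite EFinM nnfun_muleindic_ge0.
  over.
rewrite [RHS]ge0_integral_fsum//; last 2 first.
  - move=> r; apply: emeasurable_funM; last exact/measurable_EFinP.
    by apply/measurable_EFinP; exact: measurableT_comp.
  - by move=> n x _; apply: mule_ge0; rewrite ?EFinM ?nnfun_muleindic_ge0 ?lee_fin.
apply: eq_fsbigr => r /[!inE] -[x _ <-].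
have h0 : (0 <= h x)%R by [].
have mI : measurable (h @^-1` [set h x]) by [].
transitivity ((h x)%:E * \int[nu]_y (\1_(h @^-1` [set h x]) y)%:E).
  under eq_integral do rewrite EFinM.
  by rewrite ge0_integralZl//; exact/measurable_EFinP.
rewrite indic_dens// -ge0_integralZl//.
- by apply: eq_integral => y _; rewrite EFinM muleA.
- by apply: emeasurable_funM => //; exact/measurable_EFinP.
- by move=> y _; rewrite mule_ge0// lee_fin.
Qed.

(** Indicators, simple functions, then monotone limits. The density is given by its formula on
    measurable sets, so the same lemma serves for [normal_prob], its powers and the block laws. *)
Lemma ge0_integral_density (F : X -> \bar R) :
  measurable_fun setT F -> (forall x, 0 <= F x) ->
  \int[nu]_x F x = \int[m]_x (F x * (g x)%:E).
Proof.
move=> mF F0.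
pose f_ := nnsfun_approx measurableT mF.
transitivity (limn (fun n => \int[nu]_x (f_ n x)%:E)).
  rewrite -monotone_convergence//=.
  - apply: eq_integral => ? /[!inE] xD; apply/esym/cvg_lim => //=.
    exact: cvg_nnsfun_approx.
  - by move=> n; exact/measurable_EFinP/measurable_funTS.
  - by move=> n ? _; rewrite lee_fin.
  - by move=> ? _ ? ? mn; rewrite lee_fin; exact/lefP/nd_nnsfun_approx.
transitivity (limn (fun n => \int[m]_x ((f_ n x)%:E * (g x)%:E))); last first.
  rewrite -monotone_convergence//=.
  - apply: eq_integral => x /[!inE] xD; apply/cvg_lim => //=.
    by apply: cvgeZr => //; exact: cvg_nnsfun_approx.
  - by move=> n; apply: emeasurable_funM => //; exact/measurable_EFinP/measurable_funTS.
  - by move=> n x _; rewrite mule_ge0// lee_fin.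
  - move=> x _ a b ab; rewrite lee_wpmul2r ?lee_fin//.
    exact/lefP/nd_nnsfun_approx.
by apply: congr_lim; apply/funext => n; exact: nnsfun_dens.
Qed.

End change_of_density.

(** * Iterated integrals and block densities *)

Section iterated_integral.
Local Open Scope ereal_scope.
Context d (X : measurableType d) (R : realType).
Variable mu : {sigma_finite_measure set X -> \bar R}.

(** The integral against mu^n in iterated form. With the integrand on [seq X] the recursion only
    prepends letters; measurability is required separately for each length, by [mseq]. *)
Fixpoint itint n (G : seq X -> \bar R) : \bar R :=
  if n is n'.+1 then \int[mu]_x itint n' (fun s => G (x :: s)) else G [::].

Definition mseq n (G : seq X -> \bar R) :=
  measurable_fun [set: n.-tuple X] (fun t => G t).

Lemma itint_ge0 n G : (forall s, 0 <= G s) -> 0 <= itint n G.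
Proof. by elim: n G => [|n IH] G G0 /=; [exact: G0|apply: integral_ge0 => x _; exact: IH]. Qed.

(** The parameter space [Y] makes the induction work: at each step the outermost integration
    variable joins the parameter, and Tonelli's theorem gives measurability of one more integral. *)
Lemma measurable_itint d' (Y : measurableType d') n (G : Y -> seq X -> \bar R) :
  measurable_fun [set: Y * n.-tuple X] (fun p => G p.1 p.2) ->
  (forall y s, 0 <= G y s) ->
  measurable_fun [set: Y] (fun y => itint n (G y)).
Proof.
elim: n d' Y G => [|n IH] d' Y G mG G0 /=.
  pose c : Y -> Y * 0.-tuple X := fun y => (y, [tuple]).
  rewrite (_ : (fun y => _) = (fun p : Y * 0.-tuple X => G p.1 p.2) \o c)//.
  apply: measurableT_comp => //; exact: measurable_fun_pair.
pose H (p : Y * X) s := G p.1 (p.2 :: s).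
apply: (@measurable_fun_fubini_tonelli_F _ _ Y X R mu (fun p => itint n (H p))).
  apply: IH; last by move=> *; exact: G0.
  pose c (p : (Y * X) * n.-tuple X) : Y * n.+1.-tuple X :=
    (p.1.1, [the n.+1.-tuple X of p.1.2 :: p.2]).
  rewrite (_ : (fun p => _) = (fun p : Y * n.+1.-tuple X => G p.1 p.2) \o c)//.
  apply: measurableT_comp => //; apply: measurable_fun_pair => /=.
    exact: measurableT_comp.
  apply: measurable_cons => //; exact: measurableT_comp.
by move=> p; apply: itint_ge0 => s; exact: G0.
Qed.

Lemma mseq_cons n G : mseq n.+1 G ->
  measurable_fun [set: X * n.-tuple X] (fun p => G (p.1 :: p.2)).
Proof.
move=> mG; pose c (p : X * n.-tuple X) := [the n.+1.-tuple X of p.1 :: p.2].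
rewrite (_ : (fun p => _) = (fun t : n.+1.-tuple X => G t) \o c)//.
by apply: measurableT_comp => //; exact: measurable_cons.
Qed.

Lemma mseq_cons1 n G x : mseq n.+1 G -> mseq n (fun s => G (x :: s)).
Proof.
move=> /mseq_cons mG; rewrite /mseq.
rewrite (_ : (fun t => _) = (fun p : X * n.-tuple X => G (p.1 :: p.2)) \o pair x)//.
by apply: measurableT_comp => //; exact: measurable_fun_pair.
Qed.

Lemma measurable_itint_cons n G : mseq n.+1 G -> (forall s, 0 <= G s) ->
  measurable_fun [set: X] (fun x => itint n (fun s => G (x :: s))).
Proof. by move=> mG G0; apply: measurable_itint => //; exact: mseq_cons. Qed.

Lemma eq_itint n F G : (forall s, size s = n -> F s = G s) ->
  itint n F = itint n G.
Proof.
elim: n F G => [|n IH] F G FG /=; first exact: FG.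
by apply: eq_integral => x _; apply: IH => s sn; apply: FG; rewrite /= sn.
Qed.

Lemma le_itint n F G : mseq n F -> mseq n G -> (forall s, 0 <= F s) ->
  (forall s, 0 <= G s) -> (forall s, size s = n -> F s <= G s) ->
  itint n F <= itint n G.
Proof.
elim: n F G => [|n IH] F G mF mG F0 G0 FG /=; first exact: FG.
apply: ge0_le_integral => //.
- by move=> x _; apply: itint_ge0 => s; exact: F0.
- exact: measurable_itint_cons.
- exact: measurable_itint_cons.
- move=> x _; apply: IH => //; [exact: mseq_cons1|exact: mseq_cons1|].
  by move=> s sn; apply: FG; rewrite /= sn.
Qed.

Lemma itintD n F G : mseq n F -> mseq n G -> (forall s, 0 <= F s) ->
  (forall s, 0 <= G s) ->
  itint n (fun s => F s + G s) = itint n F + itint n G.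
Proof.
elim: n F G => [//|n IH] F G mF mG F0 G0 /=.
under eq_integral => x _.
  by rewrite (IH (fun s => F (x :: s)) (fun s => G (x :: s)));
    [over|exact: mseq_cons1|exact: mseq_cons1|by move=> *|by move=> *].
rewrite ge0_integralD//.
- by move=> x _; apply: itint_ge0 => s; exact: F0.
- exact: measurable_itint_cons.
- by move=> x _; apply: itint_ge0 => s; exact: G0.
- exact: measurable_itint_cons.
Qed.

Lemma itintZl n k G : mseq n G -> (forall s, 0 <= G s) -> 0 <= k ->
  itint n (fun s => k * G s) = k * itint n G.
Proof.
move=> + + k0; elim: n G => [//|n IH] G mG G0 /=.
under eq_integral => x _.
  by rewrite (IH (fun s => G (x :: s))); [over|exact: mseq_cons1|by move=> *].
rewrite ge0_integralZl//; first exact: measurable_itint_cons.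
by move=> x _; apply: itint_ge0 => s; exact: G0.
Qed.

Lemma itint_nneseries n (G : nat -> seq X -> \bar R) :
  (forall k, mseq n (G k)) -> (forall k s, 0 <= G k s) ->
  itint n (fun s => \sum_(k <oo) G k s) = \sum_(k <oo) itint n (G k).
Proof.
elim: n G => [//|n IH] G mG G0 /=.
under eq_integral => x _.
  by rewrite (IH (fun k s => G k (x :: s)));
    [over|move=> k; exact: mseq_cons1|by move=> *].
rewrite integral_nneseries//.
- by move=> k; exact: measurable_itint_cons.
- by move=> k x _; apply: itint_ge0 => s; exact: G0.
Qed.

Lemma itint_sum n (I : Type) (r : seq I) (G : I -> seq X -> \bar R) :
  (forall k, mseq n (G k)) -> (forall k s, 0 <= G k s) ->
  itint n (fun s => \sum_(k <- r) G k s) = \sum_(k <- r) itint n (G k).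
Proof.
move=> mG G0; elim: r => [|k r IH].
  rewrite big_nil (@eq_itint n _ (fun s => 0 * 0)); last first.
    by move=> s _; rewrite big_nil mule0.
  by rewrite itintZl ?mul0e//; exact: measurable_cst.
rewrite big_cons -IH -itintD//; last 2 first.
- by apply: emeasurable_sum => i; exact: mG.
- by move=> s; apply: sume_ge0.
by apply: eq_itint => s _; rewrite big_cons.
Qed.

Lemma itint_prod k n F G : mseq k F -> mseq n G -> (forall s, 0 <= F s) ->
  (forall s, 0 <= G s) ->
  itint (k + n) (fun s => F (take k s) * G (drop k s)) = itint k F * itint n G.
Proof.
elim: k F => [|k IH] F mF mG F0 G0.
  rewrite add0n /= -itintZl//; apply: eq_itint => s _.
  by rewrite take0 drop0.
rewrite /=; under eq_integral => x _.
  by rewrite (IH (fun s => F (x :: s)));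
    [over|exact: mseq_cons1|exact: mG|by move=> *|by move=> *].
rewrite ge0_integralZr//; first exact: measurable_itint_cons.
- by move=> x _; apply: itint_ge0 => s; exact: F0.
- exact: itint_ge0.
Qed.

End iterated_integral.

Section lebesgue_n_measure.
Local Open Scope ereal_scope.
Context {R : realType}.

Definition tcons n (p : R * n.-tuple R) : n.+1.-tuple R := cons_tuple p.1 p.2.

Lemma measurable_tcons n : measurable_fun [set: R * n.-tuple R] (@tcons n).
Proof. exact: measurable_cons. Qed.

HB.instance Definition _ n :=
  isMeasurableFun.Build _ _ _ _ (@tcons n) (@measurable_tcons n).

Definition box n (k : nat) : set (n.-tuple R) :=
  [set t | forall i, tnth t i \in `[(- k%:R)%R, k%:R]%R].

Lemma box_cons n k x (t : n.-tuple R) :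
  box k (cons_tuple x t) <-> (x \in `[(- k%:R)%R, k%:R]%R /\ box k t).
Proof.
split=> [h|[hx ht] i].
  split; first by have := h ord0; rewrite tnth0.
  by move=> i; have := h (lift ord0 i); rewrite tnthS.
by have [j ->|->] := unliftP ord0 i; [rewrite tnthS|rewrite tnth0].
Qed.

Lemma measurable_box n k : measurable (@box n k).
Proof.
rewrite (_ : @box n k = \bigcap_(i in [set: 'I_n])
    ((@tnth n R)^~ i @^-1` `[(- k%:R)%R, k%:R%R]%classic)); last first.
  by apply/seteqP; split => t /= h i => [_|]; [exact: h|exact: (h i I)].
apply: fin_bigcap_measurable => // i _.
by rewrite -[X in measurable X]setTI; exact: measurable_tnth.
Qed.

Lemma bigcup_box n : \bigcup_k (@box n k) = [set: n.-tuple R].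
Proof.
apply/seteqP; split => // t _.
exists (truncn (\sum_(i < n) `|tnth t i|)%R).+1 => // i.
rewrite in_itv/= -ler_norml; apply/ltW.
apply: le_lt_trans (truncnS_gt _).
by rewrite (bigD1 i)//= lerDl sumr_ge0.
Qed.

Section cons_measure.
Variables (n : nat) (m : {sigma_finite_measure set (n.-tuple R) -> \bar R}).

Definition cons_measure : set (n.+1.-tuple R) -> \bar R :=
  pushforward (@lebesgue_measure R \x m) (@tcons n).

Let mt : measurable_fun setT (@tcons n) := @measurable_tcons n.

Let cons_measure0 : cons_measure set0 = 0. Proof. exact: measure0. Qed.

Let cons_measure_ge0 A : 0 <= cons_measure A. Proof. exact: measure_ge0. Qed.

Let cons_measure_sigma_additive : semi_sigma_additive cons_measure.
Proof. exact: measure_semi_sigma_additive. Qed.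

HB.instance Definition _ := isMeasure.Build _ _ _ cons_measure
  cons_measure0 cons_measure_ge0 cons_measure_sigma_additive.

Lemma cons_measureE A :
  cons_measure A = \int[lebesgue_measure]_x m [set t | A (cons_tuple x t)].
Proof.
apply: eq_integral => x _ /=; congr (m _).
by apply/seteqP; split => t /=; rewrite /xsection/= inE.
Qed.

Hypothesis m_box : forall k, m (box k) < +oo.

Lemma cons_measure_box k : cons_measure (box k) < +oo.
Proof.
rewrite cons_measureE.
have e x : m [set t | box k (cons_tuple x t)] =
   (\1_(`[(- k%:R)%R, k%:R%R]%classic : set R) x)%:E * m (box k).
  rewrite indicE; case: (boolP (x \in _)) => /= xk.
    rewrite inE/= in xk; rewrite mul1e; congr (m _).
    by apply/seteqP; split => t /= h; [case/box_cons: h|exact/box_cons].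
  rewrite mul0e (_ : [set t | _] = set0) ?measure0//.
  apply/seteqP; split => t //= /box_cons[xk' _].
  by move/negP: xk; apply; rewrite inE.
under eq_integral do rewrite e.
rewrite ge0_integralZr//; last exact/measurable_EFinP.
rewrite integral_indic// setIT [X in X * _]lebesgue_measure_itv/=.
by apply: lte_mul_pinfty => //; case: ifPn => // _; rewrite -EFinB.
Qed.

Let cons_measure_sigma_finite : sigma_finite setT cons_measure.
Proof.
exists (@box n.+1); first by rewrite bigcup_box.
by move=> k; split; [exact: measurable_box|exact: cons_measure_box].
Qed.

Lemma cons_measure_pack :
  exists m' : {sigma_finite_measure set (n.+1.-tuple R) -> \bar R},
    (m' : set _ -> \bar R) = cons_measure.
Proof.
pose mx := Measure_isSigmaFinite.Build _ _ _ cons_measure cons_measure_sigma_finite.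
pose m' : {sigma_finite_measure set (n.+1.-tuple R) -> \bar R} :=
  HB.pack cons_measure mx.
by exists m'.
Qed.

End cons_measure.

Local Notation lambda := (@lebesgue_measure R).

(** [lebesgue_n] is only a recursive set function. The induction shows that it is a measure, as the
    image of a product under [tcons], and identifies its integral with [itint]. Finiteness on the
    cubes [box k] is carried along because Tonelli's theorem in the next dimension needs
    sigma-finiteness. *)
Lemma lebesgue_n_measure n :
  exists m : {sigma_finite_measure set (n.-tuple R) -> \bar R},
   [/\ (m : set _ -> \bar R) = lebesgue_n (n:=n), forall k, m (box k) < +oo &
    forall G, mseq n G -> (forall s, 0 <= G s) ->
     \int[m]_t G t = itint lambda n G].
Proof.
elim: n => [|n [m [mE mbox mint]]].
  exists (\d_ ([tuple] : 0.-tuple R)); split => //.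
    by move=> k; rewrite /dirac ltry.
  move=> G mG G0; rewrite integral_dirac ?diracT ?mul1e//.
have [m' m'E] := cons_measure_pack mbox.
exists m'; split.
- rewrite m'E; apply/funext => A; rewrite cons_measureE.
  by apply: eq_integral => x _; rewrite mE.
- by move=> k; rewrite m'E; exact: cons_measure_box.
- move=> G mG G0.
  transitivity (\int[cons_measure m]_t G t).
    by apply: eq_measure_integral => A _ _; exact: (congr1 (@^~ A) m'E).
  rewrite ge0_integral_pushforward//; last exact: measurable_tcons.
  rewrite preimage_setT fubini_tonelli1//=.
  + by apply: eq_integral => x _; rewrite -(mint (fun s => G (x :: s)))//; exact: mseq_cons1.
  + by apply: measurableT_comp => //; exact: measurable_tcons.
Qed.

End lebesgue_n_measure.

(** * The Gaussian reference measure and Gibbs' inequality *)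

Section gaussian_reference.
Context {R : realType} (m s : R).
Hypothesis s_gt0 : 0 < s.
Local Notation phi := (normal_pdf m s).
Local Notation lambda := (@lebesgue_measure R).
Local Notation mu := (normal_prob m s).

Lemma normal_pdf_gt0 x : 0 < phi x.
Proof.
by rewrite normal_pdfE ?gt_eqF// mulr_gt0 ?normal_peak_gt0 ?gt_eqF ?expR_gt0.
Qed.

Definition gauss_dens (l : seq R) : R := \prod_(x <- l) phi x.

Lemma gauss_dens_gt0 l : 0 < gauss_dens l.
Proof. by apply: prodr_gt0 => x _; exact: normal_pdf_gt0. Qed.

Lemma ln_gauss_dens l : ln (gauss_dens l) = \sum_(x <- l) ln (phi x).
Proof. by apply: ln_prod => x _; exact: normal_pdf_gt0. Qed.

Lemma measurable_gauss_dens n :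
  measurable_fun [set: n.-tuple R] (fun t => gauss_dens t).
Proof.
rewrite (_ : (fun t => _) = fun t : n.-tuple R => \prod_(i < n) phi (tnth t i)).
  apply: measurable_prod => i _; apply: measurableT_comp.
    exact: measurable_normal_pdf.
  exact: measurable_tnth.
by apply/funext => t; rewrite /gauss_dens big_tuple.
Qed.

Lemma itint_normal n G : mseq n G -> (forall l, 0 <= G l)%E ->
  itint lambda n (fun l => (gauss_dens l)%:E * G l)%E = itint mu n G.
Proof.
elim: n G => [|n IH] G mG G0 /=.
  by rewrite /gauss_dens big_nil mul1e.
rewrite [RHS](ge0_integral_density (m := lambda) (g := phi)); last 5 first.
- exact: measurable_normal_pdf.
- by move=> x; exact/ltW/normal_pdf_gt0.
- by move=> A mA; rewrite /normal_prob.
- exact: measurable_itint_cons.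
- by move=> x; apply: itint_ge0 => l; exact: G0.
apply: eq_integral => x _; rewrite -IH; last 2 first.
- exact: mseq_cons1.
- by move=> l; exact: G0.
rewrite muleC -itintZl; last 3 first.
- apply: emeasurable_funM; last exact: mseq_cons1.
  by apply/measurable_EFinP; exact: measurable_gauss_dens.
- by move=> l; rewrite mule_ge0// lee_fin ltW// gauss_dens_gt0.
- by rewrite lee_fin ltW// normal_pdf_gt0.
by apply: eq_itint => l _; rewrite /gauss_dens big_cons EFinM muleA.
Qed.

End gaussian_reference.

Section block_density.
Context {R : realType} (m s : R).
Hypothesis s_gt0 : 0 < s.
Variable P : probability (pathspace R) R.
Variable f : forall n : nat, n.-tuple R -> R.
Arguments f : clear implicits.
Hypothesis f_meas : forall n, measurable_fun [set: n.-tuple R] (f n).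
Hypothesis f_ge0 : forall n t, 0 <= f n t.
Hypothesis f_dens : forall n (A : set (n.-tuple R)), measurable A ->
   P (block n @^-1` A) = (\int[@lebesgue_n R n]_(t in A) (f n t)%:E)%E.

Local Notation phi := (normal_pdf m s).
Local Notation lambda := (@lebesgue_measure R).
Local Notation mu := (normal_prob m s).

(** Extends [f n] by 0 to sequences of other lengths, so that it can stand under [itint]. *)
Definition seq_dens n (l : seq R) : R := if insub l is Some t then f n t else 0.

Lemma seq_densE n (t : n.-tuple R) : seq_dens n t = f n t.
Proof. by rewrite /seq_dens valK. Qed.

Lemma seq_dens_ge0 n l : 0 <= seq_dens n l.
Proof. by rewrite /seq_dens; case: insubP. Qed.

Lemma mseq_seq_dens n : mseq n (fun l => (seq_dens n l)%:E).
Proof.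
apply/measurable_EFinP; rewrite (_ : (fun t => _) = f n); first exact: f_meas.
by apply/funext => t; rewrite seq_densE.
Qed.

Lemma integral_block n (G : seq R -> \bar R) : mseq n G ->
  (forall l, 0 <= G l)%E ->
  (\int[P]_w G (block n w) =
   itint lambda n (fun l => G l * (seq_dens n l)%:E))%E.
Proof.
move=> mG G0; have [ln [lnE _ lnint]] := @lebesgue_n_measure R n.
rewrite -[LHS](@ge0_integral_distribution _ _ _ _ _ P (path_block n) G)//.
rewrite (ge0_integral_density (m := ln) (g := f n))//; last first.
  by move=> A mA; rewrite [LHS]f_dens// -lnE.
  exact: f_meas.
rewrite -[RHS](lnint (fun l => G l * (seq_dens n l)%:E)%E).
- by apply: eq_integral => t _; rewrite seq_densE.
- apply: emeasurable_funM => //; exact: mseq_seq_dens.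
- by move=> l; rewrite mule_ge0// lee_fin seq_dens_ge0.
Qed.

Lemma ae_dens_gt0 n : {ae P, forall w, 0 < f n (block n w)}.
Proof.
have mf0 : measurable (f n @^-1` [set 0]).
  by rewrite -[X in measurable X]setTI; exact: f_meas.
exists (block n @^-1` (f n @^-1` [set 0])); split.
- by have := @measurable_block _ R n measurableT _ mf0; rewrite setTI.
- have [ln [lnE _ _]] := @lebesgue_n_measure R n.
  by rewrite f_dens// -lnE; apply: integral0_eq => t /= ->.
- by move=> w /= /negP; rewrite -leNgt => h; apply/eqP; rewrite eq_le h f_ge0.
Qed.

(** Wherever [f n] is positive, hence almost surely, this is log p_n(X_{1:n}) for p_n = dP_n /
    dmu^n. *)
Definition log_ratio n (w : pathspace R) : R :=
  ln (f n (block n w)) - \sum_(x <- block n w) ln (phi x).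

Lemma gibbs n (G : seq R -> \bar R) (u : pathspace R -> R) :
  mseq n G -> (forall l, 0 <= G l)%E -> (itint mu n G <= 1)%E ->
  P.-integrable setT (EFin \o u) ->
  P.-integrable setT (EFin \o log_ratio n) ->
  (forall w, ((expR (u w))%:E <= G (block n w))%E) ->
  \int[P]_w u w <= \int[P]_w log_ratio n w.
Proof.
(* exp (u - log p_n) has mean at most the mu^n-integral of G, and v <= exp v - 1 *)
move=> mG G0 G1 iu il uG.
(* [K] is G / p_n. The reciprocal is written [expR (- ln _)]; times the density it is 1 where the
   density is positive and 0 elsewhere, so the mu^n-integral of [G] is only an upper bound. *)
pose K l := (G l * (gauss_dens m s l * expR (- ln (seq_dens n l)))%:E)%E.
have mln : measurable_fun setT (fun t : n.-tuple R => ln (seq_dens n t)).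
  apply: measurableT_comp; first exact: measurable_ln.
  by apply/measurable_EFinP; exact: mseq_seq_dens.
have mK : mseq n K.
  apply: emeasurable_funM => //; apply/measurable_EFinP; apply: measurable_funM.
    exact: measurable_gauss_dens.
  apply: measurableT_comp; first exact: measurable_expR.
  exact: measurable_funN.
have gd0 := gauss_dens_gt0 m s_gt0.
have K0 l : (0 <= K l)%E.
  by rewrite mule_ge0// lee_fin mulr_ge0 ?expR_ge0// ltW.
have K1 : (\int[P]_w K (block n w) <= 1)%E.
  rewrite integral_block//; apply: le_trans G1; rewrite -(@itint_normal _ _ _ s_gt0)//.
  apply: le_itint => //.
  - by apply: emeasurable_funM => //; exact: mseq_seq_dens.
  - apply: emeasurable_funM => //; apply/measurable_EFinP.
    exact: measurable_gauss_dens.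
  - by move=> l; rewrite mule_ge0// lee_fin seq_dens_ge0.
  - by move=> l; rewrite mule_ge0// lee_fin ltW.
  - move=> l _; rewrite /K -muleA -EFinM muleC lee_wpmul2r// lee_fin -mulrA.
    apply: ler_piMr; first exact: ltW.
    have := seq_dens_ge0 n l; rewrite le_eqVlt => /predU1P[<-|l0].
      by rewrite mulr0.
    by rewrite expRN lnK ?posrE// mulVf// gt_eqF.
pose v w := u w - log_ratio n w.
have iv : P.-integrable setT (EFin \o v).
  rewrite (_ : _ \o _ = (EFin \o u) \- (EFin \o log_ratio n))%E.
    exact: integrableB.
  by apply/funext.
have mv : measurable_fun setT v by apply/measurable_EFinP; exact: measurable_int iv.
have mev : measurable_fun setT (fun w => (expR (v w))%:E).
  by apply/measurable_EFinP; apply: measurableT_comp => //; exact: measurable_expR.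
have ev1 : (\int[P]_w (expR (v w))%:E <= 1)%E.
  apply: le_trans K1; apply: ae_ge0_le_integral => //.
  - exact: (measurable_block_comp mK).
  - move: (ae_dens_gt0 n); apply: ae_mono => w fw _.
    have -> : v w = u w + (ln (gauss_dens m s (block n w)) - ln (f n (block n w))).
      by rewrite ln_gauss_dens// /v /log_ratio; ring.
    rewrite expRD expRD lnK ?posrE// EFinM /K seq_densE.
    apply: lee_wpmul2r; last exact: uG.
    by rewrite lee_fin mulr_ge0 ?expR_ge0// ltW.
have iev : P.-integrable setT (fun w => (expR (v w))%:E).
  apply/integrableP; split => //.
  under eq_integral do rewrite gee0_abs ?lee_fin ?expR_ge0//.
  by rewrite (le_lt_trans ev1)// ltry.
have v0 : \int[P]_w v w <= 0.
  have : \int[P]_w v w <= \int[P]_w (expR (v w) - 1).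
    apply: le_Rintegral => //.
    - rewrite (_ : _ \o _ = (fun w => (expR (v w))%:E) \- (EFin \o (fun=> 1%R)))%E.
        by apply: (integrableB _ iev (integrable_prob_cst P 1)).
      by apply/funext.
    - by move=> w _; rewrite lerBrDr addrC expR_ge1Dx.
  rewrite (RintegralB measurableT iev (integrable_prob_cst P 1)).
  rewrite (Rintegral_prob_cst P) => /le_trans; apply; rewrite subr_le0.
  by rewrite -lee_fin fineK//; exact: integrable_fin_num.
move: v0; rewrite /v RintegralB// subr_le0; exact.
Qed.

End block_density.

(** * Blocks, shifts and mixture weights *)

Section blocks.
Context {T : Type}.

Lemma val_block n (w : int -> T) :
  block n w = [seq w (Posz i.+1) | i <- iota 0 n] :> seq T.
Proof.
rewrite /block /= -val_enum_ord -map_comp.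
by [].
Qed.
End blocks.

Section shifted_blocks.
Context d (T : measurableType d).
Local Notation S := (@Defs.shift d T).

Lemma block_take k n (w : pathspace T) :
  take k (block (k + n) w) = block k w :> seq T.
Proof. by rewrite !val_block -map_take take_iota (minn_idPl (leq_addr _ _)). Qed.

Lemma block_drop k n (w : pathspace T) :
  drop k (block (k + n) w) = block n (iter k S w) :> seq T.
Proof.
rewrite !val_block -map_drop drop_iota addKn add0n -[in iota k n](addn0 k).
rewrite iotaDl -map_comp; apply: eq_map => i /=.
by rewrite iter_shiftE; congr (w _); rewrite -PoszD addSn addnC.
Qed.

Lemma sum_block {R : realType} (g : T -> R) n (w : pathspace T) :
  \sum_(x <- block n w) g x = \sum_(i < n) g (iter i S w 1).
Proof.
rewrite val_block big_map -[in iota 0 n](subn0 n) -/(index_iota 0 n) big_mkord.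
by apply: eq_bigr => i _; rewrite iter_shiftE -PoszD add1n.
Qed.

End shifted_blocks.

Section mseq_theory.
Context d (X : measurableType d) (R : realType).

Lemma mseq_take k n (F : seq X -> \bar R) : mseq k F ->
  mseq (k + n) (fun s => F (take k s)).
Proof.
move=> mF; pose c (t : (k + n).-tuple X) := [tuple tnth t (lshift n i) | i < k].
have mc : measurable_fun setT c.
  apply/measurable_fun_tnthP => i.
  rewrite (_ : _ \o _ = fun t => tnth t (lshift n i)); first exact: measurable_tnth.
  by apply/funext => t /=; rewrite tnth_mktuple.
rewrite /mseq (_ : (fun t => _) = (fun t : k.-tuple X => F t) \o c).
  exact: measurableT_comp.
apply/funext => t /=; congr (F _); case: k @c mc t {mF} => [|k] c mc t.
  by rewrite take0; apply/esym/size0nil; rewrite size_map size_enum_ord.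
apply: (@eq_from_nth _ (thead t)).
  by rewrite size_takel; [rewrite size_map size_enum_ord|rewrite size_tuple leq_addr].
move=> i; rewrite size_takel; last by rewrite size_tuple leq_addr.
move=> ik.
rewrite nth_take//.
transitivity (nth (thead t) (c t) (Ordinal ik)); last by [].
by rewrite -tnth_nth tnth_mktuple (tnth_nth (thead t)).
Qed.

Lemma mseq_drop k n (F : seq X -> \bar R) : mseq n F ->
  mseq (k + n) (fun s => F (drop k s)).
Proof.
move=> mF; pose c (t : (k + n).-tuple X) := [tuple tnth t (rshift k i) | i < n].
have mc : measurable_fun setT c.
  apply/measurable_fun_tnthP => i.
  rewrite (_ : _ \o _ = fun t => tnth t (rshift k i)); first exact: measurable_tnth.
  by apply/funext => t /=; rewrite tnth_mktuple.
rewrite /mseq (_ : (fun t => _) = (fun t : n.-tuple X => F t) \o c).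
  exact: measurableT_comp.
apply/funext => t /=; congr (F _); case: n @c mc t {mF} => [|n] c mc t.
  rewrite drop_oversize ?size_tuple ?addn0//; apply/esym/size0nil.
  by rewrite size_map size_enum_ord.
apply: (@eq_from_nth _ (tnth t (rshift k ord0))).
  by rewrite size_drop size_map size_enum_ord size_tuple addKn.
move=> i; rewrite size_drop size_tuple addKn => ik.
rewrite nth_drop.
transitivity (nth (tnth t (rshift k ord0)) (c t) (Ordinal ik)); last by [].
by rewrite -tnth_nth tnth_mktuple [RHS](tnth_nth (tnth t (rshift k ord0))).
Qed.

Lemma itint_prob1 (mu : probability X R) n : itint mu n (fun=> 1%E) = 1%E.
Proof.
elim: n => //= n ->.
by rewrite integral_cst// mul1e; exact: probability_setT.
Qed.

Lemma itint_drop (mu : probability X R) k n (F : seq X -> \bar R) :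
  mseq n F -> (forall s, 0 <= F s)%E ->
  itint mu (k + n) (fun s => F (drop k s)) = itint mu n F.
Proof.
move=> mF F0.
rewrite -[RHS]mul1e -[X in (X * _)%E](itint_prob1 mu k) -itint_prod//.
  by apply: eq_itint => s _; rewrite mul1e.
exact: measurable_cst.
Qed.

End mseq_theory.

Lemma npd_weight_gt0 {R : realType} l : 0 < npd_weight l :> R.
Proof. by rewrite /npd_weight subr_gt0 ltf_pV2 ?posrE// ltr_nat. Qed.

Lemma sum_npd_weight {R : realType} a b : (a <= b)%N ->
  \sum_(a <= l < b) npd_weight l = a.+1%:R^-1 - b.+1%:R^-1 :> R.
Proof.
move=> ab; rewrite -[RHS]opprB -(telescope_sumr (fun l => l.+1%:R^-1) ab).
by rewrite -sumrN; apply: eq_bigr => l _; rewrite opprB.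
Qed.

Lemma sum_npd_weight_le1 {R : realType} a b :
  \sum_(a <= l < b) npd_weight l <= 1 :> R.
Proof.
have [ab|ba] := leqP a b; last by rewrite big_geq ?ler01// ltnW.
rewrite sum_npd_weight// (@le_trans _ _ a.+1%:R^-1)//.
  by rewrite gerBl invr_ge0.
by rewrite invf_le1 // ler1n.
Qed.

(** * Recurrence under an ergodic shift *)

Section iterated_shift.
Context d (T : measurableType d) (R : realType).
Variable P : probability (pathspace T) R.
Hypothesis statP : stationary P.
Local Notation S := (@Defs.shift d T).

Lemma measurable_iter_shift_preimage n A : measurable A ->
  measurable (iter n S @^-1` A).
Proof.
by move=> mA; rewrite -[X in measurable X]setTI; exact: measurable_iter_shift.
Qed.

Lemma measure_iter_shift n A : measurable A -> P (iter n S @^-1` A) = P A.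
Proof.
move=> mA; elim: n => [//|n IH]; rewrite -IH.
rewrite -[RHS]statP; last exact: measurable_iter_shift_preimage.
by congr (P _); apply/seteqP; split => w /=; rewrite -iterSr.
Qed.

End iterated_shift.

Section recurrence.
Context d (T : measurableType d) (R : realType).
Variable P : probability (pathspace T) R.
Hypothesis ergP : stationary_ergodic P.
Local Notation S := (@Defs.shift d T).

(** That [A] is visited at arbitrarily late times is an invariant event. It is a decreasing limit of
    events that each contain a shifted copy of [A], so its probability is at least P A > 0 and
    therefore 1. *)
Lemma ergodic_recurrence A : measurable A -> P A != 0%E ->
  {ae P, forall w, exists k, A (iter k S w)}.
Proof.
move=> mA PA.
pose U n := \bigcup_k (iter (n + k) S @^-1` A).
have mU n : measurable (U n).
  by apply: bigcupT_measurable => k; exact: measurable_iter_shift_preimage.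
pose B := \bigcap_n U n.
have mB : measurable B by exact: bigcapT_measurable.
have invB : S @^-1` B = B.
  apply/seteqP; split => w /= Bw n _.
  - have [k _ Ak] := Bw n I; exists k.+1 => //=; rewrite addnS iterSr.
    exact: Ak.
  - have [k _ Ak] := Bw n.+1 I; exists k => //.
    by rewrite /= -iterSr; exact: Ak.
have PB : (P A <= P B)%E.
  have ndU : nonincreasing_seq U.
    move=> i j ij; apply/subsetPset => w [k _ h]; exists (j - i + k)%N => //.
    by rewrite addnA subnKC.
  have cv : P (U n) @[n --> \oo] --> P B.
    apply: nonincreasing_cvg_mu => //.
    by rewrite (le_lt_trans (probability_le1 _ _))// ltry.
  rewrite -(cvg_lim _ cv)//; apply: lime_ge; first by apply/cvg_ex; exists (P B).
  apply: nearW => n; rewrite -(measure_iter_shift ergP.1 n mA); apply: le_measure.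
  - by rewrite inE; exact: measurable_iter_shift_preimage.
  - by rewrite inE.
  - by move=> w h; exists 0%N => //; rewrite addn0.
have [B0|B1] := ergP.2 B mB invB.
  by move: PB PA; rewrite B0 measure_le0 => /eqP ->; rewrite eqxx.
exists (~` B); split; first exact: measurableC.
  by rewrite probability_setC// B1 subee.
move=> w /= nex Bw; apply: nex; have [k _ h] := Bw 0%N I; by exists k.
Qed.

End recurrence.

Lemma mule_le1 (R : realType) (x y : \bar R) :
  (0 <= x)%E -> (y <= 1)%E -> (x * y <= x)%E.
Proof. by move=> x0 y1; rewrite -[leRHS]mule1 lee_wpmul2l. Qed.

(** * Parsings of a path into blocks *)

Section parsing.
Local Open Scope ereal_scope.
Context d (X : measurableType d) (R : realType) (mu : probability X R).
Variable G : seq X -> \bar R.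
Hypothesis mG : forall n, mseq n G.
Hypothesis G0 : forall l, 0 <= G l.
Hypothesis G1 : forall n, itint mu n G <= 1.

Lemma mseq_take_all (F : seq X -> \bar R) k n :
  (forall n, mseq n F) -> mseq n (fun l => F (take k l)).
Proof.
move=> mF; have [kn|nk] := leqP k n.
  by rewrite -(subnKC kn); exact: mseq_take.
rewrite /mseq (_ : (fun t => _) = (fun t : n.-tuple X => F t)); first exact: mF.
by apply/funext => t; rewrite take_oversize// size_tuple ltnW.
Qed.

Lemma mseq_drop_all (F : seq X -> \bar R) k n :
  (forall n, mseq n F) -> mseq n (fun l => F (drop k l)).
Proof.
move=> mF; have [kn|nk] := leqP k n.
  by rewrite -(subnKC kn); exact: mseq_drop.
rewrite /mseq (_ : (fun t => _) = (fun t : n.-tuple X => F [::])).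
  exact: measurable_cst.
by apply/funext => t; rewrite drop_oversize// size_tuple ltnW.
Qed.

Lemma itint_take_drop (F H : seq X -> \bar R) k n : (k <= n)%N ->
  (forall n, mseq n F) -> (forall n, mseq n H) ->
  (forall l, 0 <= F l) -> (forall l, 0 <= H l) ->
  itint mu n (fun l => F (take k l) * H (drop k l)) =
  itint mu k F * itint mu (n - k) H.
Proof. by move=> kn mF mH F0 H0; rewrite -{1}(subnKC kn) itint_prod. Qed.

Lemma itint_drop_all (F : seq X -> \bar R) k n : (k <= n)%N ->
  (forall n, mseq n F) -> (forall l, 0 <= F l) ->
  itint mu n (fun l => F (drop k l)) = itint mu (n - k) F.
Proof. by move=> kn mF F0; rewrite -{1}(subnKC kn) itint_drop. Qed.

(* Allowing a skipped prefix turns "G is large infinitely often on some shift of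
   the path" into the same statement for the path itself. *)
Definition gap_mix (l : seq X) : \bar R :=
  \sum_(k < size l) (npd_weight k)%:E * G (drop k l).

Let w0 k : 0 <= (npd_weight k : R)%:E.
Proof. by rewrite lee_fin ltW// npd_weight_gt0. Qed.

Lemma gap_mix_ge0 l : 0 <= gap_mix l.
Proof. by apply: sume_ge0 => k _; rewrite mule_ge0. Qed.

Lemma gap_mixE n l : size l = n ->
  gap_mix l = \sum_(k < n) (npd_weight k)%:E * G (drop k l).
Proof. by move=> <-. Qed.

Lemma mseq_gap_mix n : mseq n gap_mix.
Proof.
rewrite /mseq (_ : (fun t => _) = fun t : n.-tuple X =>
    \sum_(k < n) (npd_weight k)%:E * G (drop k t)).
  by apply: emeasurable_sum => k; apply: measurable_funeM; exact: mseq_drop_all.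
by apply/funext => t; apply: gap_mixE; rewrite size_tuple.
Qed.

Lemma itint_gap_mix n : itint mu n gap_mix <= 1.
Proof.
rewrite (eq_itint _ (@gap_mixE n)) itint_sum; last 2 first.
- by move=> k; apply: measurable_funeM; exact: mseq_drop_all.
- by move=> k l; rewrite mule_ge0.
apply: (@le_trans _ _ (\sum_(k < n) (npd_weight k)%:E)).
  apply: lee_sum => k _; rewrite itintZl//; last exact: mseq_drop_all.
  by rewrite itint_drop_all ?(ltnW (ltn_ord k))// mule_le1.
by rewrite sumEFin lee_fin -(big_mkord xpredT npd_weight) sum_npd_weight_le1.
Qed.

Variables (dl : R) (n0 : nat).
Hypothesis dl01 : (0 < dl < 1)%R.
Hypothesis n0_gt0 : (0 < n0)%N.

(* Mixture over all parsings of a word into single letters (weight 1 - dl) and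
   blocks of length n >= n0 (weight dl * npd_weight n, density gap_mix). *)
Fixpoint parse_mix j (l : seq X) : \bar R :=
  if j is j'.+1 then
    if l is [::] then 1 else
    (1 - dl)%:E * parse_mix j' (drop 1 l) +
    \sum_(n0 <= n < (size l).+1)
       (dl * npd_weight n)%:E * (gap_mix (take n l) * parse_mix j' (drop n l))
  else 1.

Let dl0 : (0 <= dl)%R. Proof. by case/andP: dl01 => /ltW. Qed.
Let dl1 : (0 <= 1 - dl)%R. Proof. by case/andP: dl01 => _ /ltW; rewrite subr_ge0. Qed.
Let dw0 n : 0 <= (dl * npd_weight n)%:E.
Proof. by rewrite lee_fin mulr_ge0// ltW// npd_weight_gt0. Qed.

Lemma parse_mix_ge0 j l : 0 <= parse_mix j l.
Proof.
elim: j l => [|j IH] [|x l] //; rewrite [parse_mix _ _]/=.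
rewrite adde_ge0//; first by rewrite mule_ge0// lee_fin.
by apply: sume_ge0 => n _; rewrite mule_ge0// mule_ge0// gap_mix_ge0.
Qed.

Lemma parse_mixE j n l : size l = n.+1 -> parse_mix j.+1 l =
    (1 - dl)%:E * parse_mix j (drop 1 l) +
    \sum_(n0 <= n < n.+2)
       (dl * npd_weight n)%:E * (gap_mix (take n l) * parse_mix j (drop n l)).
Proof. by case: l => // x l [<-]. Qed.

Lemma mseq_parse_mix j n : mseq n (parse_mix j).
Proof.
elim: j n => [|j IH] n; first exact: measurable_cst.
case: n => [|n].
  rewrite /mseq (_ : (fun t => _) = (fun t : 0.-tuple X => parse_mix j.+1 [::])).
    exact: measurable_cst.
  by apply/funext => t; rewrite tuple0.
rewrite /mseq (_ : (fun t => _) = fun t : n.+1.-tuple X =>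
    (1 - dl)%:E * parse_mix j (drop 1 t) +
    \sum_(n0 <= n < n.+2)
       (dl * npd_weight n)%:E * (gap_mix (take n t) * parse_mix j (drop n t))).
  apply: emeasurable_funD.
    by apply: measurable_funeM; exact: mseq_drop_all.
  apply: emeasurable_sum => k; apply: measurable_funeM; apply: emeasurable_funM.
    by apply: mseq_take_all => i; exact: mseq_gap_mix.
  exact: mseq_drop_all.
by apply/funext => t; apply: parse_mixE; rewrite size_tuple.
Qed.

(** For each choice of the first piece the integral factorizes into piece and remainder, both at
    most 1 by [itint_gap_mix] and induction. The weights of the choices add up to at most (1 - dl) +
    dl, since the [npd_weight n] sum to at most 1. *)
Lemma itint_parse_mix j n : itint mu n (parse_mix j) <= 1.
Proof.
elim: j n => [|j IH] n; first by rewrite itint_prob1.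
case: n => [//|n]; rewrite (eq_itint _ (@parse_mixE j n)).
have mblock k : mseq n.+1 (fun l => gap_mix (take k l) * parse_mix j (drop k l)).
  apply: emeasurable_funM; first by apply: mseq_take_all => i; exact: mseq_gap_mix.
  by apply: mseq_drop_all => i; exact: mseq_parse_mix.
have block0 k l : 0 <= gap_mix (take k l) * parse_mix j (drop k l).
  by rewrite mule_ge0 ?gap_mix_ge0 ?parse_mix_ge0.
rewrite itintD; last 4 first.
- by apply: measurable_funeM; apply: mseq_drop_all => i; exact: mseq_parse_mix.
- by apply: emeasurable_sum => k; apply: measurable_funeM; exact: mblock.
- by move=> l; rewrite mule_ge0 ?parse_mix_ge0// lee_fin.
- by move=> l; apply: sume_ge0 => k _; rewrite mule_ge0.
rewrite itint_sum; last 2 first.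
- by move=> k; apply: measurable_funeM; exact: mblock.
- by move=> k l; rewrite mule_ge0.
apply: (@le_trans _ _ ((1 - dl)%:E + dl%:E)); last first.
  by rewrite -EFinD subrK.
apply: leeD.
  rewrite itintZl ?lee_fin//; last 2 first.
  - by apply: mseq_drop_all => i; exact: mseq_parse_mix.
  - by move=> l; exact: parse_mix_ge0.
  rewrite itint_drop_all//; last 2 first.
  - by move=> i; exact: mseq_parse_mix.
  - by move=> l; exact: parse_mix_ge0.
  by rewrite mule_le1 ?lee_fin.
apply: (@le_trans _ _ (\sum_(n0 <= k < n.+2) (dl * npd_weight k)%:E)).
  rewrite big_nat_cond [leRHS]big_nat_cond; apply: lee_sum => k.
  rewrite andbT => /andP[_ kn]; rewrite itintZl//.
  rewrite itint_take_drop//; last 4 first.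
  - by move=> i; exact: mseq_gap_mix.
  - by move=> i; exact: mseq_parse_mix.
  - by move=> l; exact: gap_mix_ge0.
  - by move=> l; exact: parse_mix_ge0.
  rewrite mule_le1//; apply: (@le_trans _ _ (1 * 1)); last by rewrite mule1.
  apply: lee_pmul => //; last exact: itint_gap_mix.
    by apply: itint_ge0 => l; exact: gap_mix_ge0.
  by apply: itint_ge0 => l; exact: parse_mix_ge0.
rewrite sumEFin lee_fin -mulr_sumr ler_piMr//; exact: sum_npd_weight_le1.
Qed.

Lemma parse_letter j l : (0 < size l)%N ->
  (1 - dl)%:E * parse_mix j (drop 1 l) <= parse_mix j.+1 l.
Proof.
case: l => // x l _; rewrite (@parse_mixE j (size l))// leeDl//.
by apply: sume_ge0 => n _; rewrite mule_ge0// mule_ge0 ?gap_mix_ge0 ?parse_mix_ge0.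
Qed.

Lemma parse_block j n l : (n0 <= n <= size l)%N ->
  (dl * npd_weight n)%:E * (gap_mix (take n l) * parse_mix j (drop n l))
    <= parse_mix j.+1 l.
Proof.
case: l => [|x l] /andP[n0n nl].
  by move: nl; rewrite leqn0 => /eqP n0'; move: n0n; rewrite n0' leqNgt n0_gt0.
rewrite (@parse_mixE j (size l))//.
apply: (@le_trans _ _ (\sum_(n0 <= n < (size l).+2)
   (dl * npd_weight n)%:E *
   (gap_mix (take n (x :: l)) * parse_mix j (drop n (x :: l))))); last first.
  by rewrite leeDr// mule_ge0 ?lee_fin ?parse_mix_ge0.
rewrite (big_cat_nat (n := n))/=; [|exact: n0n|by rewrite ltnW// ltnS].
rewrite [X in _ + X]big_ltn; last by rewrite ltnS.
rewrite addeCA leeDl// adde_ge0//; apply: sume_ge0 => k _.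
  by rewrite mule_ge0// mule_ge0 ?gap_mix_ge0 ?parse_mix_ge0.
by rewrite mule_ge0// mule_ge0 ?gap_mix_ge0 ?parse_mix_ge0.
Qed.

End parsing.

Lemma npd_weightE {R : realType} n : npd_weight n = (n.+1%:R * n.+2%:R)^-1 :> R.
Proof.
have aux (x : R) : x != 0 -> x + 1 != 0 -> x^-1 - (x + 1)^-1 = (x * (x + 1))^-1.
  by move=> x0 x1; field; rewrite x1 x0.
by rewrite /npd_weight -[n.+2%:R]natr1 aux// ?natr1 pnatr_eq0.
Qed.

Lemma npd_weight_decay {R : realType} (e a : R) : 0 < e -> 0 < a ->
  exists2 n0, (0 < n0)%N &
    forall n, (n0 <= n)%N -> expR (- (n%:R * e)) <= a * npd_weight n.
Proof.
(* 162 = 6 * 27, from (n+1)(n+2) <= 6 n^2 and (x/3)^3 <= e^x *)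
move=> e0 a0; pose C := 162 / (a * e ^+ 3).
exists (truncn C).+1 => // n n0n.
have n1 : 1 <= n%:R :> R by rewrite ler1n (leq_trans _ n0n).
have Cn : 162 <= n%:R * (a * e ^+ 3).
  rewrite -ler_pdivrMr ?mulr_gt0 ?exprn_gt0// (le_trans (ltW (truncnS_gt _)))//.
  by rewrite ler_nat.
rewrite expRN npd_weightE -[leLHS]mul1r ler_pdivrMr ?expR_gt0// mulrAC.
rewrite ler_pdivlMr ?mulr_gt0 ?ltr0n// mul1r.
have h : (n%:R * e / 3) ^+ 3 <= expR (n%:R * e).
  rewrite [in leRHS](_ : n%:R * e = 3%:R * (n%:R * e / 3)); last by field.
  rewrite expRM_natl lerXn2r ?nnegrE ?expR_ge0//.
    by rewrite divr_ge0// mulr_ge0// ltW.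
  by apply: le_trans (expR_ge1Dx _); rewrite lerDr.
apply: le_trans (ler_wpM2l (ltW a0) h).
rewrite -(natr1 n.+1) -(natr1 n).
have : n%:R ^+ 2 * 162 <= n%:R ^+ 2 * (n%:R * (a * e ^+ 3)).
  by rewrite ler_wpM2l// sqr_ge0.
set x := n%:R : R; nra.
Qed.

(** * Upper bound: growth of a sub-density along the path *)

Section limsup_subdensity.
Context {R : realType} (m s : R).
Hypothesis s_gt0 : 0 < s.
Variable P : probability (pathspace R) R.
Hypothesis ergP : stationary_ergodic P.
Variable f : forall n : nat, n.-tuple R -> R.
Arguments f : clear implicits.
Hypothesis f_meas : forall n, measurable_fun [set: n.-tuple R] (f n).
Hypothesis f_ge0 : forall n t, 0 <= f n t.
Hypothesis f_dens : forall n (A : set (n.-tuple R)), measurable A ->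
   P (block n @^-1` A) = (\int[@lebesgue_n R n]_(t in A) (f n t)%:E)%E.
Local Notation mu := (normal_prob m s).
Local Notation L := (log_ratio m s f).
Local Notation S := (@Defs.shift _ R).

Variable D : R.
Hypothesis L_int : \forall n \near \oo, P.-integrable setT (EFin \o L n).
Hypothesis L_cvg : (fun n => n%:R^-1 * \int[P]_w L n w) @ \oo --> D.

(** Gibbs' inequality for the constant density 1 with respect to mu^n. The sign makes the exponent
    c1 of the covering argument nonnegative, so that uncovered letters can only lower the bound. *)
Lemma divergence_rate_ge0 : 0 <= D.
Proof.
rewrite -(cvg_lim _ L_cvg)//; apply: limr_ge; first by apply/cvg_ex; exists D.
apply: filterS L_int => n iL; rewrite mulr_ge0 ?invr_ge0//.
have := @gibbs R m s s_gt0 P f f_meas f_ge0 f_dens n (fun=> 1%E) (fun=> 0).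
rewrite (Rintegral_prob_cst P); apply => //.
- exact: measurable_cst.
- by rewrite itint_prob1.
- exact: integrable_prob_cst.
- by move=> w; rewrite expR0.
Qed.

Variable G : seq R -> \bar R.
Hypothesis mG : forall n, mseq n G.
Hypothesis G0 : forall l, (0 <= G l)%E.
Hypothesis G1 : forall n, (itint mu n G <= 1)%E.

Let gd c n : set (pathspace R) :=
  [set w | ((expR (n%:R * c))%:E <= gap_mix G (block n w))%E].

Let measurable_gd c n : measurable (gd c n).
Proof.
have mg := measurable_block_comp (mseq_gap_mix mG (n := n)).
rewrite (_ : gd c n = (fun w : pathspace R => gap_mix G (block n w)) @^-1`
   [set x | ((expR (n%:R * c))%:E <= x)%E]) //.
rewrite -[X in measurable X]setTI; apply: mg => //.
rewrite (_ : [set x | _] = `[(expR (n%:R * c))%:E, +oo%E]%classic).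
  exact: emeasurable_itv.
by apply/seteqP; split => x /=; rewrite in_itv/= leey andbT.
Qed.

Section cover.
Variables (dl : R) (n0 M : nat) (c1 e : R).
Hypothesis dl01 : 0 < dl < 1.
Hypothesis n0_gt0 : (0 < n0)%N.
Hypothesis c1_ge0 : 0 <= c1.
Hypothesis dl_weight : forall n, (n0 <= n)%N ->
  expR (- (n%:R * e)) <= dl * npd_weight n.

(** The surplus [e] in the exponent pays for the weight of the block in the mixture, by [dl_weight].
    The cap [M] ensures that a block can fail to fit only near the end of the word. *)
Definition good : set (pathspace R) :=
  [set w | exists2 n, (n0 <= n <= M)%N & gd (c1 + e) n w].

Let b : pathspace R -> R := \1_(~` good).
Let bad_count N w := \sum_(i < N) b (iter i S w).
Let rho := - ln (1 - dl).
(** The logarithm guaranteed by a greedy parsing: a gain of c1 per letter, forfeited at bad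
    positions and on the last M letters, minus the price rho of a single letter, charged at all N
    positions for simplicity. *)
Let lower N w := c1 * (N%:R - bad_count N w - M%:R) - N%:R * rho.

Lemma measurable_good : measurable good.
Proof.
rewrite (_ : good = \bigcup_(n in [set n | (n0 <= n <= M)%N]) gd (c1 + e) n).
  by apply: bigcup_measurable => n _; exact: measurable_gd.
by apply/seteqP; split => w [n ? ?]; exists n.
Qed.

Let dl1 : 0 < 1 - dl. Proof. by case/andP: dl01; rewrite subr_gt0. Qed.

Let expR_rho : expR (- rho) = 1 - dl.
Proof. by rewrite /rho opprK lnK. Qed.

Let rho_ge0 : 0 <= rho.
Proof.
rewrite /rho oppr_ge0 ln_le0// lerBlDr lerDl; by case/andP: dl01 => /ltW.
Qed.

Let b_ge0 w : 0 <= b w. Proof. by rewrite /b indicE. Qed.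

Let bad_count_split k N w :
  bad_count (k + N) w = bad_count k w + bad_count N (iter k S w).
Proof.
rewrite /bad_count big_split_ord/=; congr (_ + _).
by apply: eq_bigr => i _; rewrite addnC iterD.
Qed.

Let bad_count_ge0 N w : 0 <= bad_count N w.
Proof. exact: sumr_ge0. Qed.

Let pr := parse_mix G dl n0.

Let parse_letters j N w : ((expR (- (N%:R * rho)))%:E <= pr j (block N w))%E.
Proof.
elim: j N w => [|j IH] N w.
  by rewrite /= lee_fin -expR0 ler_expR oppr_le0 mulr_ge0.
case: N => [|N].
  rewrite mul0r oppr0 expR0 (_ : tval (block 0 w) = [::])//.
  exact: size0nil (size_tuple _).
apply: le_trans (parse_letter G0 n0 dl01 j _); last by rewrite size_tuple.
rewrite -add1n block_drop; apply: le_trans (lee_wpmul2l _ (IH N _)); last first.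
  by rewrite lee_fin ltW.
rewrite -EFinM lee_fin -expR_rho -expRD natrD mulrDl mul1r opprD.
exact: lexx.
Qed.

(** Parse greedily from the left: at a good position take a block, otherwise a letter, and spell out
    the rest once at most M letters remain. Each piece has at least one letter, so a depth [j] >= N
    never runs out. *)
Lemma parse_lower_bound j N w : (N <= j)%N ->
  ((expR (lower N w))%:E <= pr j (block N w))%E.
Proof.
elim: j N w => [|j IH] N w Nj.
  move: Nj; rewrite leqn0 => /eqP ->; apply: le_trans (parse_letters 0 0 w).
  rewrite lee_fin ler_expR /lower /bad_count big_ord0 !mul0r.
  by have := mulr_ge0 c1_ge0 (ler0n R M); lra.
(* Here c1 (N - M) <= 0, so single letters alone already reach [lower]. *)
case: (leqP N M) => NM.
  apply: le_trans (parse_letters j.+1 N w); rewrite lee_fin ler_expR /lower.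
  have := mulr_ge0 c1_ge0 (bad_count_ge0 N w).
  have : 0 <= c1 * (M%:R - N%:R) by rewrite mulr_ge0// subr_ge0 ler_nat.
  by lra.
case: N Nj NM => // N Nj NM.
case: (pselect (good w)) => [[n /andP[n0n nM] gn]|ngood].
  have nN : (n <= N.+1)%N by rewrite (leq_trans nM) 1?ltnW.
  have n_gt0 : (0 < n)%N by exact: leq_trans n0n.
  apply: le_trans (parse_block G0 dl01 n0_gt0 j (n := n) _); last first.
    by rewrite size_tuple n0n.
  rewrite -(subnKC nN) block_take block_drop.
  set N' := (N.+1 - n)%N.
  have N'j : (N' <= j)%N.
    by rewrite -ltnS (leq_trans _ Nj)// /N' ltn_subrL n_gt0.
  (* Bad positions inside the block and its share of rho only decrease the left side, as c1 and rho
     are nonnegative; the term n e is kept apart for the weight of the block. *)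
  have lowerE : lower (n + N') w <= - (n%:R * e) + (n%:R * (c1 + e) + lower N' (iter n S w)).
    rewrite /lower bad_count_split natrD.
    have := mulr_ge0 c1_ge0 (bad_count_ge0 n w).
    have := mulr_ge0 (ler0n R n) rho_ge0.
    by lra.
  apply: (@le_trans _ _ ((expR (- (n%:R * e)))%:E *
      ((expR (n%:R * (c1 + e)))%:E * (expR (lower N' (iter n S w)))%:E))%E).
    by rewrite -!EFinM lee_fin -!expRD ler_expR.
  apply: lee_pmul; rewrite ?lee_fin ?expR_ge0//.
  - exact: dl_weight.
  apply: lee_pmul; rewrite ?lee_fin ?expR_ge0//.
  exact: IH.
apply: le_trans (parse_letter G0 n0 dl01 j _); last by rewrite size_tuple.
rewrite -add1n block_drop; apply: le_trans (lee_wpmul2l _ (IH N _ Nj)); last first.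
  by rewrite lee_fin ltW.
rewrite -EFinM lee_fin -expR_rho -expRD ler_expR /lower bad_count_split natrD.
have -> : bad_count 1 w = 1.
  by rewrite /bad_count big_ord_recl big_ord0 addr0 /= /b indicE mem_set.
by lra.
Qed.

(** By stationarity the expected number of bad positions among N is N (1 - P good). Gibbs'
    inequality for the mixture, divided by N, leaves the boundary term c1 M / N, which vanishes as N
    grows with M fixed. *)
Lemma cover_bound : c1 * fine (P good) - rho <= D.
Proof.
have ib : P.-integrable setT (EFin \o b).
  by apply: integrable_indic; exact: measurableC measurable_good.
have Eb : \int[P]_w b w = 1 - fine (P good).
  rewrite /Rintegral integral_indic//; last exact: measurableC measurable_good.
  rewrite setIT [X in fine X](probability_setC P measurable_good) fineB//.
  exact: fin_num_measure measurable_good.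
have ibc N : P.-integrable setT (EFin \o bad_count N).
  rewrite (_ : _ \o _ = fun w => (\sum_(i < N) (b (iter i S w))%:E)%E).
    by apply: integrable_sum => // i _; exact: (integrable_iter_shift ergP.1).
  by apply/funext => w /=; rewrite sumEFin.
have Ebc N : \int[P]_w bad_count N w = N%:R * (1 - fine (P good)).
  elim: N => [|N IH].
    rewrite mul0r -[RHS](Rintegral_prob_cst P 0); apply: eq_Rintegral => w _.
    by rewrite /bad_count big_ord0.
  transitivity (\int[P]_w (bad_count N w + b (iter N S w))).
    by apply: eq_Rintegral => w _; rewrite /bad_count big_ord_recr.
  rewrite RintegralD//; last exact: (integrable_iter_shift ergP.1 N ib).
  by rewrite IH (Rintegral_iter_shift ergP.1 N ib) Eb -natr1 mulrDl mul1r.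
have lowerE N : lower N = fun w => (c1 * (N%:R - M%:R) - N%:R * rho) - c1 * bad_count N w.
  by apply/funext => w; rewrite /lower; ring.
have icbc N : P.-integrable setT (EFin \o (fun w => c1 * bad_count N w)).
  rewrite (_ : _ \o _ = fun w => (c1%:E * (bad_count N w)%:E)%E).
    exact: (integrableZl measurableT c1 (ibc N)).
  by apply/funext => w /=; rewrite EFinM.
have il N : P.-integrable setT (EFin \o lower N).
  rewrite lowerE (_ : _ \o _ = (EFin \o (fun=> (c1 * (N%:R - M%:R) - N%:R * rho)%R)) \-
      (EFin \o (fun w => (c1 * bad_count N w)%R)))%E.
    exact: (integrableB _ (integrable_prob_cst P _) (icbc N)).
  by apply/funext.
have El N : \int[P]_w lower N w =
    (c1 * (N%:R - M%:R) - N%:R * rho) - c1 * (N%:R * (1 - fine (P good))).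
  rewrite lowerE (RintegralB measurableT (integrable_prob_cst P _) (icbc N)).
  by rewrite (Rintegral_prob_cst P) RintegralZl// Ebc.
have key : \forall N \near \oo,
    c1 * fine (P good) - rho - N%:R^-1 * (c1 * M%:R) <= N%:R^-1 * \int[P]_w L N w.
  apply: filterS2 L_int (nbhs_infty_gt 0) => N iL N0.
  have N0' : N%:R != 0 :> R by rewrite pnatr_eq0 -lt0n.
  rewrite (_ : _ - _ - _ = N%:R^-1 * \int[P]_w lower N w); last first.
    by rewrite El; field.
  rewrite ler_wpM2l ?invr_ge0//.
  apply: (@gibbs R m s s_gt0 P f f_meas f_ge0 f_dens N (pr N)) => //.
  - exact: mseq_parse_mix.
  - by move=> l; exact: parse_mix_ge0.
  - exact: itint_parse_mix.
  - by move=> w; exact: parse_lower_bound.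
have lim1 : (fun N => c1 * fine (P good) - rho - N%:R^-1 * (c1 * M%:R)) @ \oo -->
    c1 * fine (P good) - rho.
  rewrite -[X in _ --> X]subr0; apply: cvgB; first exact: cvg_cst.
  rewrite -[X in _ --> X](mul0r (c1 * M%:R)); apply: cvgM; last exact: cvg_cst.
  by rewrite -cvg_shiftS; exact: cvg_harmonic.
exact: ler_cvg_to lim1 L_cvg key.
Qed.

End cover.

Lemma eventually_lt_subdensity c : D < c ->
  {ae P, forall w, \forall n \near \oo, (G (block n w) < (expR (n%:R * c))%:E)%E}.
Proof.
move=> Dc.
pose E n : set (pathspace R) := [set w | ((expR (n%:R * c))%:E <= G (block n w))%E].
have mE n : measurable (E n).
  have mg := measurable_block_comp (mG (n := n)).
  rewrite -[X in measurable X]setTI.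
  rewrite (_ : E n = (fun w : pathspace R => G (block n w)) @^-1`
     `[(expR (n%:R * c))%:E, +oo%E]%classic); first by apply: mg => //; exact: emeasurable_itv.
  by apply/seteqP; split => x /=; rewrite in_itv/= leey andbT.
pose A := \bigcap_N \bigcup_k E (N + k)%N.
have mA : measurable A.
  by apply: bigcapT_measurable => N; exact: bigcupT_measurable.
have [PA|PA] := eqVneq (P A) 0%E.
  exists A; split => // w /= nev N _; apply: contrapT => nE; apply: nev.
  exists N => // n /= Nn; rewrite ltNge; apply/negP => h; apply: nE.
  by exists (n - N)%N => //; rewrite /E/= subnKC.
exfalso.
(* The margin c = D + 4 k4 is spent in steps: one k4 on the skipped prefix and its weight, one on
   the weights of the blocks, one on the single letters. The k4 that remains contradicts Gibbs'
   inequality. *)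
pose k4 := (c - D) / 4.
have k4_gt0 : 0 < k4 by rewrite divr_gt0// subr_gt0.
have D0 := divergence_rate_ge0.
have io_gd : {ae P, forall w, forall n0, exists2 n, (n0 <= n)%N & gd (D + 3 * k4) n w}.
  move: (ergodic_recurrence ergP mA PA); apply: ae_mono => w [k Ak] n0.
  have wk := @npd_weight_gt0 R k.
  (* For n >= N, n k4 is at least k c - ln (npd_weight k), which covers the k skipped letters and
     the weight of skipping them. *)
  pose N := (n0 + (truncn ((k%:R * c - ln (npd_weight k)) / k4)).+1)%N.
  have [i _ hi] := Ak N I.
  exists (k + (N + i))%N.
    by rewrite (leq_trans _ (leq_addl _ _))// /N -!addnA leq_addr.
  have kn : (k < size (block (k + (N + i)) w))%N.
    by rewrite size_tuple /N addnS addSn addnS ltnS leq_addr.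
  rewrite /gd/= /gap_mix (bigD1 (Ordinal kn))//=.
  apply: lee_paddr.
    by apply: sume_ge0 => j _; rewrite mule_ge0// lee_fin ltW// npd_weight_gt0.
  rewrite block_drop.
  apply: le_trans (lee_wpmul2l _ hi); last by rewrite lee_fin ltW.
  rewrite -EFinM lee_fin -[npd_weight k]lnK ?posrE// -expRD ler_expR.
  set n := (N + i)%N; rewrite natrD.
  have : (k%:R * c - ln (npd_weight k)) / k4 <= n%:R.
    apply: le_trans (ltW (truncnS_gt _)) _.
    by rewrite ler_nat /n /N (leq_trans _ (leq_addr _ _))// leq_addl.
  rewrite ler_pdivrMr// => h.
  have cE : c = D + 4 * k4 by rewrite /k4; field.
  have := mulr_ge0 (ler0n R k) (ltW k4_gt0).
  move: h; rewrite cE; lra.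
(* With this choice the price - ln (1 - dl) of a single letter is exactly k4. *)
pose dl := 1 - expR (- k4).
have dl01 : 0 < dl < 1.
  rewrite /dl subr_gt0 ltrBlDr ltrDl expR_gt0 andbT.
  by rewrite -[ltRHS]expR0 ltr_expR oppr_lt0.
have [n0 n0_gt0 hn0] := npd_weight_decay k4_gt0 (proj1 (andP dl01)).
have bound M : (D + 2 * k4) * fine (P (good n0 M (D + 2 * k4) k4)) - k4 <= D.
  have := @cover_bound dl n0 M (D + 2 * k4) k4 dl01 n0_gt0 _ hn0.
  by rewrite /dl subKr expRK opprK; apply; lra.
have mgood M := @measurable_good n0 M (D + 2 * k4) k4.
have ndgood : nondecreasing_seq (fun M => good n0 M (D + 2 * k4) k4).
  move=> i j ij; apply/subsetPset => w [n /andP[n0n ni] h]; exists n => //.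
  by rewrite n0n (leq_trans ni).
have mU : measurable (\bigcup_M good n0 M (D + 2 * k4) k4) by exact: bigcupT_measurable.
have PU : P (\bigcup_M good n0 M (D + 2 * k4) k4) = 1%E.
  have [B [mB B0 BS]] := io_gd.
  apply/eqP; rewrite eq_le probability_le1//=.
  have <- : P (~` B) = 1%E by rewrite probability_setC// B0 sube0.
  apply: le_measure; rewrite ?inE//; first exact: measurableC.
  move=> w Bw; have [n n0n gn] : exists2 n, (n0 <= n)%N & gd (D + 3 * k4) n w.
    apply: contrapT => h; apply: Bw; apply: BS => /= /(_ n0).
    exact: h.
  exists n => //; exists n; first by rewrite n0n leqnn.
  by rewrite (_ : _ + k4 = D + 3 * k4)//; ring.
have cvP : fine (P (good n0 M (D + 2 * k4) k4)) @[M --> \oo] --> (1 : R).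
  have : P (good n0 M (D + 2 * k4) k4) @[M --> \oo] -->
      P (\bigcup_M good n0 M (D + 2 * k4) k4) by exact: nondecreasing_cvg_mu.
  by rewrite PU => /fine_cvg.
have cv : (fun M => (D + 2 * k4) * fine (P (good n0 M (D + 2 * k4) k4)) - k4) @ \oo -->
    (D + 2 * k4) * 1 - k4.
  apply: cvgB; last exact: cvg_cst.
  by apply: cvgM; [exact: cvg_cst|exact: cvP].
have : (D + 2 * k4) * 1 - k4 <= D by apply: cvgr_to_le cv _; exact: nearW.
by lra.
Qed.

End limsup_subdensity.

(** * Words over a finite alphabet *)

Section words.
Context {R : realType} (K : nat).

(** Recursive in the same way as [itint], so that words can be cut with [take] and [drop];
    [word_sumE] ties it to the sum over tuples in [block_entropy]. *)
Fixpoint word_sum n (F : seq nat -> R) : R :=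
  if n is n'.+1 then \sum_(i < K) word_sum n' (fun u => F (nat_of_ord i :: u))
  else F [::].

Lemma word_sumE n (F : seq nat -> R) :
  \sum_(u : n.-tuple 'I_K) F (map_tuple (@nat_of_ord K) u) = word_sum n F.
Proof.
elim: n F => [|n IH] F /=.
  rewrite (big_pred1 [tuple])//= => u; apply/esym/eqP; exact: tuple0.
under [RHS]eq_bigr do rewrite -IH.
rewrite pair_big/=.
rewrite (reindex (fun p : 'I_K * n.-tuple 'I_K => cons_tuple p.1 p.2)) //=.
exists (fun u : n.+1.-tuple 'I_K => (thead u, behead_tuple u)).
- by move=> [x u] _ /=; rewrite theadE; congr pair; exact/val_inj.
- by move=> u _ /=; rewrite [RHS]tuple_eta; exact/val_inj.
Qed.

Lemma eq_word_sum n F F' : (forall u, size u = n -> all (fun i => i < K)%N u -> F u = F' u) ->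
  word_sum n F = word_sum n F'.
Proof.
elim: n F F' => [|n IH] F F' FF' /=; first exact: FF'.
apply: eq_bigr => i _; apply: IH => u un uK; apply: FF' => /=; first by rewrite un.
by rewrite ltn_ord.
Qed.

Lemma le_word_sum n F F' :
  (forall u, size u = n -> all (fun i => i < K)%N u -> F u <= F' u) ->
  word_sum n F <= word_sum n F'.
Proof.
elim: n F F' => [|n IH] F F' FF' /=; first exact: FF'.
apply: ler_sum => i _; apply: IH => u un uK; apply: FF' => /=; first by rewrite un.
by rewrite ltn_ord.
Qed.

Lemma word_sumZ n c F : word_sum n (fun u => c * F u) = c * word_sum n F.
Proof.
elim: n F => //= n IH F; rewrite mulr_sumr.
by apply: eq_bigr => i _; rewrite IH.
Qed.

Lemma word_sumB n F F' :
  word_sum n (fun u => F u - F' u) = word_sum n F - word_sum n F'.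
Proof.
elim: n F F' => //= n IH F F'; rewrite -sumrB.
by apply: eq_bigr => i _; rewrite IH.
Qed.

Lemma word_sum_prod k n F F' :
  word_sum (k + n) (fun u => F (take k u) * F' (drop k u)) =
  word_sum k F * word_sum n F'.
Proof.
elim: k F => [|k IH] F /=.
  by rewrite add0n -word_sumZ; apply: eq_word_sum => u _ _; rewrite take0 drop0.
rewrite mulr_suml; apply: eq_bigr => i _.
by rewrite -(IH (fun u => F (nat_of_ord i :: u))).
Qed.

(** Termwise p ln (g / p) <= g - p, from ln x <= x - 1. The condition on supports keeps g / p
    positive where p is. *)
Lemma word_gibbs n (p g : seq nat -> R) :
  (forall u, 0 <= p u) -> (forall u, 0 <= g u) ->
  (forall u, 0 < p u -> 0 < g u) ->
  word_sum n p = 1 -> word_sum n g <= 1 ->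
  word_sum n (fun u => p u * ln (g u)) <= word_sum n (fun u => p u * ln (p u)).
Proof.
move=> p0 g0 pg p1 g1; rewrite -subr_le0 -word_sumB.
apply: (@le_trans _ _ (word_sum n (fun u => g u - p u))); last first.
  by rewrite word_sumB p1 subr_le0.
apply: le_word_sum => u _ _.
have := p0 u; rewrite le_eqVlt => /predU1P[<-|pu].
  by rewrite !mul0r !subr0.
rewrite -mulrBr -ln_div ?posrE ?pg//.
have : ln (g u / p u) <= g u / p u - 1.
  have := @le_ln1Dx R (g u / p u - 1); rewrite addrCA subrr addr0; apply.
  by rewrite ltrBrDl subrr divr_gt0// pg.
move=> h; apply: le_trans (ler_wpM2l (p0 u) h) _.
by rewrite mulrBr mulr1 mulrCA divff ?mulr1// gt_eqF.
Qed.

End words.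

Lemma word_sum_delta {R : realType} (K n : nat) (F : seq nat -> R) (l : seq nat) :
  size l = n -> all (fun i => i < K)%N l ->
  word_sum K n (fun u => F u * (l == u)%:R) = F l.
Proof.
elim: n F l => [|n IH] F [|x l] //=; first by rewrite mulr1.
move=> [ln] /andP[xK lK]; rewrite (bigD1 (Ordinal xK))//= big1 ?addr0.
  rewrite -[RHS](IH (fun u => F (x :: u)))//.
  by apply: eq_word_sum => u _ _; rewrite eqseq_cons eqxx.
move=> i ix.
rewrite (@eq_word_sum _ K n _ (fun u => 0 * F u)); first by rewrite word_sumZ mul0r.
move=> u _ _; rewrite eqseq_cons (_ : x == i = false) ?andFb ?mulr0 ?mul0r//.
by apply/negbTE; apply: contra ix => /eqP xi; apply/eqP/val_inj.
Qed.

Lemma measurable_word_sum d (X : measurableType d) {R : realType} (K n : nat)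
    (F : X -> seq nat -> R) :
  (forall u, measurable_fun setT (fun x => F x u)) ->
  measurable_fun setT (fun x => word_sum K n (F x)).
Proof.
elim: n F => [|n IH] F mF /=; first exact: mF.
by apply: measurable_sum => i; apply: IH => u; exact: mF.
Qed.

Lemma integrable_word_sum d (X : measurableType d) {R : realType}
    (P : probability X R) (K n : nat) (F : X -> seq nat -> R) :
  (forall u, P.-integrable setT (EFin \o F ^~ u)) ->
  P.-integrable setT (EFin \o (fun x => word_sum K n (F x))).
Proof.
elim: n F => [|n IH] F iF /=; first exact: iF.
rewrite (_ : _ \o _ = fun x => (\sum_(i < K)
    (word_sum K n (fun u => F x (nat_of_ord i :: u)))%:E)%E).
  by apply: integrable_sum => // i _; apply: IH => u; exact: iF.
by apply/funext => x /=; rewrite sumEFin.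
Qed.

Lemma Rintegral_sum d (X : measurableType d) {R : realType}
    (P : probability X R) (I : Type) (r : seq I) (F : I -> X -> R) :
  (forall i, P.-integrable setT (EFin \o F i)) ->
  \int[P]_x (\sum_(i <- r) F i x) = \sum_(i <- r) \int[P]_x F i x.
Proof.
move=> iF; elim: r => [|i r IH].
  rewrite big_nil -[RHS](Rintegral_prob_cst P 0).
  by apply: eq_Rintegral => x _; rewrite big_nil.
rewrite big_cons -IH -RintegralD//; last first.
  rewrite (_ : _ \o _ = fun x => (\sum_(i <- r) (F i x)%:E)%E).
    by apply: integrable_sum => // j _; exact: iF.
  by apply/funext => x /=; rewrite sumEFin.
by apply: eq_Rintegral => x _; rewrite big_cons.
Qed.

Lemma Rintegral_word_sum d (X : measurableType d) {R : realType}
    (P : probability X R) (K n : nat) (F : X -> seq nat -> R) :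
  (forall u, P.-integrable setT (EFin \o F ^~ u)) ->
  \int[P]_x word_sum K n (F x) = word_sum K n (fun u => \int[P]_x F x u).
Proof.
elim: n F => [//|n IH] F iF /=.
rewrite Rintegral_sum; last by move=> i; apply: integrable_word_sum => u; exact: iF.
by apply: eq_bigr => i _; rewrite IH// => u; exact: iF.
Qed.

(** * Coded paths and their word entropies *)

Section coding.
Context d (T : measurableType d) {R : realType} (K : nat) (q : T -> nat).
Hypothesis mq : measurable_fun [set: T] q.
Hypothesis qK : forall x, (q x < K)%N.
Local Notation S := (@Defs.shift d T).

Definition coded_path (w : pathspace T) : pathspace nat := fun k => q (w k).

Lemma measurable_coded_path : measurable_fun [set: pathspace T] coded_path.
Proof.
apply: measurable_to_pathspace => k; apply: measurableT_comp => //.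
exact: measurable_coord.
Qed.

Definition word n (w : pathspace T) : seq nat := map q (block n w).

Lemma size_word n w : size (word n w) = n.
Proof. by rewrite size_map size_tuple. Qed.

Lemma all_word n w : all (fun i => i < K)%N (word n w).
Proof. by apply/allP => i /mapP[x _ ->]. Qed.

Lemma block_coded_path n w : block n (coded_path w) = word n w :> seq nat.
Proof. by rewrite /word !val_block -map_comp. Qed.

Lemma word_take k n w : take k (word (k + n) w) = word k w.
Proof. by rewrite /word -map_take block_take. Qed.

Lemma word_drop k n w : drop k (word (k + n) w) = word n (iter k S w).
Proof. by rewrite /word -map_drop block_drop. Qed.

Definition cyl (u : seq nat) : set (pathspace T) := [set w | word (size u) w = u].

Lemma measurable_cyl u : measurable (cyl u).
Proof.
pose t := in_tuple u.
rewrite (_ : cyl u = \bigcap_(i in [set: 'I_(size u)])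
   ((fun w : pathspace T => q (w (Posz i.+1))) @^-1` [set tnth t i])).
  apply: fin_bigcap_measurable => // i _.
  rewrite -[X in measurable X]setTI; apply: measurableT_comp => //.
  exact: measurable_coord.
have wE w : word (size u) w = map_tuple q (block (size u) w) by [].
apply/seteqP; split => w /= => [h i _|h] /=.
  have -> : tnth t i = tnth (map_tuple q (block (size u) w)) i.
    by rewrite !(tnth_nth 0%N) -wE h.
  by rewrite tnth_map tnth_mktuple.
have e : map_tuple q (block (size u) w) = t.
  by apply: eq_from_tnth => i; rewrite tnth_map tnth_mktuple; exact: h.
by rewrite /cyl/= wE e.
Qed.

Lemma in_cyl n w u : size u = n -> (word n w == u) = (w \in cyl u).
Proof. by move=> <-; apply/eqP/idP; rewrite inE. Qed.

Variable P : probability (pathspace T) R.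

Definition word_prob (u : seq nat) : R := fine (P (cyl u)).

Lemma word_prob_ge0 u : 0 <= word_prob u.
Proof. exact: fine_ge0. Qed.

(** Finitely many words occur, so a function of the coded word is a combination of cylinder
    indicators; integrability and expectations reduce to those of the indicators. *)
Let wordE n w (F : seq nat -> R) :
  F (word n w) = word_sum K n (fun u => F u * \1_(cyl u) w).
Proof.
rewrite -[LHS](@word_sum_delta _ K n F); [|exact: size_word|exact: all_word].
by apply: eq_word_sum => u un _; rewrite in_cyl// indicE.
Qed.

Let integrable_cell F u : P.-integrable setT (EFin \o (fun w => F u * \1_(cyl u) w)).
Proof.
rewrite (_ : _ \o _ = fun w => ((F u)%:E * (\1_(cyl u) w)%:E)%E).
  apply: integrableZl => //; apply: integrable_indic; exact: measurable_cyl.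
by apply/funext => w; rewrite /= EFinM.
Qed.

Lemma integrable_word n (F : seq nat -> R) :
  P.-integrable setT (EFin \o (fun w => F (word n w))).
Proof.
rewrite (_ : _ \o _ = EFin \o (fun w => word_sum K n (fun u => F u * \1_(cyl u) w))).
  by apply: integrable_word_sum => u; exact: integrable_cell.
by apply/funext => w /=; rewrite [in LHS]wordE.
Qed.

Lemma integrable_letter (F : nat -> R) :
  P.-integrable setT (EFin \o (fun w : pathspace T => F (q (w 1)))).
Proof.
have := integrable_word 1 (fun u => F (head 0%N u)); congr (_.-integrable _ _).
by apply/funext => w; rewrite /= /word val_block.
Qed.

Lemma expectation_word n (F : seq nat -> R) :
  \int[P]_w F (word n w) = word_sum K n (fun u => word_prob u * F u).
Proof.
transitivity (\int[P]_w word_sum K n (fun u => F u * \1_(cyl u) w)).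
  by apply: eq_Rintegral => w _; rewrite [in LHS]wordE.
rewrite Rintegral_word_sum; last by move=> u; exact: integrable_cell.
apply: eq_word_sum => u _ _; rewrite RintegralZl//; last first.
  by apply: integrable_indic; exact: measurable_cyl.
rewrite mulrC /Rintegral integral_indic ?setIT//; exact: measurable_cyl.
Qed.

Lemma word_sum_prob n : word_sum K n word_prob = 1.
Proof.
rewrite -[RHS](Rintegral_prob_cst P 1) (expectation_word n (fun=> 1)).
by apply: eq_word_sum => u _ _; rewrite mulr1.
Qed.

Definition word_entropy n := - word_sum K n (fun u => word_prob u * ln (word_prob u)).

Lemma word_prob_le1 u : word_prob u <= 1.
Proof.
rewrite -lee_fin fineK; first by apply: probability_le1; exact: measurable_cyl.
by apply: fin_num_measure; exact: measurable_cyl.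
Qed.

Lemma word_entropy_ge0 n : 0 <= word_entropy n.
Proof.
rewrite oppr_ge0 -[leRHS](mul0r (word_sum K n (fun=> 0))) -word_sumZ.
apply: le_word_sum => u _ _; rewrite mul0r mulr_ge0_le0 ?word_prob_ge0//.
by rewrite ln_le0// word_prob_le1.
Qed.

Lemma word_entropy_le n (g : seq nat -> R) : (forall u, 0 <= g u) ->
  (forall u, 0 < word_prob u -> 0 < g u) -> word_sum K n g <= 1 ->
  word_entropy n <= - \int[P]_w ln (g (word n w)).
Proof.
move=> g0 pg g1; rewrite lerN2 (expectation_word n (fun u => ln (g u))).
apply: word_gibbs => //; [exact: word_prob_ge0|exact: word_sum_prob].
Qed.

Hypothesis statP : stationary P.

Lemma word_prob_take k u : word_prob u <= word_prob (take k u).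
Proof.
apply: fine_le; [exact: fin_num_measure (measurable_cyl _)|
  exact: fin_num_measure (measurable_cyl _)|].
apply: le_measure; rewrite ?inE; [exact: measurable_cyl|exact: measurable_cyl|].
move=> w; rewrite /cyl/= => h.
have [ku|uk] := leqP k (size u); last by rewrite take_oversize// ltnW.
by rewrite size_takel// -[in RHS]h -(subnKC ku) word_take.
Qed.

Lemma word_prob_drop k u : word_prob u <= word_prob (drop k u).
Proof.
have [ku|uk] := leqP k (size u); last first.
  apply: le_trans (word_prob_take 0 u) _.
  by rewrite take0 drop_oversize// ltnW.
apply: fine_le; [exact: fin_num_measure (measurable_cyl _)|
  exact: fin_num_measure (measurable_cyl _)|].
rewrite -(measure_iter_shift statP k (measurable_cyl (drop k u))).
apply: le_measure; rewrite ?inE; [exact: measurable_cyl| |].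
  exact: measurable_iter_shift_preimage (measurable_cyl _).
move=> w; rewrite /cyl/= => h.
by rewrite size_drop -[in RHS]h -[in RHS](subnKC ku) word_drop.
Qed.

(** Gibbs' inequality against the product of the laws of the two subwords; by stationarity the
    second subword has the law of an initial word. *)
Lemma word_entropy_subadd k n :
  word_entropy (k + n) <= word_entropy k + word_entropy n.
Proof.
pose g u := word_prob (take k u) * word_prob (drop k u).
have pg u : 0 < word_prob u -> 0 < word_prob (take k u) /\ 0 < word_prob (drop k u).
  by move=> pu; split; apply: lt_le_trans pu _; [exact: word_prob_take|exact: word_prob_drop].
apply: le_trans (word_entropy_le (n := k + n) (g := g) _ _ _) _.
- by move=> u; rewrite mulr_ge0 ?word_prob_ge0.
- by move=> u /pg[? ?]; rewrite mulr_gt0.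
- by rewrite word_sum_prod !word_sum_prob mulr1.
rewrite (expectation_word _ (fun u => ln (g u))).
rewrite (@eq_word_sum _ K _ _ (fun u => word_prob u *
    (ln (word_prob (take k u)) + ln (word_prob (drop k u))))); last first.
  move=> u _ _; have := word_prob_ge0 u; rewrite le_eqVlt => /predU1P[<-|/pg[h1 h2]].
    by rewrite !mul0r.
  by rewrite /g lnM ?posrE.
rewrite -(expectation_word _ (fun u => ln (word_prob (take k u)) + ln (word_prob (drop k u)))).
rewrite (RintegralD measurableT (integrable_word _ (fun u => ln (word_prob (take k u))))
  (integrable_word _ (fun u => ln (word_prob (drop k u))))).
rewrite opprD /word_entropy.
rewrite -!(expectation_word _ (fun u => ln (word_prob u))).
rewrite (_ : \int[P]_w ln (word_prob (take k (word (k + n) w))) =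
             \int[P]_w ln (word_prob (word k w))); last first.
  by apply: eq_Rintegral => w _; rewrite word_take.
rewrite (_ : \int[P]_w ln (word_prob (drop k (word (k + n) w))) =
             \int[P]_w ln (word_prob (word n w)))//.
rewrite -[RHS](Rintegral_iter_shift statP k (integrable_word n (fun u => ln (word_prob u)))).
by apply: eq_Rintegral => w _; rewrite word_drop.
Qed.

End coding.

(** * Subadditive sequences *)

Section fekete.
Context {R : realType} (a : nat -> R).
Hypothesis a_ge0 : forall n, 0 <= a n.
Hypothesis a_subadd : forall k n, a (k + n) <= a k + a n.

Let subadd_mul j k : a (j * k) <= j%:R * a k + a 0.
Proof.
elim: j => [|j IH]; first by rewrite mul0n mul0r add0r.
by rewrite mulSn -natr1 mulrDl mul1r; have := a_subadd k (j * k); lra.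
Qed.

(** The limit is the infimum. The second conclusion bounds the entropy rate by every block entropy
    per letter, so that a single block length can certify the lower bound. *)
Lemma fekete_subadditive :
  exists H, (fun n => n.+1%:R^-1 * a n.+1) @ \oo --> H /\
    forall n, H <= n.+1%:R^-1 * a n.+1.
Proof.
pose b n := n.+1%:R^-1 * a n.+1.
have b_ge0 n : 0 <= b n by rewrite mulr_ge0// invr_ge0.
have hi : has_inf (range b).
  by split; [exists (b 0); exists 0%N|exists 0 => _ [n _ <-]].
pose H := inf (range b).
have Hb n : H <= b n by apply: ge_inf; [exact: hi.2|exists n].
exists H; split => //; apply/cvgrPdist_le => e e0.
have [_ [k _ <-] bk] := inf_adherent (eps := e / 2) (divr_gt0 e0 (ltr0Sn R 1)) hi.
(* With n + 1 = j (k + 1) + r and r <= k, the remainder costs at most r a(1) + a(0) and the multiple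
   of k + 1 another a(0), which subadditivity alone does not make 0. *)
pose C := k.+1%:R * a 1 + a 0 + a 0.
exists (truncn (C / (e / 2))) => // n /= Nn.
have n1 : 0 < n.+1%:R :> R by rewrite ltr0n.
have Cn : C <= n.+1%:R * (e / 2).
  rewrite -ler_pdivrMr ?divr_gt0// (le_trans (ltW (truncnS_gt _)))//.
  by rewrite ler_nat ltnS.
rewrite distrC ger0_norm ?subr_ge0; last exact: Hb.
pose j := (n.+1 %/ k.+1)%N; pose r := (n.+1 %% k.+1)%N.
have an : a n.+1 <= j%:R * a k.+1 + C.
  rewrite [in leLHS](divn_eq n.+1 k.+1) -/j -/r.
  have := a_subadd (j * k.+1) r; have := subadd_mul j k.+1.
  have := subadd_mul r 1; rewrite muln1.
  have : r%:R * a 1 <= k.+1%:R * a 1.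
    by rewrite ler_wpM2r// ler_nat ltnW// ltn_pmod.
  by rewrite /C; lra.
have jk : j%:R * a k.+1 <= n.+1%:R * b k.
  have -> : a k.+1 = k.+1%:R * b k by rewrite /b mulVKf// pnatr_eq0.
  rewrite mulrA ler_wpM2r// -natrM ler_nat; exact: leq_trunc_div.
rewrite lerBlDr mulrC ler_pdivrMr//.
have : n.+1%:R * b k <= n.+1%:R * (H + e / 2) by rewrite ler_wpM2l// ltW.
by move: n1 Cn an jk; set x := n.+1%:R; set y := b k; nra.
Qed.

End fekete.

(** * The law of the coded process and universality *)

Section coded_process.
Context d (T : measurableType d) {R : realType} (K : nat) (q : T -> nat).
Hypothesis mq : measurable_fun [set: T] q.
Hypothesis qK : forall x, (q x < K)%N.
Variable P : probability (pathspace T) R.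
Hypothesis ergP : stationary_ergodic P.

Lemma code_process_exists :
  exists PY : probability (pathspace nat) R, forall A, PY A = P (coded_path q @^-1` A).
Proof.
pose c : {mfun pathspace T >-> pathspace nat} :=
  HB.pack (coded_path q) (isMeasurableFun.Build _ _ _ _ _ (measurable_coded_path mq)).
by exists (distribution P c).
Qed.

Variable PY : probability (pathspace nat) R.
Hypothesis PYE : forall A, PY A = P (coded_path q @^-1` A).

Let measurable_code_preimage A : measurable A -> measurable (coded_path q @^-1` A).
Proof. by move=> mA; rewrite -[X in measurable X]setTI; exact: measurable_coded_path. Qed.

(** Coding commutes with the shift, so invariant events of the coded process pull back to invariant
    events. *)
Lemma code_process_stationary_ergodic : stationary_ergodic PY.
Proof.
split=> [A mA|A mA SA].
- by rewrite !PYE -[RHS]ergP.1//; exact: measurable_code_preimage.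
- rewrite !PYE; apply: ergP.2; first exact: measurable_code_preimage.
  by rewrite -[in RHS]SA.
Qed.

Lemma code_process_supported : supported_on K PY.
Proof.
move=> k; rewrite PYE (_ : _ @^-1` _ = setT) ?probability_setT//.
by apply/seteqP; split => // w _ /=; exact: qK.
Qed.

Lemma word_cyl_code n (u : n.-tuple nat) :
  coded_path q @^-1` (word_cyl u) = cyl q u.
Proof.
apply/seteqP; split => w h.
  have e : block n (coded_path q w) = u by exact: h.
  by rewrite /cyl /mkset size_tuple -block_coded_path e.
have e : word q n w = u by have := h; rewrite /cyl /mkset size_tuple.
by apply: val_inj; exact: etrans (block_coded_path _ _ _) e.
Qed.

Lemma block_entropy_code n : block_entropy K PY n = word_entropy K q P n.
Proof.
rewrite /block_entropy /word_entropy -word_sumE; congr (- _); apply: eq_bigr => u _.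
by rewrite /= PYE word_cyl_code.
Qed.

Lemma universal_rate (Q : probability (pathspace nat) R) : universal K Q ->
  exists H, (forall n, H <= n.+1%:R^-1 * word_entropy K q P n.+1) /\
    {ae P, forall w, (fun n => - ((n.+1%:R^-1)%:E *
       lne (Q (word_cyl (map_tuple q (block n.+1 w))))))%E @ \oo --> H%:E}.
Proof.
move=> [_ uQ].
have [H [cvH leH]] := fekete_subadditive (word_entropy_ge0 K mq P)
  (word_entropy_subadd mq qK ergP.1).
exists H; split => //.
have cvH' : (fun n : nat => n.+1%:R^-1 * block_entropy K PY n.+1) @ \oo --> H.
  by under eq_fun do rewrite block_entropy_code.
have [[N [mN N0 sN]] _ _] := uQ PY H code_process_stationary_ergodic
   code_process_supported cvH'.
exists (coded_path q @^-1` N); split.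
- exact: measurable_code_preimage.
- by rewrite -PYE.
- move=> w /= nw; apply: sN => /= h; apply: nw.
  apply: cvg_trans h; apply: near_eq_cvg; apply: nearW => n /=.
  congr (- (_ * lne (Q (word_cyl _))))%E.
  by apply: val_inj; exact: block_coded_path.
Qed.

End coded_process.

(** Since only finitely many words occur, an arbitrary [v] is allowed: the function is a finite sum
    of multiples of word indicators, each a product over the positions. *)
Lemma measurable_cell_fun d (T : measurableType d) {R : realType} (K n : nat)
    (q : T -> nat) (v : seq nat -> R) :
  measurable_fun setT q -> (forall x, (q x < K)%N) ->
  measurable_fun [set: n.-tuple T] (fun t => v (map q t)).
Proof.
move=> mq qK.
rewrite (_ : (fun t => _) = fun t : n.-tuple T =>
    word_sum K n (fun u => v u * (map q t == u)%:R)); last first.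
  apply/funext => t; rewrite word_sum_delta//; first by rewrite size_map size_tuple.
  by apply/allP => i /mapP[x _ ->].
apply: measurable_word_sum => u; apply: measurable_funM => //.
have [un|un] := eqVneq (size u) n; last first.
  rewrite (_ : (fun t => _) = fun=> 0) //; apply/funext => t.
  case: eqP => // tu; move: un; rewrite -tu size_map size_tuple eqxx//.
rewrite (_ : (fun t => _) = fun t : n.-tuple T =>
    \prod_(i < n) (q (tnth t i) == nth 0%N u i)%:R).
  apply: measurable_prod => i _.
  rewrite (_ : (fun t => _) = (fun j : nat => (j == nth 0%N u i)%:R) \o
     (q \o (fun t : n.-tuple T => tnth t i)))//.
  apply: measurableT_comp => //; apply: measurableT_comp => //.
  exact: measurable_tnth.
apply/funext => t; case: (eqVneq (map q t) u) => [e|].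
  rewrite big1// => i _; rewrite -e.
  rewrite (nth_map (tnth t i)) ?size_tuple ?ltn_ord//.
  by rewrite -tnth_nth eqxx.
move=> ne; apply/esym/eqP; rewrite prodf_seq_eq0; apply: contraNT ne => h.
apply/eqP/(@eq_from_nth _ 0%N); first by rewrite size_map size_tuple.
rewrite size_map size_tuple => i iN.
move/hasPn : h => /(_ (Ordinal iN) (mem_index_enum _)) /=.
rewrite pnatr_eq0 eqb0 negbK => /eqP e; rewrite -[RHS]e.
rewrite (nth_map (tnth t (Ordinal iN))) ?size_tuple//.
by rewrite -[in LHS]/(nat_of_ord (Ordinal iN)) -tnth_nth.
Qed.

(** * Approximation by functions of cells *)

Section cell_approximation.
Context {R : realType} (K : nat -> nat) (q : nat -> R -> nat) (n : nat).
Hypothesis hpart : nested_partitions K q.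

Lemma measurable_cell l : measurable_fun [set: R] (q l).
Proof.
move=> _ B _; rewrite setTI.
rewrite (_ : q l @^-1` B = \bigcup_(i in B) (q l @^-1` [set i])); last first.
  apply/seteqP; split => [x Bx|x [i Bi e]]; first by exists (q l x).
  by rewrite /preimage/= e.
apply: bigcup_measurable => i _; have [_ _ _ _ <-] := hpart.
by apply: sub_sigma_algebra; exists l => //; exists i.
Qed.

Lemma cell_lt l x : (q l x < K l)%N.
Proof. by have [_ h _ _ _] := hpart; exact: h. Qed.

Lemma cell_refine l l' x y : (l <= l')%N -> q l' x = q l' y -> q l x = q l y.
Proof.
move=> /subnKC <-; elim: (l' - l)%N x y => [|k IH] x y; first by rewrite addn0.
rewrite addnS => e; apply: IH; have [_ _ _ h _] := hpart; exact: h.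
Qed.

(** The word of finer cells determines the coarser one, which [v'] reads off an arbitrary
    representative; [[::]] is a default for words that no sequence produces. Functions of cells at
    two levels can thus be compared at a common one. *)
Lemma cell_lift (Y : Type) l l' (v : seq nat -> Y) : (l <= l')%N ->
  exists v' : seq nat -> Y, forall t : seq R, v' (map (q l') t) = v (map (q l) t).
Proof.
move=> ll'; exists (fun u => v (map (q l) (xget [::] [set t | map (q l') t = u]))).
move=> t; congr v; case: xgetP => [s _ /= st|h]; last by case: (h t).
apply: (@eq_from_nth _ 0%N).
  by rewrite !size_map; have := congr1 size st; rewrite !size_map.
rewrite size_map => i si; have ti : (i < size t)%N.
  by have := congr1 size st; rewrite !size_map => <-.
rewrite !(nth_map 0)//; apply: (cell_refine ll').
by have := congr1 (nth 0%N ^~ i) st; rewrite !(nth_map 0).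
Qed.

Variable nu : {measure set (n.-tuple R) -> \bar R}.
Hypothesis nu_fin : (nu setT < +oo)%E.

Definition cell_approx (u : n.-tuple R -> R) := forall e : R, 0 < e ->
  exists l (v : seq nat -> R),
    (\int[nu]_t `|u t - v (map (q l) t)|%:E < e%:E)%E.

Let mcell l (v : seq nat -> R) :
  measurable_fun [set: n.-tuple R] (fun t => v (map (q l) t)).
Proof. exact: measurable_cell_fun (measurable_cell l) (cell_lt l). Qed.

Lemma dist_triangle (u v w : n.-tuple R -> R) : measurable_fun setT u ->
  measurable_fun setT v -> measurable_fun setT w ->
  (\int[nu]_t `|u t - w t|%:E <=
   \int[nu]_t `|u t - v t|%:E + \int[nu]_t `|v t - w t|%:E)%E.
Proof.
move=> mu mv mw.
have md (a b : n.-tuple R -> R) : measurable_fun setT a -> measurable_fun setT b ->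
    measurable_fun [set: n.-tuple R] (fun t => `|a t - b t|%:E).
  move=> ma mb; apply/measurable_EFinP; apply: measurableT_comp => //.
  exact: measurable_funB.
rewrite -ge0_integralD//; [|exact: md|exact: md].
apply: ge0_le_integral => //; [exact: md| |].
  by apply: emeasurable_funD; exact: md.
by move=> t _; rewrite -EFinD lee_fin; exact: ler_distD.
Qed.

Lemma cell_approx_lim (u : n.-tuple R -> R) : measurable_fun setT u ->
  (forall e : R, 0 < e -> exists u', [/\ measurable_fun setT u', cell_approx u' &
     (\int[nu]_t `|u t - u' t|%:E < e%:E)%E]) -> cell_approx u.
Proof.
move=> mu h e e0; have e2 : 0 < e / 2 by rewrite divr_gt0.
have [u' [mu' au' uu']] := h _ e2; have [l [v hv]] := au' _ e2.
exists l, v; apply: le_lt_trans (dist_triangle mu mu' (mcell l v)) _.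
by rewrite [e in ltRHS]splitr EFinD lteD.
Qed.

Lemma cell_approxD (u1 u2 : n.-tuple R -> R) : measurable_fun setT u1 -> measurable_fun setT u2 ->
  cell_approx u1 -> cell_approx u2 -> cell_approx (fun t => u1 t + u2 t).
Proof.
move=> mu1 mu2 a1 a2 e e0; have e2 : 0 < e / 2 by rewrite divr_gt0.
have [l1 [v1 h1]] := a1 _ e2; have [l2 [v2 h2]] := a2 _ e2.
have [v1' v1E] := cell_lift v1 (leq_maxl l1 l2).
have [v2' v2E] := cell_lift v2 (leq_maxr l1 l2).
exists (maxn l1 l2), (fun u => v1' u + v2' u).
rewrite [e in ltRHS]splitr EFinD; apply: le_lt_trans (lteD h1 h2).
have md (a b : n.-tuple R -> R) : measurable_fun setT a -> measurable_fun setT b ->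
    measurable_fun [set: n.-tuple R] (fun t => `|a t - b t|%:E).
  move=> ma mb; apply/measurable_EFinP; apply: measurableT_comp => //.
  exact: measurable_funB.
rewrite -ge0_integralD//; [|exact: md (mcell l1 v1)|exact: md (mcell l2 v2)].
apply: ge0_le_integral => //.
- apply: md; first exact: measurable_funD.
  exact: (mcell _ (fun u => v1' u + v2' u)).
- by apply: emeasurable_funD; [exact: md (mcell l1 v1)|exact: md (mcell l2 v2)].
- move=> t _; rewrite -EFinD lee_fin v1E v2E opprD addrACA; exact: ler_normD.
Qed.

Lemma cell_approxZ (c : R) (u : n.-tuple R -> R) : measurable_fun setT u ->
  cell_approx u -> cell_approx (fun t => c * u t).
Proof.
move=> mu a e e0.
have c1 : 0 < `|c| + 1 by rewrite ltr_wpDl.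
have [l [v h]] := a (e / (`|c| + 1)) (divr_gt0 e0 c1).
exists l, (fun s => c * v s).
have md : measurable_fun [set: n.-tuple R] (fun t => `|u t - v (map (q l) t)|%:E).
  apply/measurable_EFinP; apply: measurableT_comp => //.
  by apply: measurable_funB => //; exact: mcell.
apply: (@le_lt_trans _ _ ((`|c| + 1)%:E * \int[nu]_t `|u t - v (map (q l) t)|%:E)%E).
  rewrite -ge0_integralZl//.
  apply: ge0_le_integral => //.
  - apply/measurable_EFinP; apply: measurableT_comp => //; apply: measurable_funB.
      exact: measurable_funM.
    exact: (mcell l (fun s => c * v s)).
  - exact: measurable_funeM.
  - move=> t _; rewrite -EFinM lee_fin -mulrBr normrM ler_wpM2r//.
    by rewrite lerDl.
by rewrite muleC -lte_pdivlMr// -EFinM.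
Qed.

Let cell_sets : set (set (n.-tuple R)) :=
  [set B | exists l (Z : set (seq nat)), B = [set t : n.-tuple R | Z (map (q l) t)]].

(** Each coordinate is measurable for the sigma-algebra of the cell sets, because the cells of all
    levels generate the Borel sets of the line; hence so is the identity. *)
Let measurable_cell_sets A : measurable A -> <<s cell_sets >> A.
Proof.
move=> mA.
pose Y := g_sigma_algebraType (cell_sets : set (set (n.-tuple R))).
have mid : measurable_fun [set: Y] (fun y : Y => (y : n.-tuple R)).
  apply/measurable_fun_tnthP => i.
  have [_ _ _ _ gen] := hpart.
  apply: (@measurability _ _ _ _ setT _
     [set q l @^-1` [set i] | l in [set: nat] & i in [set: nat]]) => //.
  move=> _ [_ [l _ [j _ <-]] <-]; rewrite setTI; apply: sub_sigma_algebra.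
  exists l, (fun s => nth 0%N s i = j).
  apply/seteqP; split => t /=; rewrite (nth_map (tnth t i)) ?size_tuple ?ltn_ord//.
    by rewrite -tnth_nth.
  by rewrite -tnth_nth.
by have := mid measurableT _ mA; rewrite setTI.
Qed.

(** A pi-lambda argument: cell sets are stable under intersection once lifted to a common level, and
    the sets with approximable indicator form a lambda-system. Increasing unions rely on [nu] being
    finite. *)
Lemma cell_approx_indic A : measurable A -> cell_approx \1_A.
Proof.
move=> mA; suff : [set B | measurable B /\ cell_approx \1_B] A by case.
have sub : <<s cell_sets >> `<=` [set B | measurable B /\ cell_approx \1_B].
  have mI (B : set (n.-tuple R)) : measurable B ->
    measurable_fun setT (\1_B : n.-tuple R -> R) by move=> ?; exact: measurable_indic.
  have cell_setsE l (Z : set (seq nat)) :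
      (\1_[set t : n.-tuple R | Z (map (q l) t)] : n.-tuple R -> R) =
      fun t => \1_Z (map (q l) t).
    by apply/funext => t; rewrite !indicE; congr (nat_of_bool _)%:R; apply/idP/idP; rewrite !inE.
  apply: lambda_system_subset => //.
  - move=> _ _ [l1 [Z1 ->]] [l2 [Z2 ->]].
    have [Z1' Z1E] := cell_lift Z1 (leq_maxl l1 l2).
    have [Z2' Z2E] := cell_lift Z2 (leq_maxr l1 l2).
    exists (maxn l1 l2), (fun s => Z1' s /\ Z2' s).
    by apply/seteqP; split => t /=; rewrite Z1E Z2E.
  - split => //.
    + split => // e e0; exists 0%N, (fun=> 1).
      rewrite (_ : (\int[nu]_t _)%E = 0%E)// integral0_eq// => t _.
      by rewrite indicT subrr normr0.
    + move=> B C CB [mB aB] [mC aC]; split; first exact: measurableD.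
      rewrite (_ : \1_(B `\` C) = fun t => \1_B t + (-1) * \1_C t).
        apply: cell_approxD; [exact: mI|by apply: measurable_funM => //; exact: mI|by []|].
        by apply: cell_approxZ => //; exact: mI.
      apply/funext => t; rewrite !indicE in_setD.
      have : t \in C -> t \in B by rewrite !inE; exact: CB.
      by case: (t \in C); case: (t \in B) => //= h; rewrite ?mulr0 ?addr0 ?mulr1 ?subrr//; have := h isT.
    + move=> F ndF mF; have mU : measurable (\bigcup_i F i).
        by apply: bigcupT_measurable => i; have [] := mF i.
      split => //; apply: cell_approx_lim => [|e e0]; first exact: mI.
      have cvF : nu (F i) @[i --> \oo] --> nu (\bigcup_i F i).
        by apply: nondecreasing_cvg_mu => // i; have [] := mF i.
      have nuU (B : set (n.-tuple R)) : measurable B -> nu B \is a fin_num.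
        move=> mB; rewrite ge0_fin_numE//; apply: le_lt_trans nu_fin.
        by apply: le_measure; rewrite ?inE.
      have : \forall i \near \oo, (nu (\bigcup_i F i) - nu (F i) < e%:E)%E.
        have /fine_cvgP[_ /cvgrPdist_lt /(_ _ e0)] : nu (F i) @[i --> \oo] -->
           (fine (nu (\bigcup_i F i)))%:E by rewrite fineK ?nuU.
        apply: filterS => i /=; have [mFi _] := mF i.
        rewrite -[nu (\bigcup_i F i)]fineK ?nuU// -[nu (F i)]fineK ?nuU// -EFinB lte_fin.
        by move=> /ltr_normlW.
      move=> [i _ /(_ i (leqnn _)) /= hi]; exists \1_(F i); have [mFi aFi] := mF i.
      split => //.
      have eD : nu (\bigcup_i F i `\` F i) = (nu (\bigcup_i F i) - nu (F i))%E.
        rewrite measureD//; last by rewrite ltey_eq nuU.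
        by congr (_ - nu _)%E; apply/setIidr => t Ft; exists i.
      apply: le_lt_trans hi; rewrite -eD.
      rewrite -[X in (_ <= nu X)%E]setIT -integral_indic//; last exact: measurableD.
      apply: ge0_le_integral => //.
      * apply/measurable_EFinP; apply: measurableT_comp => //; apply: measurable_funB; exact: mI.
      * by apply/measurable_EFinP; apply: mI; exact: measurableD.
      * move=> t _; rewrite lee_fin !indicE in_setD.
        have : t \in F i -> t \in \bigcup_i F i by rewrite !inE => ?; exists i.
        by case: (t \in F i); case: (t \in _) => //= h; rewrite ?subrr ?subr0 ?normr0 ?normr1//; have := h isT.
  - move=> _ [l [Z ->]]; split.
      rewrite (_ : [set t | _] = (fun t : n.-tuple R => \1_Z (map (q l) t) : R) @^-1` [set 1]).
        by rewrite -[X in measurable X]setTI; exact: (mcell l \1_Z).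
      apply/seteqP; split => t /=; rewrite indicE.
        by move=> h; rewrite mem_set.
      by case: (boolP (_ \in _)) => [|_ /eqP]; rewrite ?inE// eq_sym oner_eq0.
    move=> e e0; exists l, \1_Z.
    rewrite (_ : (\int[nu]_t _)%E = 0%E)// integral0_eq// => t _.
    by rewrite cell_setsE subrr normr0.
by apply: sub; exact: measurable_cell_sets.
Qed.

Import HBSimple.

Lemma cell_approx_sfun (g : {sfun n.-tuple R >-> R}) : cell_approx g.
Proof.
rewrite (_ : (g : _ -> R) = fun t => \sum_(y <- finmap.enum_fset (fset_set (range g))) y * \1_(g @^-1` [set y]) t).
  have mI y : measurable_fun setT (\1_(g @^-1` [set y]) : n.-tuple R -> R).
    exact: measurable_indic.
  elim: (finmap.enum_fset (fset_set (range g))) => [|y r IH].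
    move=> e e0; exists 0%N, (fun=> 0).
    rewrite (_ : (\int[nu]_t _)%E = 0%E)// integral0_eq// => t _.
    by rewrite big_nil subrr normr0.
  rewrite (_ : (fun t => _) = fun t => y * \1_(g @^-1` [set y]) t +
      \sum_(y <- r) y * \1_(g @^-1` [set y]) t); last first.
    by apply/funext => t; rewrite big_cons.
  apply: cell_approxD => //.
  - exact: measurable_funM.
  - by apply: measurable_sum => z; exact: measurable_funM.
  - by apply: cell_approxZ => //; apply: cell_approx_indic.
by apply/funext => t; rewrite [LHS]fimfunE fsbig_finite.
Qed.

Lemma cell_approx_integrable (u : n.-tuple R -> R) : nu.-integrable setT (EFin \o u) -> cell_approx u.
Proof.
move=> iu; have [g [_ _ cv]] := approximation_sfun_integrable measurableT iu.
apply: cell_approx_lim => [|e e0].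
  by apply/measurable_EFinP; exact: measurable_int iu.
have /fine_cvgP[fin /cvgrPdist_lt /(_ _ e0) h] := cv.
have [i _ /(_ i (leqnn _)) [f1 f2]] := filterI fin h.
exists (g i); split; [by []|exact: cell_approx_sfun|].
rewrite -[ltLHS]fineK// lte_fin; move: f2; rewrite /= sub0r normrN.
exact: le_lt_trans (ler_norm _).
Qed.

End cell_approximation.

(** * The Gaussian measure on tuples and the masses of cells *)

Lemma density_measure_exists d (X : measurableType d) (R : realType)
    (m : {measure set X -> \bar R}) (g : X -> R) :
  measurable_fun setT g -> (forall x, 0 <= g x) ->
  exists M : {measure set X -> \bar R}, forall A, measurable A ->
    M A = (\int[m]_(x in A) (g x)%:E)%E.
Proof.
move=> mg g0; pose D (A : set X) := (\int[m]_(x in A) (g x)%:E)%E.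
have D0 : D set0 = 0%E by rewrite /D integral_set0.
have Dge0 A : (0 <= D A)%E by apply: integral_ge0 => x _; rewrite lee_fin.
have Dadd : semi_sigma_additive D.
  move=> F mF tF mUF; rewrite /D ge0_integral_bigcup//; last 2 first.
  - by apply/measurable_EFinP; exact: measurable_funTS.
  - by move=> x _; rewrite lee_fin.
  by apply: is_cvg_ereal_nneg_natsum_cond => n _ _; exact: Dge0.
pose M : {measure set X -> \bar R} := HB.pack D (isMeasure.Build _ _ _ D D0 Dge0 Dadd).
by exists M.
Qed.

Section gauss_tuple.
Context {R : realType} (m s : R).
Hypothesis s_gt0 : 0 < s.
Local Notation mu := (normal_prob m s).

(** Turns [itint mu n] into integration against an actual finite measure on tuples, as the
    approximation by cells in L^1 demands. *)
Lemma gauss_tuple_measure n :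
  exists M : {measure set (n.-tuple R) -> \bar R}, (M setT < +oo)%E /\
    forall G, mseq n G -> (forall l, 0 <= G l)%E ->
      (\int[M]_t G t = itint mu n G)%E.
Proof.
have [ln [_ _ lnint]] := @lebesgue_n_measure R n.
have mg := measurable_gauss_dens m s (n := n).
have g0 (t : n.-tuple R) : 0 <= gauss_dens m s t by apply/ltW/gauss_dens_gt0.
have [M ME] := density_measure_exists ln mg g0.
have key G : mseq n G -> (forall l, 0 <= G l)%E -> (\int[M]_t G t = itint mu n G)%E.
  move=> mG G0; rewrite (ge0_integral_density mg g0 ME)//.
  rewrite -(@itint_normal _ _ _ s_gt0)//.
  rewrite -[RHS](lnint (fun l => (gauss_dens m s l)%:E * G l)%E); last 2 first.
  - by apply: emeasurable_funM => //; apply/measurable_EFinP.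
  - by move=> l; rewrite mule_ge0// lee_fin ltW// gauss_dens_gt0.
  by apply: eq_integral => t _; rewrite muleC.
exists M; split => //.
have := key (fun=> 1%E) (measurable_cst _) (fun=> lee01).
by rewrite itint_prob1 integral_cst// mul1e => ->; rewrite ltry.
Qed.

End gauss_tuple.

Section cells.
Context d (X : measurableType d) {R : realType} (mu : probability X R).
Variables (K : nat) (q : X -> nat).
Hypothesis mq : measurable_fun [set: X] q.
Hypothesis qK : forall x, (q x < K)%N.

Definition cell_mass (j : nat) : R := fine (mu (q @^-1` [set j])).

Lemma cell_mass_ge0 j : 0 <= cell_mass j. Proof. exact: fine_ge0. Qed.

Lemma measurable_cell_set j : measurable (q @^-1` [set j]).
Proof. by rewrite -[X in measurable X]setTI; exact: mq. Qed.

Lemma integral_cells (h : nat -> R) : (forall j, 0 <= h j) ->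
  (\int[mu]_x (h (q x))%:E = (\sum_(i < K) cell_mass i * h i)%:E)%E.
Proof.
move=> h0.
transitivity (\int[mu]_x (\sum_(i < K) (h i)%:E * (\1_(q @^-1` [set nat_of_ord i]) x)%:E))%E.
  apply: eq_integral => x _; rewrite (bigD1 (Ordinal (qK x)))//= big1 ?adde0.
    by rewrite indicE mem_set// mule1.
  move=> i iq; rewrite indicE memNset ?mule0//= => e.
  by move/eqP: iq; apply; exact: val_inj.
have mI (i : nat) : measurable_fun setT (fun x => (\1_(q @^-1` [set i]) x : R)%:E).
  by apply/measurable_EFinP; apply: measurable_indic; exact: measurable_cell_set.
rewrite ge0_integral_sum//; last 2 first.
- by move=> i; exact: measurable_funeM.
- by move=> i x _; rewrite mule_ge0// lee_fin.
rewrite -sumEFin; apply: eq_bigr => i _.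
rewrite ge0_integralZl//; last by rewrite lee_fin.
rewrite integral_indic ?setIT//; last exact: measurable_cell_set.
rewrite EFinM /cell_mass fineK; first by rewrite muleC.
by apply: fin_num_measure; exact: measurable_cell_set.
Qed.

Lemma itint_cells n (v : seq nat -> R) : (forall u, 0 <= v u) ->
  itint mu n (fun l => (v (map q l))%:E) =
  (word_sum K n (fun u => v u * \prod_(j <- u) cell_mass j))%:E.
Proof.
elim: n v => [|n IH] v v0 /=; first by rewrite big_nil mulr1.
under eq_integral => x _ do rewrite (IH (fun u => v (q x :: u)))//.
rewrite (integral_cells (h := fun j => word_sum K n (fun u => v (j :: u) * \prod_(i <- u) cell_mass i))).
  congr (_%:E); apply: eq_bigr => i _; rewrite -word_sumZ; apply: eq_word_sum => u _ _.
  by rewrite big_cons mulrCA.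
move=> j; rewrite -[leLHS](mul0r (word_sum K n (fun=> 0))) -word_sumZ.
apply: le_word_sum => u _ _; rewrite mul0r mulr_ge0//.
by apply: prodr_ge0 => i _; exact: cell_mass_ge0.
Qed.

End cells.

Section absolute_continuity.
Context {R : realType} (m s : R).
Hypothesis s_gt0 : 0 < s.
Variable P : probability (pathspace R) R.
Hypothesis statP : stationary P.
Variable f : forall n : nat, n.-tuple R -> R.
Arguments f : clear implicits.
Hypothesis f_meas : forall n, measurable_fun [set: n.-tuple R] (f n).
Hypothesis f_ge0 : forall n t, 0 <= f n t.
Hypothesis f_dens : forall n (A : set (n.-tuple R)), measurable A ->
   P (block n @^-1` A) = (\int[@lebesgue_n R n]_(t in A) (f n t)%:E)%E.
Local Notation mu := (normal_prob m s).
Local Notation lambda := (@lebesgue_measure R).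

Lemma lebesgue_null_of_normal_null (A : set R) : measurable A ->
  mu A = 0%E -> lambda A = 0%E.
Proof.
move=> mA mu0.
have mf : measurable_fun A (fun x => (normal_pdf m s x)%:E).
  by apply/measurable_EFinP/measurable_funTS; exact: measurable_normal_pdf.
have : (\int[lambda]_(x in A) `|(normal_pdf m s x)%:E| = 0)%E.
  by rewrite -mu0; apply: eq_integral => x _; rewrite gee0_abs ?lee_fin ?normal_pdf_ge0.
move=> /(proj1 (ae_eq_integral_abs lambda mA mf)) [N [mN N0 sN]].
apply/eqP; rewrite -measure_le0 -N0; apply: le_measure; rewrite ?inE//.
move=> x Ax; apply: sN => /= /(_ Ax) /eqP.
by rewrite eqe gt_eqF// normal_pdf_gt0.
Qed.

(** Stationarity moves the coordinate to 1. Its law has a Lebesgue density, and mu-null sets are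
    Lebesgue null because the Gaussian density is positive. Hence almost no path enters a cell of
    mu-mass 0, where [NPD_l] would divide by 0. *)
Lemma coord_null (A : set R) (k : nat) : measurable A -> mu A = 0%E ->
  P [set w | A (w (Posz k.+1))] = 0%E.
Proof.
move=> mA mu0.
have mA1 : measurable [set w : pathspace R | A (w 1)].
  rewrite (_ : [set w | _] = (fun w : pathspace R => w 1) @^-1` A)//.
  by rewrite -[X in measurable X]setTI; exact: measurable_coord.
have -> : [set w : pathspace R | A (w (Posz k.+1))] =
    iter k (@Defs.shift _ R) @^-1` [set w | A (w 1)].
  by apply/seteqP; split => w /=; rewrite iter_shiftE -PoszD add1n.
rewrite (measure_iter_shift statP k mA1).
pose G (l : seq R) : \bar R := (\1_A (head 0 l) : R)%:E.
have mG : mseq 1 G.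
  apply/measurable_EFinP.
  rewrite (_ : (fun t => _) = (\1_A : R -> R) \o (fun t : 1.-tuple R => tnth t ord0)).
    by apply: measurableT_comp; [exact: measurable_indic|exact: measurable_tnth].
  by apply/funext => t /=; rewrite (tnth_nth 0) nth0.
have G0 l : (0 <= G l)%E by rewrite lee_fin.
transitivity (\int[P]_w G (block 1 w))%E.
  rewrite -[X in P X]setIT -integral_indic//; apply: eq_integral => w _.
  rewrite /G val_block /= !indicE.
  by have -> : (w \in [set w | A (w 1)]) = (w 1 \in A) by apply/idP/idP; rewrite !inE.
rewrite (integral_block f_meas f_ge0 f_dens mG G0) /=.
transitivity (\int[lambda]_(x in A) (seq_dens f 1 [:: x])%:E)%E.
  rewrite [RHS]integral_mkcond; apply: eq_integral => x _.
  by rewrite patchE /G /= indicE; case: ifPn => _; rewrite ?mul1e ?mul0e.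
apply: null_set_integral => //; last exact: lebesgue_null_of_normal_null.
apply: measurable_funTS.
have := mseq_seq_dens f_meas (n := 1) => /mseq_cons mf1.
rewrite (_ : (fun x => _) = (fun p : R * 0.-tuple R => (seq_dens f 1 (p.1 :: p.2))%:E) \o
   (fun x => (x, [tuple])))//.
by apply: measurableT_comp => //; exact: measurable_fun_pair.
Qed.

End absolute_continuity.

(** * Truncation away from 0 and infinity *)

Section clamp.
Context {R : realType} (a : R).
Hypothesis a01 : 0 < a <= 1.

(** Truncation to [a, 1/a]. It is 1-Lipschitz and idempotent, and on its range [ln] is bounded and
    Lipschitz with constant 1/a. *)
Definition clamp (x : R) : R := Num.max a (Num.min a^-1 x).

Let a_gt0 : 0 < a. Proof. by case/andP: a01. Qed.
Let a_le1 : a <= 1. Proof. by case/andP: a01. Qed.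
Let aV_ge1 : 1 <= a^-1. Proof. by rewrite invf_ge1. Qed.

Lemma clamp_ge x : a <= clamp x. Proof. by rewrite le_max lexx. Qed.

Lemma clamp_gt0 x : 0 < clamp x. Proof. exact: lt_le_trans a_gt0 (clamp_ge x). Qed.

Lemma clamp_le x : clamp x <= a^-1.
Proof. by rewrite ge_max ge_min lexx/= andbT (le_trans a_le1). Qed.

Lemma clamp_le_add x : 0 <= x -> clamp x <= x + a.
Proof.
move=> x0; rewrite ge_max lerDr x0/= ge_min; apply/orP; right.
by rewrite lerDl ltW.
Qed.

Lemma clamp_lipschitz x y : `|clamp x - clamp y| <= `|x - y|.
Proof.
rewrite /clamp /Num.max /Num.min.
have := aV_ge1; have := a_le1; set b := a^-1 => h1 h2.
do ![case: ifPn; rewrite -?leNgt]; rewrite ler_norml;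
  have := ler_norm (x - y); have := ler_norm (- (x - y)); rewrite normrN; lra.
Qed.

Lemma clamp_id x : a <= x <= a^-1 -> clamp x = x.
Proof. by move=> /andP[ax xa]; rewrite /clamp min_r// max_r. Qed.

Lemma clamp_idem x : clamp (clamp x) = clamp x.
Proof. by rewrite clamp_id// clamp_ge clamp_le. Qed.

(** The interval contains 1, so truncation only moves x towards 1. This is the domination used when
    the truncation is removed. *)
Lemma norm_ln_clamp x : 0 < x -> `|ln (clamp x)| <= `|ln x|.
Proof.
move=> x0; have [x1|x1] := leP 1 x.
  have c1 : 1 <= clamp x by rewrite !(le_max, le_min) x1 aV_ge1 orbT.
  have cx : clamp x <= x by rewrite ge_max (le_trans a_le1)//= ge_min lexx orbT.
  by rewrite !ger0_norm ?ln_ge0// ler_ln ?posrE// clamp_gt0.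
have c1 : clamp x <= 1 by rewrite ge_max a_le1/= ge_min (ltW x1) orbT.
have cx : x <= clamp x.
  by rewrite le_max; apply/orP; right; rewrite le_min lexx andbT (le_trans (ltW x1)).
rewrite !ler0_norm ?ln_le0// ?(ltW x1)// lerN2 ler_ln ?posrE//; exact: clamp_gt0.
Qed.

Lemma measurable_clamp : measurable_fun [set: R] clamp.
Proof. by apply: measurable_maxr => //; exact: measurable_minr. Qed.

Lemma ln_lipschitz x y : a <= x -> a <= y -> ln x - ln y <= a^-1 * `|x - y|.
Proof.
move=> ax ay; have x0 := lt_le_trans a_gt0 ax; have y0 := lt_le_trans a_gt0 ay.
rewrite -ln_div ?posrE//; apply: (@le_trans _ _ (x / y - 1)).
  have := @le_ln1Dx R (x / y - 1); rewrite addrCA subrr addr0; apply.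
  by rewrite ltrBrDl subrr divr_gt0.
have -> : x / y - 1 = y^-1 * (x - y).
  by field; rewrite gt_eqF.
apply: (@le_trans _ _ (y^-1 * `|x - y|)).
  by rewrite ler_wpM2l ?invr_ge0 ?(ltW y0)// ler_norm.
by rewrite ler_wpM2r// lef_pV2 ?posrE.
Qed.

End clamp.

Lemma clamp_eventually {R : realType} (x : R) : 0 < x ->
  \forall k \near \oo, clamp (k.+1%:R^-1) x = x.
Proof.
move=> x0; exists (truncn (Num.max x x^-1)) => // k /= kx.
have h : Num.max x x^-1 <= k.+1%:R.
  by rewrite (le_trans (ltW (truncnS_gt _)))// ler_nat ltnS.
move: h; rewrite ge_max => /andP[h1 h2].
apply: clamp_id; rewrite ?invr_gt0 ?ltr0n ?invf_le1 ?ler1n//.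
by rewrite invrK h1 andbT invf_ple ?posrE ?ltr0n.
Qed.

(** * Approximating the divergence by words of cells *)

Section divergence_approximation.
Context {R : realType} (m s : R).
Hypothesis s_gt0 : 0 < s.
Variables (K : nat -> nat) (q : nat -> R -> nat).
Hypothesis hpart : nested_partitions K q.
Variable P : probability (pathspace R) R.
Hypothesis statP : stationary P.
Variable f : forall n : nat, n.-tuple R -> R.
Arguments f : clear implicits.
Hypothesis f_meas : forall n, measurable_fun [set: n.-tuple R] (f n).
Hypothesis f_ge0 : forall n t, 0 <= f n t.
Hypothesis f_dens : forall n (A : set (n.-tuple R)), measurable A ->
   P (block n @^-1` A) = (\int[@lebesgue_n R n]_(t in A) (f n t)%:E)%E.
Local Notation mu := (normal_prob m s).
Local Notation lambda := (@lebesgue_measure R).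
Local Notation L := (log_ratio m s f).
Local Notation mass l := (cell_mass (mu : probability _ R) (q l)).
Let mq l := measurable_cell hpart l.
Let qK l := cell_lt hpart l.

Let cell_null l j : mass l j = 0 -> mu (q l @^-1` [set j]) = 0%E.
Proof.
move=> M0; have mc := measurable_cell_set (mq l) j.
by rewrite -(fineK (fin_num_measure (normal_prob m s) _ mc)); congr (_%:E).
Qed.

Lemma ae_cell_mass_gt0 l :
  {ae P, forall w, forall k : nat, 0 < mass l (q l (w (Posz k.+1)))}.
Proof.
have h j : {ae P, forall w, forall k : nat, mass l j = 0 -> q l (w (Posz k.+1)) <> j}.
  apply: ae_all => k; have [M0|M0] := eqVneq (mass l j) 0; last first.
    by apply: aeW => w /eqP; rewrite (negbTE M0).
  have mc := measurable_cell_set (mq l) j.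
  exists [set w | (q l @^-1` [set j]) (w (Posz k.+1))]; split.
  - rewrite (_ : [set w | _] = (fun w : pathspace R => w (Posz k.+1)) @^-1` (q l @^-1` [set j]))//.
    by rewrite -[X in measurable X]setTI; exact: measurable_coord.
  - apply: (coord_null s_gt0 statP f_meas f_ge0 f_dens) => //.
    exact: cell_null.
  - by move=> w /= /not_implyP[_ /contrapT].
move: (ae_all h); apply: ae_mono => w hw k; rewrite lt_neqAle cell_mass_ge0 andbT.
by apply/eqP => e; exact: (hw _ _ (esym e)).
Qed.

Lemma word_mass_gt0 l u : 0 < word_prob (q l) P u ->
  forall j, j \in u -> 0 < mass l j.
Proof.
move=> pu j ju; rewrite ltNge; apply/negP => M0'.
have M0 : mass l j = 0 by apply/eqP; rewrite eq_le M0' cell_mass_ge0.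
have mc := measurable_cell_set (mq l) j.
have P0 := coord_null s_gt0 statP f_meas f_ge0 f_dens (index j u) mc (cell_null M0).
move: pu; rewrite /word_prob.
suff -> : P (cyl (q l) u) = 0%E by rewrite ltxx.
apply/eqP; rewrite -measure_le0 -P0; apply: le_measure; rewrite ?inE.
- exact: (measurable_cyl (mq l)).
- rewrite (_ : [set w | _] = (fun w : pathspace R => w (Posz (index j u).+1)) @^-1` (q l @^-1` [set j]))//.
  by rewrite -[X in measurable X]setTI; exact: measurable_coord.
move=> w; rewrite /cyl /word /= => e.
have iu : (index j u < size u)%N by rewrite index_mem.
have uj := nth_index 0%N ju; move: iu uj; move: (index j u) => i iu uj.
rewrite -uj -[in RHS]e val_block -map_comp (nth_map 0%N) ?size_iota//.
by rewrite nth_iota.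
Qed.

(** Gibbs' inequality for words, with g(u) equal to v(u) / Z times the product of the masses of the
    letters. It sums to at most 1 because integrating v against mu^n weights each word by that
    product. *)
Lemma word_entropy_bound l n (v : seq nat -> R) (Z : R) :
  (forall u, 0 < v u) -> 0 < Z ->
  (itint mu n (fun t => (v (map (q l) t))%:E) <= Z%:E)%E ->
  word_entropy (K l) (q l) P n <=
    - (\int[P]_w ln (v (word (q l) n w)))
    - n%:R * (\int[P]_w ln (mass l (q l (w 1)))) + ln Z.
Proof.
move=> v0 Z0; have e := itint_cells (normal_prob m s) (mq l) (qK l) n (fun u => ltW (v0 u)).
rewrite [X in (X <= _)%E]e lee_fin => hZ'.
have hZ : word_sum (K l) n (fun u => v u * \prod_(j <- u) mass l j) <= Z.
  exact: hZ'.
pose g u := Z^-1 * (v u * \prod_(j <- u) mass l j).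
have prod_ge0 u : 0 <= \prod_(j <- u) mass l j.
  by apply: prodr_ge0 => j _; exact: cell_mass_ge0.
have g0 u : 0 <= g u by rewrite mulr_ge0 ?invr_ge0 ?(ltW Z0)// mulr_ge0 ?(ltW (v0 u)).
have prod_gt0 u (pu : 0 < word_prob (q l) P u) :
    0 < \prod_(j <- u) mass l j := prodr_gt0_mem (word_mass_gt0 pu).
have hg : word_sum (K l) n g <= 1.
  by rewrite word_sumZ mulrC ler_pdivrMr// mul1r.
have pg u : 0 < word_prob (q l) P u -> 0 < g u.
  by move=> pu; rewrite mulr_gt0 ?invr_gt0// mulr_gt0// prod_gt0.
apply: le_trans (@word_entropy_le _ _ _ (K l) _ (mq l) (qK l) P n g g0 pg hg) _.
have iW (F : seq nat -> R) := integrable_word (mq l) (qK l) P n F.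
have iM := integrable_letter (mq l) (qK l) P (fun j => ln (mass l j)).
rewrite (expectation_word (mq l) (qK l) P n (fun u => ln (g u))).
rewrite (@eq_word_sum _ (K l) n _ (fun u => word_prob (q l) P u *
    (ln (v u) + \sum_(j <- u) ln (mass l j) - ln Z))); last first.
  move=> u _ _; have := word_prob_ge0 (q l) P u; rewrite le_eqVlt => /predU1P[<-|pu].
    by rewrite !mul0r.
  rewrite /g lnM ?posrE ?invr_gt0 ?mulr_gt0 ?prod_gt0// lnM ?posrE ?prod_gt0//.
  by rewrite lnV ?posrE// ln_prod; [rewrite addrC|exact: word_mass_gt0].
rewrite -(expectation_word (mq l) (qK l) P n (fun u => ln (v u) + \sum_(j <- u) ln (mass l j) - ln Z)).
rewrite (RintegralB measurableT (iW (fun u => ln (v u) + \sum_(j <- u) ln (mass l j)))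
  (integrable_prob_cst P (ln Z))) (Rintegral_prob_cst P).
rewrite (RintegralD measurableT (iW (fun u => ln (v u)))
  (iW (fun u => \sum_(j <- u) ln (mass l j)))).
have -> : \int[P]_w (\sum_(j <- word (q l) n w) ln (mass l j)) =
    n%:R * \int[P]_w ln (mass l (q l (w 1))).
  transitivity (\int[P]_w (\sum_(i < n) ln (mass l (q l (iter i (@Defs.shift _ R) w 1))))).
    apply: eq_Rintegral => w _; rewrite /word big_map.
    exact: (sum_block (fun x => ln (mass l (q l x)))).
  rewrite (@Rintegral_sum _ _ _ P _ _ (fun (i : 'I_n) w =>
     ln (mass l (q l (iter i (@Defs.shift _ R) w 1))))); last first.
    by move=> i; exact: (integrable_iter_shift statP i iM).
  rewrite (eq_bigr (fun=> \int[P]_w ln (mass l (q l (w 1))))); last first.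
    by move=> i _; exact: (Rintegral_iter_shift statP i iM).
  by rewrite sumr_const card_ord -[LHS]mulr_natl.
by lra.
Qed.

Variable n : nat.
Hypothesis L_int : P.-integrable setT (EFin \o L n).

(** p_n as a function on sequences; the division by the Gaussian density is again written
    [expR (- ln _)]. *)
Let ratio (t : seq R) : R := seq_dens f n t * expR (- ln (gauss_dens m s t)).

Let ratio_ge0 t : 0 <= ratio t.
Proof. by rewrite mulr_ge0 ?expR_ge0// seq_dens_ge0. Qed.

Let mratio : mseq n (fun t => (ratio t)%:E).
Proof.
apply/measurable_EFinP; apply: measurable_funM.
  by apply/measurable_EFinP; exact: mseq_seq_dens.
apply: measurableT_comp; first exact: measurable_expR.
apply: measurable_funN; apply: measurableT_comp; first exact: measurable_ln.
exact: measurable_gauss_dens.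
Qed.

Let itint_ratio : itint mu n (fun t => (ratio t)%:E) = 1%E.
Proof.
rewrite -(@itint_normal _ _ _ s_gt0)//.
have e := @integral_block _ P f f_meas f_ge0 f_dens n (fun=> 1%E)
  (measurable_cst _) (fun=> lee01).
rewrite integral_cst// mul1e in e; rewrite -[RHS](probability_setT P); apply/esym.
apply: etrans e _; apply: eq_itint => t _.
rewrite mul1e -EFinM /ratio mulrCA expRN lnK ?posrE ?gauss_dens_gt0//.
by rewrite divff ?mulr1// gt_eqF// gauss_dens_gt0.
Qed.

Let ln_ratio w : 0 < f n (block n w) -> 0 < ratio (block n w) /\ ln (ratio (block n w)) = L n w.
Proof.
move=> fw; have r0 : 0 < ratio (block n w) by rewrite mulr_gt0 ?seq_densE ?expR_gt0.
split => //; rewrite /ratio lnM ?posrE ?seq_densE ?expR_gt0// expRK.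
by rewrite ln_gauss_dens.
Qed.

(** Dominated convergence under |log p_n|: almost surely p_n is positive, so the truncation is
    eventually inactive. *)
Lemma clamped_log_cvg :
  (fun k : nat => \int[P]_w ln (clamp k.+1%:R^-1 (ratio (block n w)))) @ \oo -->
  \int[P]_w L n w.
Proof.
have mr : measurable_fun setT (fun w : pathspace R => ratio (block n w)).
  by apply/measurable_EFinP; exact: (measurable_block_comp mratio).
have mlc (k : nat) : measurable_fun setT
    (fun w : pathspace R => ln (clamp k.+1%:R^-1 (ratio (block n w)))).
  apply: measurableT_comp; first exact: measurable_ln.
  by apply: measurableT_comp => //; exact: measurable_clamp.
have k01 (k : nat) : 0 < (k.+1%:R^-1 : R) <= 1.
  by rewrite invr_gt0 ltr0n invf_le1 ?ltr0n// ler1n.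
have [_ _ cv] : [/\ P.-integrable setT (EFin \o L n),
   [sequence \int[P]_w `|(ln (clamp k.+1%:R^-1 (ratio (block n w))))%:E - (EFin \o L n) w|]_k
      @ \oo --> 0 &
   [sequence \int[P]_w (ln (clamp k.+1%:R^-1 (ratio (block n w))))%:E]_k @ \oo -->
     \int[P]_w (EFin \o L n) w]%E.
  apply: (@dominated_convergence _ _ _ P setT measurableT _ _ (abse \o (EFin \o L n))).
  - by move=> k; apply/measurable_EFinP; exact: mlc.
  - exact: measurable_int L_int.
  - move: (ae_dens_gt0 f_meas f_ge0 f_dens n); apply: ae_mono => w fw _.
    have [r0 e] := ln_ratio fw; rewrite /= -e; apply: cvg_near_cst.
    by move: (clamp_eventually r0); apply: filterS => k ->.
  - exact: integrable_abse.
  - move: (ae_dens_gt0 f_meas f_ge0 f_dens n); apply: ae_mono => w fw k _.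
    have [r0 e] := ln_ratio fw; rewrite /= lee_fin -e.
    exact: norm_ln_clamp.
move: cv; rewrite -[X in _ --> X -> _]fineK; last exact: integrable_fin_num.
by move=> /fine_cvg.
Qed.

(** [word_entropy_bound] is applied to [c], a function of cells close to the truncation [g] of p_n.
    Four errors of at most e / 4 add up: truncating the logarithm, the excesses [a] and [d] of the
    total mass Z, and the replacement of [g] by [c] under the logarithm. *)
Lemma divergence_approximation (e : R) : 0 < e ->
  exists l, word_entropy (K l) (q l) P n +
     n%:R * (\int[P]_w ln (mass l (q l (w 1)))) <= - (\int[P]_w L n w) + e.
Proof.
move=> e0; have e4 : 0 < e / 4 by rewrite divr_gt0.
have [k0 _ hk0] : \forall k \near \oo,
    \int[P]_w L n w - e / 4 <= \int[P]_w ln (clamp k.+1%:R^-1 (ratio (block n w))).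
  have /cvgrPdist_le /(_ _ e4) := clamped_log_cvg; apply: filterS => k /=.
  by rewrite ler_distlC => /andP[].
(* Large enough both for the truncated logarithm to lose at most e / 4 in the mean and for a = 1 /
   (k + 1) to be at most e / 4. *)
pose k := (k0 + truncn (e / 4)^-1)%N.
have {}hk0 := hk0 k (leq_addr _ _).
pose a : R := k.+1%:R^-1.
have a01 : 0 < a <= 1 by rewrite invr_gt0 ltr0n invf_le1 ?ltr0n// ler1n.
have a0 : 0 < a by case/andP: a01.
have ae : a <= e / 4.
  rewrite /a invf_ple ?posrE ?ltr0n// (le_trans (ltW (truncnS_gt _)))//.
  by rewrite ler_nat ltnS leq_addl.
pose g (t : seq R) := clamp a (ratio t).
have mg : measurable_fun [set: n.-tuple R] (fun t => g t).
  apply: measurableT_comp; first exact: measurable_clamp.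
  exact/measurable_EFinP.
(* The second bound compensates the Lipschitz constant 1/a of the logarithm. *)
pose d := Num.min (e / 4) (a * (e / 4)).
have d0 : 0 < d by rewrite lt_min e4 mulr_gt0.
have [M [Mfin Mint]] := @gauss_tuple_measure _ m _ s_gt0 n.
(* The summand mu^n will control the total mass of [c], the summand P_n its expected logarithm. *)
pose nu : {measure set (n.-tuple R) -> \bar R} :=
  measure_add M (distribution P (@path_block _ R n)).
have nu_fin : (nu setT < +oo)%E.
  have -> : nu setT = (M setT + distribution P (@path_block _ R n) setT)%E.
    exact: measure_addE.
  by rewrite lte_add_pinfty// (le_lt_trans (probability_le1 _ _))// ltry.
have ig : nu.-integrable setT (EFin \o (fun t : n.-tuple R => g t)).
  apply: measurable_bounded_integrable => //.
  exists a^-1; split; first exact: num_real.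
  move=> x ax t _ /=; apply: le_trans (ltW ax).
  by rewrite ger0_norm ?clamp_le// ltW// clamp_gt0.
have [l [v hv]] := cell_approx_integrable hpart nu_fin ig d0.
(* Truncating the approximant makes it at least [a]; since [g] is a fixed point of the truncation,
   the error does not grow. *)
pose c u := clamp a (v u).
have mc : measurable_fun [set: n.-tuple R] (fun t => c (map (q l) t)).
  exact: measurable_cell_fun (mq l) (qK l).
pose h (t : seq R) := `|g t - c (map (q l) t)|.
have h_ge0 t : 0 <= h t by exact: normr_ge0.
have mh : mseq n (fun t => (h t)%:E).
  apply/measurable_EFinP; apply: measurableT_comp => //; exact: measurable_funB.
have hd : (\int[M]_t (h t)%:E + \int[P]_w (h (block n w))%:E <= d%:E)%E.
  have h0 t : (0 <= (h t)%:E)%E by rewrite lee_fin h_ge0.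
  have e1 := @ge0_integral_distribution _ _ _ _ _ P (@path_block _ R n)
     (fun t => (h t)%:E) mh h0.
  have e2 := ge0_integral_measure_add M (distribution P (@path_block _ R n))
    measurableT (fun t _ => h0 t) mh.
  rewrite -[X in (_ + X <= _)%E]e1 -e2; apply: le_trans (ltW hv).
  apply: ge0_le_integral => //.
    apply/measurable_EFinP; apply: measurableT_comp => //; apply: measurable_funB => //.
    exact: measurable_cell_fun (mq l) (qK l).
  move=> t _; rewrite lee_fin /h /g /c -[X in X - _](clamp_idem a01).
  exact: clamp_lipschitz.
exists l.
(* p_n integrates to 1, truncation from below adds at most a, and the approximation at most d. *)
pose Z := 1 + a + d.
have Z0 : 0 < Z by rewrite /Z !addr_gt0.
have hc u : 0 < c u by exact: clamp_gt0.
have hZ : (itint mu n (fun t => (c (map (q l) t))%:E) <= Z%:E)%E.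
  have M0 : (0 <= \int[P]_w (h (block n w))%:E)%E.
    by apply: integral_ge0 => w _; rewrite lee_fin h_ge0.
  have hM : (\int[M]_t (h t)%:E <= d%:E)%E by apply: le_trans hd; rewrite leeDl.
  have h0 t : (0 <= (h t)%:E)%E by rewrite lee_fin h_ge0.
  rewrite (Mint (fun t => (h t)%:E) mh h0) in hM.
  apply: (@le_trans _ _ (itint mu n (fun t => (ratio t)%:E + (a%:E + (h t)%:E)))%E).
    apply: le_itint.
    - exact/measurable_EFinP.
    - apply: emeasurable_funD; first exact: mratio.
      by apply: emeasurable_funD; [exact: measurable_cst|exact: mh].
    - by move=> t; rewrite lee_fin ltW.
    - by move=> t; rewrite -!EFinD lee_fin !addr_ge0 ?(ltW a0) ?ratio_ge0 ?h_ge0.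
    - move=> t _; rewrite -!EFinD lee_fin addrA.
      have := clamp_le_add a01 (ratio_ge0 t); rewrite -/(g t).
      have := ler_norm (- (g t - c (map (q l) t))); rewrite normrN -/(h t).
      by lra.
  rewrite itintD; last 4 first.
  - exact: mratio.
  - by apply: emeasurable_funD; [exact: measurable_cst|exact: mh].
  - by move=> t; rewrite lee_fin.
  - by move=> t; rewrite -EFinD lee_fin addr_ge0 ?(ltW a0) ?h_ge0.
  rewrite itintD; last 4 first.
  - exact: measurable_cst.
  - exact: mh.
  - by move=> t; rewrite lee_fin ltW.
  - by move=> t; rewrite lee_fin /h.
  rewrite itint_ratio /Z -addrA !EFinD leeD2l//; apply: leeD => //.
  have -> : itint mu n (fun=> a%:E) = itint mu n (fun=> (a%:E * 1)%E).
    by apply: eq_itint => t _; rewrite mule1.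
  by rewrite itintZl ?itint_prob1 ?mule1 ?lee_fin ?(ltW a0)//; exact: measurable_cst.
apply: le_trans (lerD (word_entropy_bound hc Z0 hZ) (lexx _)) _.
have hP : \int[P]_w h (block n w) <= d.
  have hP' : (\int[P]_w (h (block n w))%:E <= d%:E)%E.
    apply: le_trans hd; rewrite leeDr//.
    by apply: integral_ge0 => t _; rewrite lee_fin h_ge0.
  rewrite -lee_fin fineK// ge0_fin_numE; first by rewrite (le_lt_trans hP')// ltry.
  by apply: integral_ge0 => w _; rewrite lee_fin h_ge0.
have ih : P.-integrable setT (EFin \o (fun w => h (block n w))).
  apply/integrableP; split; first exact: (measurable_block_comp mh).
  under eq_integral do rewrite /= normr_id.
  apply: (@le_lt_trans _ _ d%:E); last exact: ltry.
  apply: le_trans hd; rewrite leeDr//.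
  by apply: integral_ge0 => t _; rewrite lee_fin h_ge0.
have ilc : P.-integrable setT (EFin \o (fun w => ln (c (word (q l) n w)))).
  exact: (integrable_word (mq l) (qK l) P n (fun u => ln (c u))).
have ilg : P.-integrable setT (EFin \o (fun w => ln (g (block n w)))).
  apply: measurable_bounded_integrable => //.
  - by rewrite (le_lt_trans (probability_le1 _ _))// ltry.
  - apply: measurableT_comp; first exact: measurable_ln.
    exact: (measurable_block_comp mg).
  exists (ln a^-1); split; first exact: num_real.
  move=> x ax w _ /=; apply: le_trans (ltW ax).
  have gw0 : 0 < g (block n w) by exact: clamp_gt0.
  have h1 : ln a <= ln (g (block n w)) by rewrite ler_ln ?posrE//; exact: clamp_ge.
  have h2 : ln (g (block n w)) <= ln a^-1.
    by rewrite ler_ln ?posrE ?invr_gt0//; exact: clamp_le.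
  have h3 : ln a^-1 = - ln a by rewrite lnV ?posrE.
  by rewrite ler_norml h2 andbT h3 opprK.
have key : \int[P]_w ln (g (block n w)) - \int[P]_w ln (c (word (q l) n w)) <= a^-1 * d.
  rewrite -RintegralB//.
  apply: (@le_trans _ _ (\int[P]_w (a^-1 * h (block n w)))).
    apply: le_Rintegral => //.
    - rewrite (_ : _ \o _ = (EFin \o (fun w => ln (g (block n w)))) \-
        (EFin \o (fun w => ln (c (word (q l) n w)))))%E; first exact: integrableB.
      by apply/funext.
    - rewrite (_ : _ \o _ = (fun w => (a^-1)%:E * (h (block n w))%:E))%E.
        exact: (integrableZl measurableT a^-1 ih).
      by apply/funext.
    - move=> w _; apply: (ln_lipschitz a01); exact: clamp_ge.
  by rewrite RintegralZl// ler_wpM2l// invr_ge0 ltW.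
have lnZ : ln Z <= a + d.
  have := @le_ln1Dx R (a + d); rewrite /Z addrA; apply.
  by rewrite (lt_trans (ltrN10 _))// addr_gt0.
have d1 : d <= e / 4 by rewrite ge_min lexx.
have d2 : a^-1 * d <= e / 4.
  by rewrite mulrC ler_pdivrMr// mulrC /d ge_min lexx orbT.
move: hk0 key; rewrite -/a -/g; set X1 := \int[P]_w _; set X2 := \int[P]_w _.
by lra.
Qed.

End divergence_approximation.

Section universal_words.
Context {R : realType} (K : nat) (Q : probability (pathspace nat) R).

Lemma cyl_id n (t : n.-tuple nat) : cyl id t = word_cyl t.
Proof.
apply/seteqP; split => w; rewrite /cyl /word_cyl /mkset /word map_id size_tuple.
  by move=> e; exact: val_inj.
by move=> ->.
Qed.

Lemma word_prob_id n (t : n.-tuple nat) :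
  word_prob id Q t = fine (Q (word_cyl t)).
Proof. by rewrite /word_prob cyl_id. Qed.

(** [q'] folds the symbols outside the alphabet into 0, which gives a code into K letters; its word
    probabilities sum to 1 and dominate those of [Q]. *)
Lemma word_sum_prob_le1 n : (0 < K)%N -> word_sum K n (word_prob id Q) <= 1.
Proof.
move=> K0; pose q' (x : nat) := if (x < K)%N then x else 0%N.
have q'K x : (q' x < K)%N by rewrite /q'; case: ifP.
have mq' : measurable_fun [set: nat] q' by [].
rewrite -(word_sum_prob mq' q'K Q n); apply: le_word_sum => u _ uK.
have mid : measurable_fun [set: nat] (@id nat) by [].
apply: fine_le; [exact: fin_num_measure (measurable_cyl mid _)|
  exact: fin_num_measure (measurable_cyl mq' _)|].
apply: le_measure; rewrite ?inE; [exact: measurable_cyl|exact: measurable_cyl|].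
move=> w; rewrite /cyl /word /= map_id => e; rewrite e.
rewrite -[RHS]map_id; apply/eq_in_map => x xu; rewrite /q'.
by rewrite (allP uK).
Qed.

End universal_words.

(** * The NPD density *)

Section npd_subdensity.
Context {R : realType} (m s : R).
Variables (K : nat -> nat) (q : nat -> R -> nat).
Hypothesis hpart : nested_partitions K q.
Variable Q : nat -> probability (pathspace nat) R.
Local Notation mu := (normal_prob m s).
Local Notation mass l := (cell_mass (mu : probability _ R) (q l)).
Let mq l := measurable_cell hpart l.
Let qK l := cell_lt hpart l.

Definition cell_density l (u : seq nat) : R :=
  word_prob id (Q l) u / \prod_(j <- u) mass l j.

Definition npd_seq (x : seq R) : \bar R :=
  (\sum_(0 <= l <oo) (npd_weight l * cell_density l (map (q l) x))%:E)%E.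

Lemma cell_density_ge0 l u : 0 <= cell_density l u.
Proof.
by rewrite divr_ge0 ?word_prob_ge0// prodr_ge0// => j _; exact: cell_mass_ge0.
Qed.

Lemma NPD_lE l n (t : n.-tuple R) : NPD_l m s q Q l t = cell_density l (map (q l) t).
Proof.
rewrite /NPD_l /cell_density -(word_prob_id (Q l) (map_tuple (q l) t)).
by rewrite [in RHS]big_map big_tuple.
Qed.

Lemma NPDE n (t : n.-tuple R) : NPD m s q Q t = npd_seq t.
Proof. by apply: eq_eseriesr => l _; rewrite NPD_lE. Qed.

Let npd_term_ge0 l x : (0 <= (npd_weight l * cell_density l (map (q l) x))%:E :> \bar R)%E.
Proof. by rewrite lee_fin mulr_ge0 ?cell_density_ge0// ltW// npd_weight_gt0. Qed.

Lemma npd_seq_ge0 x : (0 <= npd_seq x)%E.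
Proof. by apply: nneseries_ge0 => l _ _; exact: npd_term_ge0. Qed.

Lemma npd_seq_ge l x : ((npd_weight l * cell_density l (map (q l) x))%:E <= npd_seq x)%E.
Proof.
apply: le_trans (nneseries_lim_ge l.+1 _) => [|k _ _]; last exact: npd_term_ge0.
by rewrite big_nat_recr//= leeDr// sume_ge0.
Qed.

Let mseq_npd_term n l :
  mseq n (fun x => (npd_weight l * cell_density l (map (q l) x))%:E).
Proof.
apply/measurable_EFinP.
exact: (measurable_cell_fun (fun u => npd_weight l * cell_density l u) (mq l) (qK l)).
Qed.

Lemma mseq_npd n : mseq n npd_seq.
Proof.
apply: ge0_emeasurable_sum => [l t _ _|l _]; first exact: npd_term_ge0.
exact: mseq_npd_term.
Qed.

(** At each level, integration multiplies [cell_density] by the product of the masses again, leaving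
    at most the total probability of the words; the weights [npd_weight l] telescope to at most
    1. *)
Lemma itint_npd n : (itint mu n npd_seq <= 1)%E.
Proof.
rewrite /npd_seq itint_nneseries//.
apply: lime_le; first by apply: is_cvg_nneseries => l _ _; exact: itint_ge0.
apply: nearW => N; apply: (@le_trans _ _ (\sum_(0 <= l < N) (npd_weight l)%:E)%E).
  apply: lee_sum => l _.
  have e := itint_cells (mu : probability _ R) (mq l) (qK l) n
    (v := fun u => npd_weight l * cell_density l u)
    (fun u => mulr_ge0 (ltW (npd_weight_gt0 l)) (cell_density_ge0 l u)).
  apply: (@le_trans _ _ (word_sum (K l) n (fun u =>
      npd_weight l * cell_density l u * \prod_(j <- u) mass l j))%:E).
    by rewrite le_eqVlt; apply/orP; left; apply/eqP; exact: e.
  rewrite lee_fin.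
  apply: (@le_trans _ _ (npd_weight l * word_sum (K l) n (word_prob id (Q l)))).
    rewrite -word_sumZ; apply: le_word_sum => u _ _.
    rewrite -mulrA ler_wpM2l// ?(ltW (npd_weight_gt0 _))// /cell_density.
    (* A word of mass 0 contributes nothing, whatever its probability under [Q l]. *)
    have [->|M0] := eqVneq (\prod_(j <- u) mass l j) 0.
      by rewrite mulr0 word_prob_ge0.
    by rewrite divfK.
  apply: ler_piMr; first exact/ltW/npd_weight_gt0.
  by apply: word_sum_prob_le1; apply: leq_ltn_trans (qK l 0).
  by rewrite sumEFin lee_fin; exact: sum_npd_weight_le1.
by move=> k; exact: mseq_npd_term.
Qed.

End npd_subdensity.

(** The integral is that of the positive part minus that of the negative part, and such a difference
    is finite only if both are. Finite entropies thus make the log-densities integrable. *)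
Lemma integrable_of_integral_fin_num d (X : measurableType d) (R : realType)
    (mu : {measure set X -> \bar R}) (F : X -> \bar R) :
  measurable_fun setT F -> (\int[mu]_x F x)%E \is a fin_num ->
  mu.-integrable setT F.
Proof.
move=> mF; rewrite integralE fin_numB => /andP[fp fn].
apply/integrableP; split=> //.
rewrite (eq_integral (fun x => F^\+%E x + F^\-%E x)%E); last first.
  by move=> x _; rewrite -[RHS]/((F^\+ \+ F^\-)%E x) -fune_abse.
rewrite ge0_integralD//; [|exact: measurable_funepos|exact: measurable_funeneg].
by rewrite lte_add_pinfty// ltey_eq ?fp ?fn.
Qed.

(** * Log-densities and the Gaussian energy *)

Section log_density.
Context {R : realType} (m s : R).
Hypothesis s_gt0 : 0 < s.
Variable P : probability (pathspace R) R.
Hypothesis statP : stationary P.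
Variable f : forall n : nat, n.-tuple R -> R.
Arguments f : clear implicits.
Hypothesis f_meas : forall n, measurable_fun [set: n.-tuple R] (f n).
Hypothesis f_ge0 : forall n t, 0 <= f n t.
Hypothesis f_dens : forall n (A : set (n.-tuple R)), measurable A ->
   P (block n @^-1` A) = (\int[@lebesgue_n R n]_(t in A) (f n t)%:E)%E.
Local Notation L := (log_ratio m s f).
Local Notation S := (@Defs.shift _ R).

Definition gauss_energy (x : R) : R := (x - m) ^+ 2 / (2 * s ^+ 2).

Definition gauss_const : R := ln (s * Num.sqrt (2 * pi)).

Lemma ln_normal_pdf x : ln (normal_pdf m s x) = - gauss_energy x - gauss_const.
Proof.
rewrite normal_pdfE ?gt_eqF// lnM ?posrE ?expR_gt0 ?normal_peak_gt0 ?gt_eqF//.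
rewrite addrC /normal_fun expRK; congr (_ + _).
  by rewrite /gauss_energy mulNr mulr_natl.
rewrite /normal_peak /gauss_const lnV ?posrE; last first.
  by rewrite sqrtr_gt0 mulrn_wgt0// mulr_gt0 ?exprn_gt0 ?pi_gt0.
congr (- ln _); rewrite -mulr_natl (mulrC (s ^+ 2)) mulrA sqrtrM ?sqrtr_sqr.
  by rewrite gtr0_norm// mulrC.
by rewrite mulr_ge0// pi_ge0.
Qed.

Hypothesis mean_fin : P.-integrable setT (fun w : pathspace R => (w 1)%:E).
Hypothesis var_fin : P.-integrable setT (fun w : pathspace R => (w 1 ^+ 2)%:E).

Lemma integrable_energy :
  P.-integrable setT (EFin \o (fun w : pathspace R => gauss_energy (w 1))).
Proof.
pose c := (2 * s ^+ 2)^-1.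
rewrite (_ : _ \o _ = (fun w : pathspace R => c%:E * (w 1 ^+ 2)%:E) \+
   ((fun w => (- (2 * m * c))%R%:E * (w 1)%:E) \+ (EFin \o (fun=> (m ^+ 2 * c)%R))))%E.
  apply: integrableD => //; first exact: integrableZl.
  by apply: integrableD => //; [exact: integrableZl|exact: integrable_prob_cst].
apply/funext => w /=; rewrite -!EFinM -!EFinD /gauss_energy -/c; congr (_%:E).
by ring.
Qed.

Lemma sum_ln_normal_pdf n (w : pathspace R) :
  \sum_(x <- block n w) ln (normal_pdf m s x) =
  - (\sum_(i < n) gauss_energy (iter i S w 1)) - n%:R * gauss_const.
Proof.
rewrite -sum_block.
under eq_bigr do rewrite ln_normal_pdf.
rewrite sumrB sumrN; congr (_ - _).
by rewrite big_const_seq count_predT size_tuple iter_addr addr0 mulr_natl.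
Qed.

(** [lne] takes the value -oo where the density vanishes, unlike the real-valued [ln]; the density
    is almost surely positive, so the integrals agree. *)
Lemma integrable_ln_dens n :
  (\int[P]_w (- lne (f n (block n w))%:E))%E \is a fin_num ->
  P.-integrable setT (EFin \o (fun w => ln (f n (block n w)))) /\
  (\int[P]_w (- lne (f n (block n w))%:E) =
   (- (\int[P]_w ln (f n (block n w))))%:E)%E.
Proof.
move=> fin.
have mf := measurable_block_comp (f_meas (n := n)).
have mlf : measurable_fun setT (fun w : pathspace R => ln (f n (block n w))).
  by apply: measurableT_comp; first exact: measurable_ln.
have mF : measurable_fun setT (fun w : pathspace R => (- lne (f n (block n w))%:E)%E).
  rewrite (_ : (fun w => _) = fun w : pathspace R =>
    if f n (block n w) <= 0 then +oo%E else (- ln (f n (block n w)))%:E).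
    apply: measurable_fun_ifT => //; first exact: measurable_fun_ler.
    by apply/measurable_EFinP; exact: measurable_funN.
  by apply/funext => w /=; case: ifP.
have iF := integrable_of_integral_fin_num mF fin.
have mG : measurable_fun setT (fun w : pathspace R => (- ln (f n (block n w)))%:E).
  by apply/measurable_EFinP; exact: measurable_funN.
have FG : ae_eq P setT (fun w : pathspace R => (- lne (f n (block n w))%:E)%E)
    (fun w => (- ln (f n (block n w)))%:E).
  move: (ae_dens_gt0 f_meas f_ge0 f_dens n); apply: ae_mono => w f0 _.
  by rewrite lne_EFin.
have iG : P.-integrable setT (fun w : pathspace R => (- ln (f n (block n w)))%:E).
  apply/integrableP; split => //; have /integrableP[_] := iF.
  congr (_ < _)%E; apply: ae_eq_integral => //; [exact: measurableT_comp..|].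
  by apply: ae_mono FG => w h _; rewrite h.
have il : P.-integrable setT (EFin \o (fun w => ln (f n (block n w)))).
  have := integrableZl measurableT (-1) iG; congr (_.-integrable _ _).
  by apply/funext => w /=; rewrite -EFinM mulN1r opprK.
split => //.
rewrite (ae_eq_integral _ _ measurableT mF mG FG).
transitivity (\int[P]_w ((-1)%:E * (ln (f n (block n w)))%:E))%E.
  by apply: eq_integral => w _; rewrite -EFinM mulN1r.
rewrite (integralZl measurableT il) -[in LHS](fineK (integrable_fin_num measurableT il)).
by rewrite -EFinM mulN1r.
Qed.

Lemma integrable_log_ratio n :
  (\int[P]_w (- lne (f n (block n w))%:E))%E \is a fin_num ->
  P.-integrable setT (EFin \o L n) /\
  \int[P]_w L n w = - fine (\int[P]_w (- lne (f n (block n w))%:E))%E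
     + n%:R * ((\int[P]_w gauss_energy (w 1)) + gauss_const).
Proof.
move=> /integrable_ln_dens[il ->] /=.
have ie i := integrable_iter_shift statP i integrable_energy.
have ies : P.-integrable setT
   (EFin \o (fun w => \sum_(i < n) gauss_energy (iter i S w 1))).
  rewrite (_ : _ \o _ = fun w => (\sum_(i < n) (gauss_energy (iter i S w 1))%:E)%E).
    by apply: integrable_sum => // i _; exact: ie.
  by apply/funext => w /=; rewrite sumEFin.
have ic := integrable_prob_cst P (n%:R * gauss_const).
have LE w : L n w = ln (f n (block n w)) +
    (\sum_(i < n) gauss_energy (iter i S w 1) + n%:R * gauss_const).
  by rewrite /log_ratio sum_ln_normal_pdf opprB addrC opprK [RHS]addrC (addrC (_ * _)).
have iec : P.-integrable setT (EFin \o (fun w =>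
    \sum_(i < n) gauss_energy (iter i S w 1) + n%:R * gauss_const)).
  have := integrableD measurableT ies ic; congr (_.-integrable _ _).
split.
  have := integrableD measurableT il iec; congr (_.-integrable _ _).
  by apply/funext => w /=; rewrite LE.
transitivity (\int[P]_w (ln (f n (block n w)) +
    (\sum_(i < n) gauss_energy (iter i S w 1) + n%:R * gauss_const))).
  by apply: eq_Rintegral => w _; rewrite LE.
rewrite (RintegralD measurableT il iec) (RintegralD measurableT ies ic) opprK.
congr (_ + _); rewrite (Rintegral_prob_cst P) mulrDr; congr (_ + _).
transitivity (\sum_(i < n) \int[P]_w gauss_energy (iter i S w 1)).
  exact: (@Rintegral_sum _ _ _ P _ _
    (fun (i : 'I_n) w => gauss_energy (iter i S w 1)) (fun i => ie i)).
under eq_bigr => i _ do rewrite (Rintegral_iter_shift statP i integrable_energy).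
by rewrite sumr_const card_ord mulr_natl.
Qed.

End log_density.

(** * Lower bound for the NPD density along the path *)

Section npd_rate.
Context {R : realType} (m s : R).
Hypothesis s_gt0 : 0 < s.
Variables (K : nat -> nat) (q : nat -> R -> nat).
Hypothesis hpart : nested_partitions K q.
Variable Q : nat -> probability (pathspace nat) R.
Hypothesis hQ : forall l, universal (K l) (Q l).
Variable P : probability (pathspace R) R.
Hypothesis ergP : stationary_ergodic P.
Variable f : forall n : nat, n.-tuple R -> R.
Arguments f : clear implicits.
Hypothesis f_meas : forall n, measurable_fun [set: n.-tuple R] (f n).
Hypothesis f_ge0 : forall n t, 0 <= f n t.
Hypothesis f_dens : forall n (A : set (n.-tuple R)), measurable A ->
   P (block n @^-1` A) = (\int[@lebesgue_n R n]_(t in A) (f n t)%:E)%E.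
Local Notation mu := (normal_prob m s).
Local Notation L := (log_ratio m s f).
Local Notation mass l := (cell_mass (mu : probability _ R) (q l)).
Local Notation npd := (npd_seq m s q Q).
Local Notation S := (@Defs.shift _ R).
Let mq l := measurable_cell hpart l.
Let qK l := cell_lt hpart l.

Variable D : R.
Hypothesis L_int : \forall n \near \oo, P.-integrable setT (EFin \o L n).
Hypothesis L_cvg : (fun n => n%:R^-1 * \int[P]_w L n w) @ \oo --> D.

(** One block length N + 1 at which the mean of log p_(N+1) per letter is within e / 2 of D is
    enough; the error allowed to the cells there is (N + 1) e / 2. *)
Lemma exists_entropy_level (e : R) : 0 < e -> exists l N,
  N.+1%:R^-1 * word_entropy (K l) (q l) P N.+1 + \int[P]_w ln (mass l (q l (w 1)))
    <= - D + e.
Proof.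
move=> e0; have e2 : 0 < e / 2 by rewrite divr_gt0.
have /cvgrPdist_le /(_ _ e2) LD := L_cvg.
have [N _ hN] := filterI L_int LD.
have [iN] := hN N.+1 (leqnSn N); rewrite /= ler_distlC => /andP[LN _].
have N0 : 0 < N.+1%:R :> R by rewrite ltr0n.
have [l hl] := divergence_approximation s_gt0 hpart ergP.1 f_meas f_ge0 f_dens
  iN (mulr_gt0 N0 e2).
exists l, N; move: hl LN; set M := Rintegral _ _ _; set I := Rintegral _ _ _.
set W := word_entropy _ _ _ _ => hl LN.
have {}hl : N.+1%:R^-1 * (W + N.+1%:R * M) <= N.+1%:R^-1 * (- I + N.+1%:R * (e / 2)).
  by rewrite ler_wpM2l// invr_ge0 ltW.
move: hl; rewrite !mulrDr !mulrA mulVf ?gt_eqF// !mul1r (mulrN _ I) => hl.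
clearbody M I W; move: LN hl; set c := N.+1%:R^-1; clearbody c => LN hl; lra.
Qed.

(** Only one level of the mixture is kept. The tolerance splits into four parts e / 4: the choice of
    the level, its weight, universality, and Birkhoff's theorem for the log masses of the cells. *)
Lemma ae_npd_lower_bound (e : R) : 0 < e -> {ae P, forall w, \forall n \near \oo,
  (- lne (npd (block n.+1 w)) <= (n.+1%:R * (- D + e))%:E)%E}.
Proof.
move=> e0; have e4 : 0 < e / 4 by rewrite divr_gt0.
have [l [N hl]] := exists_entropy_level e4.
have [PY PYE] := code_process_exists (mq l) P.
have [H [leH cvH]] := universal_rate (mq l) (qK l) ergP PYE (hQ l).
move: hl; set M := Rintegral _ _ _ => hl.
have {leH} HM : H + M <= - D + e / 4 by rewrite (le_trans _ hl)// lerD2r.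
have iF := integrable_letter (mq l) (qK l) P (fun j => ln (mass l j)).
have bF := birkhoff ergP iF.
have mass0 := ae_cell_mass_gt0 m s_gt0 hpart ergP.1 f_meas f_ge0 f_dens l.
have h := ae_mono2 (fun w a b => conj a b) cvH (ae_mono2 (fun w a b => conj a b) bF mass0).
move: h; apply: ae_mono => w [{}cvH [{}bF {}mass0]].
pose w0 : R := npd_weight l; have w00 : 0 < w0 := npd_weight_gt0 l.
have [k0 _ hk0] : \forall n \near \oo, - ln w0 <= n.+1%:R * (e / 4).
  exists (truncn (`|ln w0| / (e / 4))) => // n /= hn.
  rewrite -ler_pdivrMr//; apply: le_trans (_ : `|ln w0| / (e / 4) <= _).
    by rewrite ler_wpM2r ?invr_ge0 ?(ltW e4)// -normrN ler_norm.
  by rewrite (le_trans (ltW (truncnS_gt _)))// ler_nat ltnS.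
have /cvgrPdist_le /(_ _ e4) bF' := bF.
have cvH' : \forall n \near \oo, (- ((n.+1%:R^-1)%:E *
      lne (Q l (word_cyl (map_tuple (q l) (block n.+1 w))))) < (H + e / 4)%:E)%E.
  apply: (cvH [set y | (y < (H + e / 4)%:E)%E]); apply: (nbhs_open_ereal_lt (f := fun x => x + e / 4)).
  by rewrite ltrDl.
have [k1 _ hk1] := filterI bF' cvH'.
exists (maxn k0 k1) => // n /=; rewrite geq_max => /andP[nk0 nk1].
have {hk0}hk0 := hk0 n nk0.
have {hk1}[/= hb] := hk1 n nk1; move: hb; rewrite ler_distlC => /andP[_ hb].
pose t := map_tuple (q l) (block n.+1 w).
pose p := word_prob id (Q l) t.
have n0 : 0 < n.+1%:R :> R by rewrite ltr0n.
have Qfin : Q l (word_cyl t) = p%:E.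
  rewrite /p word_prob_id fineK// ge0_fin_numE//.
  apply: le_lt_trans (_ : (1 < +oo)%E); last by rewrite ltry.
  apply: probability_le1.
  have mid : measurable_fun [set: nat] (@id nat) by [].
  by rewrite -cyl_id; exact: measurable_cyl.
(* A word of [Q l]-probability 0 would have logarithm -oo, against the bound H + e / 4 on the
   rate. *)
rewrite -/t Qfin; have [p0|p0] := leP p 0.
  by rewrite /= p0 mulrNy gtr0_sg ?invr_gt0// mul1e.
rewrite lne_EFin// -EFinM -EFinN lte_fin => hH.
pose r := w0 * cell_density m s q Q l t.
have t_gt0 : {in (t : seq nat), forall j, 0 < mass l j}.
  by rewrite /= val_block => _ /mapP[_ /mapP[i _ ->] ->].
have M0 := prodr_gt0_mem t_gt0.
have r0 : 0 < r by rewrite mulr_gt0// divr_gt0.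
have rnpd := npd_seq_ge m s q Q l (block n.+1 w).
apply: le_trans (_ : - lne r%:E <= _)%E.
  by rewrite leeN2 lee_lne// in_itv/= ?lee_fin ?(ltW r0)// leey ?andbT ?npd_seq_ge0.
rewrite lne_EFin// -EFinN lee_fin.
have lnP : ln (\prod_(j <- t) mass l j) =
    \sum_(i < n.+1) ln (mass l (q l (iter i S w 1))).
  rewrite ln_prod// big_map; exact: (sum_block (fun x => ln (mass l (q l x)))).
rewrite /r lnM ?posrE ?divr_gt0// /cell_density ln_div ?posrE// lnP -/p.
move: hH hb; set B := \sum_(i < n.+1) _; set c := n.+1%:R => hH hb.
have {}hH : - ln p <= c * (H + e / 4).
  by rewrite -ler_pdivrMl// mulrN ltW.
have {}hb : B <= c * (M + e / 4) by rewrite -ler_pdivrMl.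
have HMc : c * (H + M) <= c * (- D + e / 4) by rewrite ler_wpM2l// ltW.
lra.
Qed.

End npd_rate.

(** * The rate D *)

Section log_ratio_rate.
Context {R : realType} (m s : R).
Hypothesis s_gt0 : 0 < s.
Variable P : probability (pathspace R) R.
Hypothesis statP : stationary P.
Variable f : forall n : nat, n.-tuple R -> R.
Arguments f : clear implicits.
Hypothesis f_meas : forall n, measurable_fun [set: n.-tuple R] (f n).
Hypothesis f_ge0 : forall n t, 0 <= f n t.
Hypothesis f_dens : forall n (A : set (n.-tuple R)), measurable A ->
   P (block n @^-1` A) = (\int[@lebesgue_n R n]_(t in A) (f n t)%:E)%E.
Hypothesis mean_fin : P.-integrable setT (fun w : pathspace R => (w 1)%:E).
Hypothesis var_fin : P.-integrable setT (fun w : pathspace R => (w 1 ^+ 2)%:E).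
Variable h : R.
Hypothesis h_rate : (fun n : nat => ((n.+1%:R^-1)%:E *
  \int[P]_w (- lne (f n.+1 (block n.+1 w))%:E))%E) @ \oo --> h%:E.
Local Notation L := (log_ratio m s f).
Local Notation D := (- h + ((\int[P]_w gauss_energy m s (w 1)) + gauss_const s)).

(** The limit h is real, so the expectations are finite from some n on; finiteness at smaller n is
    not implied, hence integrability near infinity only. *)
Lemma log_ratio_near : \forall n \near \oo,
  P.-integrable setT (EFin \o L n.+1) /\
  n.+1%:R^-1 * \int[P]_w L n.+1 w = - fine ((n.+1%:R^-1)%:E *
      \int[P]_w (- lne (f n.+1 (block n.+1 w))%:E))%E
   + ((\int[P]_w gauss_energy m s (w 1)) + gauss_const s).
Proof.
have /fine_cvgP[fin _] := h_rate; apply: filterS fin => n.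
set I := (\int[P]_w _)%E => fin; have n0 : n.+1%:R != 0 :> R by rewrite pnatr_eq0.
have I_fin : I \is a fin_num.
  rewrite -(mul1e I) -(divff n0) EFinM -muleA.
  exact: fin_numM.
have [il ->] := integrable_log_ratio m s_gt0 statP f_meas f_ge0 f_dens mean_fin
  var_fin I_fin.
by split => //; rewrite -/I mulrDr mulKf// mulrN fineM.
Qed.

Lemma log_ratio_cvg : (fun n => n%:R^-1 * \int[P]_w L n w) @ \oo --> D.
Proof.
rewrite -cvg_shiftS; have /fine_cvgP[_ cv] := h_rate.
apply: cvg_trans (_ : (fun n : nat => - fine ((n.+1%:R^-1)%:E *
      \int[P]_w (- lne (f n.+1 (block n.+1 w))%:E))%E
   + ((\int[P]_w gauss_energy m s (w 1)) + gauss_const s)) @ \oo --> _).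
  apply: near_eq_cvg; apply: filterS log_ratio_near => n [_ /= ->//].
by apply: cvgD; [exact: cvgN|exact: cvg_cst].
Qed.

Lemma log_ratio_integrable : \forall n \near \oo, P.-integrable setT (EFin \o L n).
Proof. by apply: near_inftyS; apply: filterS log_ratio_near => n []. Qed.

End log_ratio_rate.

(** * From one-sided bounds to the limit *)

Lemma cvg_of_le {R : realType} (y : nat -> R) (a : R) :
  (forall k : nat, \forall n \near \oo, a - k.+1%:R^-1 <= y n <= a + k.+1%:R^-1) ->
  y @ \oo --> a.
Proof.
move=> h; apply/cvgrPdist_le => e e0.
have [k _ /(_ k (leqnn k)) /= hk] := near_infty_natSinv_lt (PosNum e0).
apply: filterS (h k) => n /andP[h1 h2]; rewrite ler_distlC.
by apply/andP; split; [apply: le_trans h1; rewrite lerB// ltW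
  |apply: le_trans h2 _; rewrite lerD// ltW].
Qed.

(** The pathwise conclusion. Tolerances 1 / (k + 1) stand for arbitrary e > 0, so that both bounds
    hold for all k off a single null set; being real, they also force [lne] to be finite. *)
Lemma lne_npd_rate {R : realType} (b : nat -> \bar R) (D : R) :
  (forall n, (0 <= b n)%E) ->
  (forall k, \forall n \near \oo,
     (- lne (b n.+1) <= (n.+1%:R * (- D + k.+1%:R^-1))%:E)%E) ->
  (forall k, \forall n \near \oo, (b n < (expR (n%:R * (D + k.+1%:R^-1)))%:E)%E) ->
  (\forall n \near \oo, lne (b n.+1) \is a fin_num) /\
  (fun n => n.+1%:R^-1 * fine (- lne (b n.+1))%E) @ \oo --> - D.
Proof.
move=> b0 lower upper.
have bounds k : \forall n \near \oo,
    ((n.+1%:R * (- D - k.+1%:R^-1))%:E <= - lne (b n.+1)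
       <= (n.+1%:R * (- D + k.+1%:R^-1))%:E)%E.
  have [N _ hN] := upper k.
  have upper' : \forall n \near \oo,
      (b n.+1 < (expR (n.+1%:R * (D + k.+1%:R^-1)))%:E)%E.
    by exists N => // n /= Nn; apply: hN => /=; exact: leqW.
  apply: filterS2 (lower k) upper' => n -> /= /ltW h; rewrite andbT.
  rewrite leeNr -EFinN -mulrN opprB opprK addrC.
  apply: le_trans (_ : lne (expR (n.+1%:R * (D + k.+1%:R^-1)))%:E <= _)%E.
    by rewrite lee_lne// in_itv/= ?b0 ?leey// lee_fin expR_ge0.
  by rewrite lne_EFin ?expR_gt0// expRK lexx.
have fin_of (n : nat) (x y : R) : (x%:E <= - lne (b n) <= y%:E)%E ->
    lne (b n) \is a fin_num.
  move=> /andP[h1 h2]; rewrite -fin_numN fin_numE -ltNye -ltey.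
  by rewrite (lt_le_trans _ h1) ?ltNyr// (le_lt_trans h2) ?ltry.
split; first by apply: filterS (bounds 0%N) => n; exact: fin_of.
apply: cvg_of_le => k; apply: filterS (bounds k) => n hn.
have n0 : 0 < n.+1%:R :> R by rewrite ltr0n.
have fin := fin_of _ _ _ hn.
move: hn; rewrite -(@fineK _ (- lne (b n.+1))%E) ?fin_numN// !lee_fin => /andP[h1 h2].
by rewrite mulrC ler_pdivlMr// ler_pdivrMr// !(mulrC _ n.+1%:R) h1.
Qed.

Theorem mainTheorem14 (R : realType)
  (* mu = N(m, s^2), s > 0 *)
  (m s : R) (s_gt0 : 0 < s)
  (* the nested partitions chi_l and universal measures R^l *)
  (K : nat -> nat) (q : nat -> R -> nat)
  (Q : nat -> probability (pathspace nat) R)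
  (hpart : nested_partitions K q)
  (hQ : forall l, universal (K l) (Q l))
  (* the process P in E *)
  (P : probability (pathspace R) R)
  (hP : stationary_ergodic P)
  (* P_n << lambda^n, with density P_lambda = f n *)
  (f : forall n : nat, n.-tuple R -> R)
  (f_meas : forall n, measurable_fun [set: n.-tuple R] (f n))
  (f_ge0 : forall n t, 0 <= f n t)
  (f_dens : forall n (A : set (n.-tuple R)), measurable A ->
     P (block n @^-1` A) = (\int[@lebesgue_n R n]_(t in A) (f n t)%:E)%E)
  (* finite mean and variance *)
  (mean_fin : forall i : int,
     P.-integrable [set: pathspace R] (fun w => (w i)%:E))
  (var_fin : forall i : int,
     P.-integrable [set: pathspace R] (fun w => (w i ^+ 2)%:E))
  (* |h_lambda| < oo *)
  (h : R)
  (h_rate : (fun n : nat => ((n.+1%:R^-1)%:E *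
       \int[P]_w (- lne (f n.+1 (block n.+1 w))%:E))%E) @ \oo --> h%:E) :
  {ae P, forall w : pathspace R,
     (fun n : nat =>
        ((n.+1%:R^-1)%:E *
           (- lne (NPD m s q Q (block n.+1 w)) +
            (\sum_(i < n.+1) (w (Posz i.+1) - m) ^+ 2 / (2 * s ^+ 2))%:E)
         + (ln (s * Num.sqrt (2 * pi)))%:E)%E)
     @ \oo --> h%:E}.
Proof.
have L_int := log_ratio_integrable m s_gt0 hP.1 f_meas f_ge0 f_dens
  (mean_fin 1) (var_fin 1) h_rate.
pose V := \int[P]_w gauss_energy m s (w 1).
pose D := - h + (V + gauss_const s).
have L_cvg : (fun n => n%:R^-1 * \int[P]_w log_ratio m s f n w) @ \oo --> D :=
  log_ratio_cvg s_gt0 hP.1 f_meas f_ge0 f_dens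
  (mean_fin 1) (var_fin 1) h_rate.
have lower : {ae P, forall w : pathspace R, forall k : nat, \forall n \near \oo,
    (- lne (npd_seq m s q Q (block n.+1 w)) <= (n.+1%:R * (- D + k.+1%:R^-1))%:E)%E}.
  apply: ae_all => k.
  by apply: (ae_npd_lower_bound s_gt0 hpart hQ hP f_meas f_ge0 f_dens L_int L_cvg).
have upper : {ae P, forall w : pathspace R, forall k : nat, \forall n \near \oo,
    (npd_seq m s q Q (block n w) < (expR (n%:R * (D + k.+1%:R^-1)))%:E)%E}.
  apply: ae_all => k.
  apply: (eventually_lt_subdensity s_gt0 hP f_meas f_ge0 f_dens L_int L_cvg).
  - by move=> n; exact: (mseq_npd m s hpart Q (n := n)).
  - exact: npd_seq_ge0.
  - exact: (itint_npd m s hpart Q).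
  - by rewrite ltrDl invr_gt0.
have energy := birkhoff hP (integrable_energy m s (mean_fin 1) (var_fin 1)).
have := ae_mono2 (fun w a b => conj a b) energy (ae_mono2 (fun w a b => conj a b) lower upper).
apply: ae_mono => w [{}energy [{}lower {}upper]].
have [fin rate] := lne_npd_rate (fun n => npd_seq_ge0 _ _ _ _ _) lower upper.
have cv : (fun n : nat => (n.+1%:R^-1 *
    fine (- lne (npd_seq m s q Q (block n.+1 w)))%E + n.+1%:R^-1 *
    \sum_(i < n.+1) gauss_energy m s (iter i (@Defs.shift _ R) w 1)
    + gauss_const s)%:E) @ \oo --> h%:E.
  (* Birkhoff's theorem for the Gaussian energy supplies V, which cancels the V in D. *)
  have -> : h = - D + V + gauss_const s by rewrite /D; ring.
  apply: cvg_EFin; first exact: nearW.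
  by apply: cvgD; [exact: cvgD|exact: cvg_cst].
apply: cvg_trans cv.
apply: near_eq_cvg; apply: filterS fin => n fin.
rewrite NPDE -[in RHS](fineK fin) -EFinN -EFinD mulrDr fineN.
congr (_ + _ * _ + _)%:E; apply: eq_bigr => i _.
by rewrite iter_shiftE -PoszD add1n.
Qed.
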